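(* Every oriented graph embeddable on $\mathbb{S}_5$ or $\mathbb{N}_{10}$ is $4$-dicolourable.
   Context: $\mathbb{S}_k$ denotes the sphere with $k$ handles and $\mathbb{N}_k$ the sphere with $k$ cross-caps. A $k$-dicolouring of a digraph is a partition of its vertex set into $k$ subsets each inducing an acyclic subdigraph (no directed cycle); a digraph is $k$-dicolourable if it has a $k$-dicolouring. An oriented graph is a digraph obtained from a finite simple graph (its underlying graph) by replacing each edge by exactly one of the two possible arcs; it is embeddable on a surface if its underlying graph is. *)

(* Defs.v *)
From HB Require Import structures.
From Stdlib Require Import Relations.
From mathcomp Require Import all_boot all_order all_algebra.
From mathcomp Require Import all_classical all_reals all_analysis.

Set Implicit Arguments.
Unset Strict Implicit.
Unset Printing Implicit Defensive.

Import Order.TTheory GRing.Theory Num.Theory.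
Import numFieldNormedType.Exports.

Local Open Scope classical_set_scope.
Local Open Scope ring_scope.

(** * Digraphs *)

Definition oriented (V : finType) (d : rel V) : Prop :=
  forall u v : V, d u v -> ~~ d v u.

Definition underlying (V : finType) (d : rel V) : rel V :=
  fun u v => d u v || d v u.

(* [ucycle d p]: the sequence p of distinct vertices, read cyclically, follows
   arcs of d; the empty sequence satisfies it and has to be excluded. *)
Definition acyclic_on (V : finType) (d : rel V) (A : {set V}) : Prop :=
  forall p : seq V, p != [::] -> {subset p <= A} -> ~ ucycle d p.

(* The parts of the partition are the fibres of c, some of which may be
   empty. *)
Definition dicolourable (k : nat) (V : finType) (d : rel V) : Prop :=
  exists c : V -> 'I_k, forall i : 'I_k, acyclic_on d [set v | c v == i]%SET.

(** * Identification spaces *)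

Section Glue.
Variables (T : topologicalType) (r : T -> T -> Prop).

Definition glue_eqb : rel T := fun x y => `[< clos_refl_sym_trans T r x y >].

Lemma glue_eqb_refl : reflexive glue_eqb.
Proof. by move=> x; apply/asboolP; apply: rst_refl. Qed.

Lemma glue_eqb_sym : symmetric glue_eqb.
Proof. by move=> x y; apply/asboolP/asboolP; apply: rst_sym. Qed.

Lemma glue_eqb_trans : transitive glue_eqb.
Proof.
by move=> y x z /asboolP xy /asboolP yz; apply/asboolP; apply: rst_trans yz.
Qed.

Definition glue_equiv : equiv_rel T :=
  EquivRel glue_eqb glue_eqb_refl glue_eqb_sym glue_eqb_trans.

(* T with the points related by r identified, with the quotient topology. *)
Definition glued : topologicalType :=
  quotient_topology {eq_quot glue_equiv}%qT.

End Glue.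

(** * Closed surfaces *)

Section Surfaces.
Variable R : realType.

(* The sphere is R^2 with a point at infinity. *)
Definition sphere : topologicalType := one_point_compactification (R * R)%type.

Definition centre (i : nat) : R * R := ((4 * i)%:R, 0).

(* The norm of R * R is the sup norm: the i-th disc is the closed square with
   centre (4 i, 0) and side 2, and its boundary is
   [set centre i + v | v in [set v | `|v| = 1]]. The discs are pairwise
   disjoint. *)
Definition open_disc (i : nat) : set sphere :=
  [set Some x | x in ball (centre i) 1].

(* The sphere minus the interiors of n pairwise disjoint closed discs. *)
Definition holed_sphere (n : nat) : topologicalType :=
  set_type (~` \bigcup_(i in `I_n) open_disc i).

(* The i-th handle: the boundaries of the discs 2i and 2i+1 are identified by
   a reflection, so that their orientations, as circles in the plane, disagree
   (a translation would attach a Klein handle instead). *)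
Definition handle_glue (k : nat) (p q : holed_sphere k.*2) : Prop :=
  exists (i : nat) (v : R * R),
    [/\ (i < k)%N, `|v| = 1,
        set_val p = Some (centre i.*2 + v) &
        set_val q = Some (centre i.*2.+1 + (- v.1, v.2))].

(* The i-th cross-cap: opposite points of the boundary of the i-th disc are
   identified. *)
Definition crosscap_glue (k : nat) (p q : holed_sphere k) : Prop :=
  exists (i : nat) (v : R * R),
    [/\ (i < k)%N, `|v| = 1,
        set_val p = Some (centre i + v) &
        set_val q = Some (centre i - v)].

Definition sphere_handles (k : nat) : topologicalType :=
  glued (@handle_glue k).

Definition sphere_crosscaps (k : nat) : topologicalType :=
  glued (@crosscap_glue k).

(** * Embeddings of graphs *)

(* A is a simple (injectively parametrised) curve of S from x to y. *)
Definition simple_curve (S : topologicalType) (A : set S) (x y : S) : Prop :=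
  exists g : R -> S,
    [/\ {within `[0, 1], continuous g},
        {in `[0, 1] &, injective g},
        g 0 = x, g 1 = y & A = g @` `[0, 1]].

(* e is the adjacency relation of a simple graph; the edge uv is represented
   by the unordered pair [set u; v]. Vertices go to distinct points and edges
   to simple curves between their ends; a curve contains no image of a vertex
   other than its ends, and distinct curves meet only at images of common
   ends. *)
Definition embeddable (S : topologicalType) (V : finType) (e : rel V) : Prop :=
  exists (f : V -> S) (A : {set V} -> set S),
    [/\ injective f,
        forall u v, e u v -> simple_curve (A [set u; v]%SET) (f u) (f v),
        forall u v w, e u v -> A [set u; v]%SET (f w) ->
          w \in [set u; v]%SET &
        forall u v u' v', e u v -> e u' v' ->
          [set u; v]%SET != [set u'; v']%SET ->
          A [set u; v]%SET `&` A [set u'; v']%SET `<=`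
          [set f w | w in [set` ([set u; v] :&: [set u'; v'])%SET]]].

End Surfaces.

(* Main.v *)
Require Import Defs.
From mathcomp Require Import all_boot zify.
From mathcomp.classical Require Import boolp.

(** Each of the two surfaces has Euler characteristic -8. So a simple graph with
    n >= 1 vertices embedded in one of them has at most 3 n + 24 edges, and the
    same holds for the subgraph induced by any nonempty set of vertices. The
    proof derives this bound ([embedded_edge_bound]) and then shows that an
    oriented graph in which every nonempty set W spans at most 3 |W| + 24 arcs
    is 4-dicolourable ([sparse_dicol4]).

    The edge bound uses neither triangulations nor the Jordan curve theorem.
    The surface is replaced by a fine square grid: N steps per unit, in a box
    that grows with N, with the points and edges on the boundaries of the holes
    glued as in the surface. A grid point sees a point of the surface if its
    open star contains it. The grid points that see some point of a connected
    set form a connected set of the grid graph ([thick_conn]); those of two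
    disjoint compact sets are disjoint once the grid is fine ([compact_sep]).
    So an embedded graph is a minor of the grid graph. The grid is a cell
    complex in which the cycles modulo 2 fall into at most 2^10 classes modulo
    boundaries ([grid_hom]): a cycle that crosses each cross-cap evenly, or
    that crosses the handles evenly in the two ways, can be pushed off the
    holes and bounds in the plane ([planar_cycle]). For a minor with n
    vertices and m edges there are at least 2^(m-n+1) cycles modulo 2; at most
    2^(f-1) of them bound, f being the number of regions, and 3 f <= 2 m as
    every region has at least three edges on its rim. Hence
    m - n + 1 <= 10 + f - 1, which is the bound ([minor_edge_bound]).

    For the colouring, let W be minimal among the sets that are not
    4-dicolourable, with n vertices and m arcs. All in- and out-degrees in W
    are at least 4, so 4 n <= m <= 3 n + 24. If n <= 18, remove a maximal
    acyclic set of suitable size. What remains is not 3-dicolourable, so it has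
    more than ten vertices ([dicol3_le10]) and contains a set critical for
    three colours, on 11 or 12 vertices, which would need more arcs than there
    are ([critical3_card11], [critical3_card12], [excess]). If n >= 19, most
    vertices are low: their degree is exactly 8. As in Gallai's theorem on
    critical graphs, moving an uncoloured vertex along the edges shows that
    every cycle of the underlying graph through low vertices only is a
    directed cycle ([low_cycle_directed]). So the low vertices induce few arcs
    ([low_arcs]) and are 2-dicolourable, even together with one further vertex
    ([low_dicol2]); and the other vertices span at most 16 arcs, after the
    removal of one of them if necessary, and are 2-dicolourable as well
    ([dicol2_sparse]). *)

Set Implicit Arguments.
Unset Strict Implicit.
Unset Printing Implicit Defensive.

(** * Acyclic sets and dicolourings *)

Section Colouring.
Variables (V : finType) (d : rel V).
Hypothesis orient : forall u v, d u v -> ~~ d v u.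
Implicit Types (A B H S U W : {set V}) (u v w x y z : V).

Lemma dF v : d v v = false.
Proof. by apply/negP => dv; move: (orient dv); rewrite dv. Qed.

Definition inn W v := [set u in W | d u v].
Definition out W v := [set u in W | d v u].
Definition din W v := #|inn W v|.
Definition dout W v := #|out W v|.
Definition deg W v := din W v + dout W v.
Definition arcs W := [set p : V * V | [&& p.1 \in W, p.2 \in W & d p.1 p.2]].
Definition size_arcs W := #|arcs W|.
Local Notation e := size_arcs.

(** Going backwards along arcs inside a nonempty set without a source closes a
    directed cycle ([acyclic_no_cycle]). The form with sources is decidable
    and suits the addition of one vertex. *)
Definition acyclic A := [forall B : {set V}, (B \subset A) && (B != set0) ==>
  [exists v in B, [forall u in B, ~~ d u v]]].

Lemma acyclicP A : reflect (forall B, B \subset A -> B != set0 ->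
    exists2 v, v \in B & forall u, u \in B -> ~~ d u v) (acyclic A).
Proof.
apply: (iffP forallP) => h B.
  move=> BA B0; have := h B; rewrite BA B0 => /existsP[v /andP[vB /forallP vP]].
  by exists v => // u uB; have := vP u; rewrite uB.
apply/implyP => /andP[BA B0]; have [v vB vP] := h B BA B0.
apply/existsP; exists v; rewrite vB; apply/forallP => u; apply/implyP; exact: vP.
Qed.

Lemma acyclic_sub A B : B \subset A -> acyclic A -> acyclic B.
Proof.
by move=> BA /acyclicP h; apply/acyclicP => C CB; apply: h; apply: subset_trans BA.
Qed.

Lemma acyclic0 : acyclic set0.
Proof. by apply/acyclicP => B; rewrite subset0 => /eqP->; rewrite eqxx. Qed.

(** Without in-neighbours, v is a source of every set that contains it;
    without out-neighbours, a source of the rest of such a set remains a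
    source. *)
Lemma acyclic_add A v : acyclic A -> (inn A v == set0) || (out A v == set0) -> acyclic (v |: A).
Proof.
move=> Aa io; apply/acyclicP => B BA B0.
have BvA : B :\ v \subset A by rewrite subDset.
have sub u : u \in B -> u != v -> u \in A.
  by move=> uB uv; apply: (subsetP BvA); rewrite !inE uv.
have [vB|vB] := boolP (v \in B); last first.
  move/acyclicP: Aa; apply => //; apply/subsetP => u uB; apply: sub => //.
  by apply: contraNneq vB => <-.
case/orP: io => [/eqP io|/eqP io].
  exists v => // u uB; have [->|uv] := eqVneq u v; first by rewrite dF.
  by apply/negP => duv; have := in_set0 u; rewrite -io inE sub // duv.
have [Bv|Bv] := eqVneq (B :\ v) set0.
  exists v => // u uB; have [->|uv] := eqVneq u v; first by rewrite dF.
  by have := in_set0 u; rewrite -Bv !inE uv uB.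
have [x xB xP] := acyclicP _ Aa _ BvA Bv; move: xB; rewrite !inE => /andP[xv xB].
exists x => // u uB; have [->|uv] := eqVneq u v; last by apply: xP; rewrite !inE uv.
by apply/negP => dvx; have := in_set0 x; rewrite -io inE sub // dvx.
Qed.

Definition dicol k W := [exists c : {ffun V -> 'I_k}, [forall i, acyclic [set v in W | c v == i]]].

Lemma dicolP k W : reflect (exists c : V -> 'I_k, forall i, acyclic [set v in W | c v == i]) (dicol k W).
Proof.
apply: (iffP existsP) => -[c cP]; first by exists c => i; move/forallP: cP.
exists [ffun v => c v]; apply/forallP => i; move: (cP i); congr acyclic.
by apply/setP => v; rewrite !inE ffunE.
Qed.

Lemma dicol_sub k W W' : W' \subset W -> dicol k W -> dicol k W'.
Proof.
move=> WW /dicolP[c cP]; apply/dicolP; exists c => i; apply: acyclic_sub (cP i).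
by apply/subsetP => v; rewrite !inE => /andP[/(subsetP WW)-> ->].
Qed.

Lemma dicol_union k l A B : dicol k A -> dicol l B -> dicol (k + l) (A :|: B).
Proof.
move=> /dicolP[c cP] /dicolP[c' cP']; apply/dicolP.
exists (fun v => if v \in A then lshift l (c v) else rshift k (c' v)) => i.
case: (splitP i) => j ij.
  apply: acyclic_sub (cP j); apply/subsetP => v; rewrite !inE => /andP[vAB].
  case: ifP => vA /eqP/(congr1 val) /=; rewrite ij; first by move/val_inj->; rewrite eqxx.
  by have := ltn_ord j; lia.
apply: acyclic_sub (cP' j); apply/subsetP => v; rewrite !inE => /andP[vAB].
case: ifP vAB => vA vAB /eqP/(congr1 val) /=; rewrite ij; first by have := ltn_ord (c v); lia.
by move/addnI/val_inj ->; rewrite eqxx andbT.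
Qed.

Lemma dicol1 A : acyclic A -> dicol 1 A.
Proof.
move=> Aa; apply/dicolP; exists (fun=> ord0) => i; apply: acyclic_sub Aa.
by apply/subsetP => v; rewrite inE => /andP[].
Qed.

Lemma dicol0 k : 0 < k -> dicol k set0.
Proof.
case: k => // k _; apply/dicolP; exists (fun=> ord0) => i.
by rewrite (_ : [set _ in _ | _] = set0) ?acyclic0 //; apply/setP => v; rewrite !inE.
Qed.

Lemma dicol_peel k W A : acyclic A -> dicol k (W :\: A) -> dicol k.+1 W.
Proof.
move=> /dicol1 Aa cW; rewrite -add1n; apply: dicol_sub (dicol_union Aa cW).
by apply/subsetP => v vW; rewrite !inE vW; case: (v \in A).
Qed.

(** Fewer than k in-neighbours, or out-neighbours, miss some colour, and v can
    join the class of that colour. *)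
Lemma dicol_greedy k W v : dicol k W -> (din W v < k) || (dout W v < k) -> dicol k (v |: W).
Proof.
move=> /dicolP[c cP] deg_lt; wlog vW : / v \notin W.
  move=> h; have [vW|] := boolP (v \in W); last exact: h.
  have -> : v |: W = W by apply/setUidPr; rewrite sub1set.
  by apply/dicolP; exists c.
have free (S : {set V}) : #|S| < k -> exists i, [forall u in S, c u != i].
  move=> Sk; have : #|c @: S| < #|'I_k| by rewrite card_ord (leq_ltn_trans (leq_imset_card _ _)).
  rewrite ltnNge => nS; have [i iS] : exists i, i \notin c @: S.
    apply/existsP; apply: contraR nS; rewrite negb_exists => /forallP h.
    by rewrite subset_leq_card //; apply/subsetP => i _; have := h i; rewrite negbK.
  exists i; apply/forallP => u; apply/implyP => uS; apply: contraNneq iS => <-.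
  exact: imset_f.
have [i iP] : exists i, (inn [set u in W | c u == i] v == set0) ||
    (out [set u in W | c u == i] v == set0).
  case/orP: deg_lt => /free[i /forallP iP]; exists i; apply/orP; [left|right];
    apply/eqP/setP => u; rewrite !inE; apply/negP => /andP[/andP[uW cu] duv];
    by have := iP u; rewrite inE uW duv cu.
apply/dicolP; exists (fun u => if u == v then i else c u) => j.
have [->|ji] := eqVneq j i.
  apply: acyclic_sub (acyclic_add (cP i) iP); apply/subsetP => u; rewrite !inE.
  by case: (eqVneq u v).
apply: acyclic_sub (cP j); apply/subsetP => u; rewrite !inE.
case: (eqVneq u v) => //= _; by rewrite eq_sym (negPf ji).
Qed.

Definition critical k W := ~~ dicol k W && [forall v in W, dicol k (W :\ v)].

Lemma critical_exists k W : ~~ dicol k W -> exists2 H : {set V}, H \subset W & critical k H.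
Proof.
move=> nW; have [H HP Hmin] := @arg_minnP {set V} W (fun H : {set V} => (H \subset W) && ~~ dicol k H)
  (fun H : {set V} => #|H|) (introT andP (conj (subxx W) nW)).
case/andP: HP => HW nH; exists H => //; rewrite /critical nH; apply/forallP => v.
apply/implyP => vH; apply: contraT => nHv.
have := Hmin (H :\ v); rewrite nHv (subset_trans (subsetDl _ _) HW) => /(_ isT).
by rewrite (cardsD1 v H) vH ltnn.
Qed.

Lemma critical_ndicol k W : critical k W -> ~~ dicol k W. Proof. by case/andP. Qed.

Lemma inn_D1 W v : inn (W :\ v) v = inn W v.
Proof. by apply/setP => u; rewrite !inE; have [->|uv] := eqVneq u v; rewrite ?dF ?andbF. Qed.

Lemma out_D1 W v : out (W :\ v) v = out W v.
Proof. by apply/setP => u; rewrite !inE; have [->|uv] := eqVneq u v; rewrite ?dF ?andbF. Qed.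

(** A vertex of smaller in- or out-degree could be coloured last, by
    [dicol_greedy]. *)
Lemma critical_deg k W v : critical k W -> v \in W -> k <= din W v /\ k <= dout W v.
Proof.
move=> /andP[nW /forallP cW] vW; have := cW v; rewrite vW /= => cv.
suff : ~~ ((din W v < k) || (dout W v < k)) by rewrite negb_or -!leqNgt => /andP.
apply: contra nW => lt; rewrite -(setD1K vW); apply: dicol_greedy => //.
by rewrite /din /dout inn_D1 out_D1.
Qed.

Lemma critical_neq0 k W : 0 < k -> critical k W -> exists v, v \in W.
Proof.
move=> k0 /critical_ndicol nW; apply/set0Pn; apply: contraNneq nW => ->; exact: dicol0.
Qed.

Lemma sum_din W S : \sum_(v in S) din W v = \sum_(u in W) dout S u.
Proof.
rewrite /din /dout; under eq_bigr do rewrite -sum1dep_card.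
under [RHS]eq_bigr do rewrite -sum1dep_card.
rewrite (exchange_big_dep (mem W)) /=; last by move=> v u _ /andP[].
by apply: eq_bigr => u uW; apply: eq_bigl => v; rewrite uW.
Qed.

Lemma size_arcs_din W : e W = \sum_(v in W) din W v.
Proof.
rewrite /e -sum1_card (eq_bigr (fun=> 1)) // /arcs.
under [RHS]eq_bigr do rewrite /din -sum1dep_card.
rewrite pair_big_dep /=.
rewrite [RHS](reindex_onto (fun p : V * V => (p.2, p.1)) (fun p => (p.2, p.1))) /=; last by case.
apply: eq_bigl => -[u v]; rewrite !inE /= eqxx andbT.
by rewrite andbCA.
Qed.

Lemma size_arcs_dout W : e W = \sum_(v in W) dout W v.
Proof. by rewrite size_arcs_din sum_din. Qed.

Lemma sum_deg W : \sum_(v in W) deg W v = 2 * e W.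
Proof. by rewrite big_split /= -size_arcs_din -size_arcs_dout mul2n addnn. Qed.

Lemma sum_degC A B : \sum_(v in A) deg B v = \sum_(v in B) deg A v.
Proof. by rewrite !big_split /= !sum_din addnC -!sum_din. Qed.

Lemma din_setID W S v : din W v = din (W :&: S) v + din (W :\: S) v.
Proof.
rewrite /din -(cardsID S (inn W v)); congr (_ + _); apply: eq_card => u; rewrite !inE.
  by rewrite andbAC.
by rewrite andbA.
Qed.

Lemma dout_setID W S v : dout W v = dout (W :&: S) v + dout (W :\: S) v.
Proof.
rewrite /dout -(cardsID S (out W v)); congr (_ + _); apply: eq_card => u; rewrite !inE.
  by rewrite andbAC.
by rewrite andbA.
Qed.

Lemma deg_split W A v : A \subset W -> deg W v = deg A v + deg (W :\: A) v.
Proof.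
move=> AW; rewrite /deg (din_setID W A) (dout_setID W A) (setIidPr AW); lia.
Qed.

Lemma sum_split W A (F : V -> nat) : A \subset W ->
  \sum_(v in W) F v = \sum_(v in A) F v + \sum_(v in W :\: A) F v.
Proof.
move=> AW; rewrite (big_setID A) /= (setIidPr AW) //.
Qed.

Lemma size_arcs_split W A : A \subset W ->
  e W = e A + e (W :\: A) + \sum_(v in A) deg (W :\: A) v.
Proof.
move=> AW; have := sum_deg W; rewrite (sum_split _ AW).
have sp S : \sum_(v in S) deg W v = \sum_(v in S) deg A v + \sum_(v in S) deg (W :\: A) v.
  by rewrite -big_split; apply: eq_bigr => v _; exact: deg_split.
rewrite !sp !sum_deg (sum_degC (W :\: A) A); lia.
Qed.

Lemma deg_lt W v : v \in W -> deg W v < #|W|.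
Proof.
move=> vW; rewrite (cardsD1 v W) vW ltnS /deg /din /dout -cardsUI.
rewrite (_ : inn W v :&: out W v = set0) ?cards0 ?addn0; last first.
  apply/setP => u; rewrite !inE; apply/negP => /andP[/andP[_ uv] /andP[_ vu]].
  by move: (orient uv); rewrite vu.
apply: subset_leq_card; apply/subsetP => u; rewrite !inE.
case: (eqVneq u v) => [->|_]; first by rewrite dF !andbF.
by case/orP => /andP[].
Qed.

Lemma size_arcs_le W : 2 * e W <= #|W| * #|W|.-1.
Proof.
rewrite -sum_deg -sum_nat_const; apply: leq_sum => v vW; have := deg_lt vW; lia.
Qed.

Lemma low_indegree W t : e W < #|W| * t.+1 -> exists2 v, v \in W & din W v <= t.
Proof.
move=> lt; have [v /andP[vW vt]|no] := pickP (fun v => (v \in W) && (din W v <= t)).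
  by exists v.
move: lt; rewrite ltnNge => /negP[]; rewrite size_arcs_din -sum_nat_const.
apply: leq_sum => v vW; have := no v; rewrite vW /= => /negbT; lia.
Qed.

Lemma critical_arcs k W : critical k W -> k * #|W| <= e W.
Proof.
move=> cW; rewrite size_arcs_din mulnC -sum_nat_const; apply: leq_sum => v vW.
by case: (critical_deg cW vW).
Qed.

(** * Large acyclic sets *)

Definition has_acyclic W a := [exists A : {set V}, [&& A \subset W, acyclic A & a <= #|A|]].

Lemma has_acyclicP W a : reflect (exists A, [/\ A \subset W, acyclic A & a <= #|A|]) (has_acyclic W a).
Proof. by apply: (iffP existsP) => -[A /and3P ?]; exists A. Qed.

Lemma has_acyclic_sub W W' a a' : W' \subset W -> a <= a' -> has_acyclic W' a' -> has_acyclic W a.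
Proof.
move=> WW aa /has_acyclicP[A [AW Aa Ac]]; apply/has_acyclicP; exists A.
by split=> //; [exact: subset_trans AW WW|exact: leq_trans aa Ac].
Qed.

(** Any acyclic set of these vertices remains acyclic when v is added as a
    source. *)
Definition nonin W v := [set u in W | (u != v) && ~~ d u v].

Lemma card_nonin W v : v \in W -> #|nonin W v| + din W v + 1 = #|W|.
Proof.
move=> vW; rewrite (cardsD1 v W) vW /din -inn_D1.
rewrite -(cardsID (inn (W :\ v) v) (W :\ v)).
have -> : (W :\ v) :&: inn (W :\ v) v = inn (W :\ v) v.
  by apply/setIidPr/subsetP => u; rewrite inE => /andP[].
have -> : (W :\ v) :\: inn (W :\ v) v = nonin W v; last lia.
by apply/setP => u; rewrite !inE; case: (u \in W); case: (u == v); case: (d u v).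
Qed.

Lemma nonin_add A W v : A \subset nonin W v -> acyclic A -> acyclic (v |: A) /\ #|v |: A| = #|A|.+1.
Proof.
move=> AW Aa; split.
  apply: acyclic_add => //; apply/orP; left; apply/eqP/setP => u; rewrite !inE.
  by apply/negP => /andP[/(subsetP AW)]; rewrite !inE => /and3P[_ _ /negPf->].
rewrite cardsU1; suff -> : v \notin A by [].
by apply/negP => /(subsetP AW); rewrite !inE eqxx andbF.
Qed.

Lemma nonin_sub W v : nonin W v \subset W.
Proof. by apply/subsetP => u; rewrite inE => /andP[]. Qed.

Lemma has_acyclic_nonin W v a : v \in W -> has_acyclic (nonin W v) a -> has_acyclic W a.+1.
Proof.
move=> vW /has_acyclicP[A [AW Aa Ac]]; have [vAa vAc] := nonin_add AW Aa.
apply/has_acyclicP; exists (v |: A); split; rewrite ?vAc // subUset sub1set vW.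
exact: subset_trans AW (nonin_sub W v).
Qed.

Lemma has_acyclic1 W : 0 < #|W| -> has_acyclic W 1.
Proof.
move=> /card_gt0P[v vW]; apply: (has_acyclic_nonin vW); apply/has_acyclicP; exists set0.
by rewrite sub0set acyclic0.
Qed.

(** Some in-degree is at most the average, so [nonin W v] is large for some
    v. *)
Lemma has_acyclic_step W a t n : e W < n * t.+1 -> n <= #|W| ->
  (forall v, v \in W -> #|W| <= #|nonin W v| + t + 1 -> has_acyclic (nonin W v) a) ->
  has_acyclic W a.+1.
Proof.
move=> lt nW h; have [|v vW vt] := @low_indegree W t.
  by apply: leq_trans lt _; rewrite leq_mul2r nW orbT.
apply: (has_acyclic_nonin vW); apply: h => //; have := card_nonin vW; lia.
Qed.

Lemma has_acyclic2 W : 1 < #|W| -> has_acyclic W 2.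
Proof.
move=> W1; have le := size_arcs_le W.
apply: (@has_acyclic_step W 1 (#|W|.-1./2) #|W|) => //.
  case: #|W| le W1 => //= n le n1; have := odd_double_half n; nia.
by move=> v vW; move=> h; apply: has_acyclic1; have := odd_double_half (#|W|.-1); lia.
Qed.

Lemma subset_card W n : n <= #|W| -> exists2 W' : {set V}, W' \subset W & #|W'| = n.
Proof.
elim: n => [_|n IH lt]; first by exists set0; rewrite ?sub0set ?cards0.
have [W' W'W cW'] := IH (ltnW lt).
have /properP[_ [v vW vW']] : W' \proper W by rewrite properEcard W'W cW'.
by exists (v |: W'); rewrite ?subUset ?sub1set ?vW // cardsU1 vW' cW'.
Qed.

Lemma has_acyclic3 W : 3 < #|W| -> has_acyclic W 3.
Proof.
move=> /subset_card[W' W'W c4]; apply: (has_acyclic_sub W'W (leqnn 3)).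
have le := size_arcs_le W'; rewrite c4 in le.
by apply: (@has_acyclic_step W' 2 1 4); rewrite ?c4 //; [lia|move=> v vW h; apply: has_acyclic2; lia].
Qed.

Lemma has_acyclic4 W : 7 < #|W| -> has_acyclic W 4.
Proof.
move=> /subset_card[W' W'W c4]; apply: (has_acyclic_sub W'W (leqnn 4)).
have le := size_arcs_le W'; rewrite c4 in le.
by apply: (@has_acyclic_step W' 3 3 8); rewrite ?c4 //; [lia|move=> v vW h; apply: has_acyclic3; lia].
Qed.

(** The only obstruction is a tournament: with fewer than 21 arcs some vertex
    has in-degree at most 2, and four vertices remain for the search. *)
Lemma has_acyclic7 W : #|W| = 7 -> e W < 21 -> has_acyclic W 4.
Proof.
move=> c7 e21; apply: (@has_acyclic_step W 3 2 7); rewrite ?c7 //.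
by move=> v vW h; apply: has_acyclic3; lia.
Qed.

(** * Digraphs with at most ten vertices *)

Lemma acyclic_list (s : seq V) : pairwise (fun x y => ~~ d y x) s -> acyclic [set x in s].
Proof.
elim: s => [|x s IH] /=.
  by move=> _; rewrite (_ : [set _ in _] = set0) ?acyclic0 //; apply/setP => x; rewrite !inE.
move=> /andP[/allP xs /IH sa].
have -> : [set y in x :: s] = x |: [set y in s] by apply/setP => y; rewrite !inE.
apply: acyclic_add => //; apply/orP; left; apply/eqP/setP => u; rewrite !inE.
by apply/negP => /andP[/xs /negPf->].
Qed.

Lemma acyclic_pair x y : acyclic [set x; y].
Proof.
have [xy|xy] := boolP (d y x).
  have := @acyclic_list [:: y; x]; rewrite /= (orient xy) => /(_ isT); apply: acyclic_sub.
  by apply/subsetP => z; rewrite !inE orbC.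
have := @acyclic_list [:: x; y]; rewrite /= xy => /(_ isT); apply: acyclic_sub.
by apply/subsetP => z; rewrite !inE.
Qed.

Lemma acyclic_triple_mid x y z : ~~ acyclic [set x; y; z] ->
  (d y x && d x z) || (d z x && d x y).
Proof.
apply: contraR; rewrite negb_or => h.
have -> : [set x; y; z] = x |: [set y; z] by apply/setP => u; rewrite !inE orbA.
apply: acyclic_add (acyclic_pair _ _) _; apply: contraT; rewrite negb_or.
move=> /andP[/set0Pn[u] + /set0Pn[w]]; rewrite !inE => /andP[uyz ux] /andP[wyz xw].
move: ux xw; case/orP: uyz => /eqP->; case/orP: wyz => /eqP-> ux xw.
- by have := orient ux; rewrite xw.
- by rewrite ux xw in h.
- by rewrite ux xw andbF in h.
- by have := orient ux; rewrite xw.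
Qed.

Lemma acyclic_triple x y z : ~~ acyclic [set x; y; z] ->
  [&& d x y, d y z & d z x] || [&& d x z, d z y & d y x].
Proof.
move=> xyz; have := acyclic_triple_mid xyz.
rewrite setUC setUA in xyz; have := acyclic_triple_mid xyz => + h.
case/orP: h => /andP[h1 h2]; case/orP=> /andP[h3 h4].
- by rewrite h1 h2 h4 orbT.
- by have := orient h2; rewrite h4.
- by have := orient h1; rewrite h3.
- by rewrite h2 h3 h1.
Qed.

(** Lower bounds on the number of arcs come from explicit lists: L names arcs
    by the positions of their ends in vs. *)
Lemma arcs_list (x0 : V) (vs : seq V) (L : seq (nat * nat)) W : uniq vs -> uniq L ->
  all (fun p => (p.1 < size vs) && (p.2 < size vs)) L -> {subset vs <= W} ->
  all (fun p => d (nth x0 vs p.1) (nth x0 vs p.2)) L -> size L <= e W.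
Proof.
move=> uv uL /allP Lb sW /allP Ld.
pose g (p : nat * nat) := (nth x0 vs p.1, nth x0 vs p.2).
have ug : uniq (map g L).
  rewrite map_inj_in_uniq // => -[i j] [i' j'] /Lb /= /andP[i1 j1] /Lb /= /andP[i2 j2] [].
  by move=> /eqP; rewrite nth_uniq // => /eqP-> /eqP; rewrite nth_uniq // => /eqP->.
rewrite -(size_map g) -(card_uniqP ug); apply: subset_leq_card; apply/subsetP => q.
move=> /mapP[p pL ->]; have /andP[p1 p2] := Lb p pL.
by rewrite inE /= !sW ?mem_nth // (Ld p pL).
Qed.

Lemma two_parts H A B : critical 2 H -> acyclic A -> acyclic B -> H \subset A :|: B -> False.
Proof.
move=> cH /dicol1 cA /dicol1 cB HAB; move/negP: (critical_ndicol cH); apply.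
exact: (dicol_sub HAB (dicol_union cA cB)).
Qed.

(** Let a and b be the in-neighbours of v. The sets v |: (S - s) and {a, b, s}
    cover H, and the first is acyclic if S - s is; so the second is a directed
    triangle. One such s decides the direction of the arc between a and b, and
    all the others follow it. *)
Lemma critical2_struct H v s0 (S := nonin H v) : critical 2 H -> din H v = 2 ->
  s0 \in S -> acyclic (S :\ s0) -> exists a b,
  [/\ d a b, d a v, d b v, H \subset v |: (a |: (b |: S)) &
      forall s, s \in S -> acyclic (S :\ s) -> d b s && d s a].
Proof.
move=> cH dv s0S s0a.
have /cards2P[a [b [ab inE2]]] : #|inn H v| == 2 by rewrite -/(din H v) dv.
have HS : H \subset v |: (a |: (b |: S)).
  apply/subsetP => u uH; have := congr1 (fun X : {set V} => u \in X) inE2.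
  rewrite /S !inE uH /=.
  by case: (u == v); case: (d u v); case: (u == a); case: (u == b).
have av : d a v.
  by have := congr1 (fun X : {set V} => a \in X) inE2; rewrite !inE eqxx => /andP[].
have bv : d b v.
  by have := congr1 (fun X : {set V} => b \in X) inE2; rewrite !inE eqxx orbT => /andP[].
have key s : s \in S -> acyclic (S :\ s) -> ~~ acyclic [set a; b; s].
  move=> sS sa; apply/negP => abs.
  have [vTa _] := nonin_add (subset_trans (subsetDl _ _) (subxx S)) sa.
  apply: (two_parts cH vTa abs); apply: subset_trans HS _.
  apply/subsetP => u; rewrite !inE.
  by case: (u == v); case: (u == a); case: (u == b); case: (u == s) => //=; rewrite ?orbT ?orbF.
have /acyclic_triple/orP[/and3P[t1 t2 t3]|/and3P[t1 t2 t3]] := key s0 s0S s0a.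
  exists a, b; split=> // s sS sa.
  have /acyclic_triple/orP[/and3P[_ -> ->]|/and3P[_ _ ba]] // := key s sS sa.
  by have := orient ba; rewrite t1.
exists b, a; split=> //; first by rewrite (setUCA [set b]).
move=> s sS sa.
have /acyclic_triple/orP[/and3P[ab' _ _]|/and3P[-> -> _]] // := key s sS sa.
by have := orient ab'; rewrite t3.
Qed.

(** Otherwise v |: S and the pair of in-neighbours of v would be two
    classes. *)
Lemma critical2_nonin_cyclic H v : critical 2 H -> din H v = 2 -> ~~ acyclic (nonin H v).
Proof.
move=> cH dv.
apply/negP => sa.
have /cards2P[a [b [ab inE2]]] : #|inn H v| == 2 by rewrite -/(din H v) dv.
have [vSa _] := nonin_add (subxx _) sa.
apply: (two_parts cH vSa (acyclic_pair a b)); rewrite -inE2; apply/subsetP => u uH.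
by rewrite !inE uH /=; case: (u == v); case: (d u v).
Qed.

Lemma two_covers H v (S : {set V}) a b (s s1 s2 : seq V) : critical 2 H ->
  H \subset v |: (a |: (b |: S)) -> {subset S <= s} ->
  all (mem (s1 ++ s2)) [:: v, a, b & s] ->
  acyclic [set x in s1] -> acyclic [set x in s2] -> False.
Proof.
move=> cH /subsetP HS Ss /allP al a1 a2; apply: (two_parts cH a1 a2); apply/subsetP => x /HS.
rewrite !in_setU1 => xx; rewrite in_setU !in_set -mem_cat; apply: al; rewrite !inE.
case/or4P: xx => [->|->|->|xS]; rewrite ?orbT //.
by rewrite (Ss x xS) !orbT.
Qed.

Lemma nonin_noarc H v s : s \in nonin H v -> ~~ d s v.
Proof. by rewrite inE => /and3P[]. Qed.

Lemma acyclic_src A v : {in A, forall u, ~~ d u v} -> acyclic A -> acyclic (v |: A).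
Proof.
move=> h aA; apply: acyclic_add => //; apply/orP; left; apply/eqP/setP => u; rewrite !inE.
by apply/negP => /andP[/h/negP].
Qed.

Lemma acyclic_snk A v : {in A, forall u, ~~ d v u} -> acyclic A -> acyclic (v |: A).
Proof.
move=> h aA; apply: acyclic_add => //; apply/orP; right; apply/eqP/setP => u; rewrite !inE.
by apply/negP => /andP[/h/negP].
Qed.

Lemma acyclic_card2 A : #|A| <= 2 -> acyclic A.
Proof.
rewrite leq_eqVlt ltnS leq_eqVlt ltnS leqn0 => /or3P[/cards2P[x [y [_ ->]]]|/cards1P[x ->]|].
- exact: acyclic_pair.
- by have := acyclic_pair x x; rewrite setUid.
- by rewrite cards_eq0 => /eqP->; exact: acyclic0.
Qed.

Lemma card_list A n : #|A| = n -> exists s, [/\ uniq s, A = [set x in s] & size s = n].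
Proof.
move=> <-; exists (enum A); split; rewrite ?enum_uniq -?cardE //.
by apply/setP => x; rewrite inE mem_enum.
Qed.

Lemma triangle_cyclic A : #|A| = 3 -> ~~ acyclic A ->
  exists x y z, [/\ A = [set x; y; z], d x y, d y z & d z x].
Proof.
move=> /card_list[s [_ AE sz]].
case: s sz AE => [|x [|y [|z []]]] // _ AE.
have -> : A = [set x; y; z] by rewrite AE; apply/setP => u; rewrite !inE orbA.
move=> /acyclic_triple/orP[/and3P[? ? ?]|/and3P[? ? ?]]; first by exists x, y, z.
by exists x, z, y; split=> //; rewrite setUAC.
Qed.

Lemma cover_uniq H vs : H \subset [set x in vs] -> size vs <= #|H| ->
  uniq vs /\ {subset vs <= H}.
Proof.
move=> Hs sz; have c := subset_leq_card Hs.
have E : #|[set x in vs]| = #|vs| by apply: eq_card => x; rewrite inE.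
have cs := card_size vs.
split; first by apply/card_uniqP/eqP; rewrite eqn_leq cs -E (leq_trans sz c).
have /eqP-> : H == [set x in vs] by rewrite eqEcard Hs E (leq_trans cs sz).
by move=> x; rewrite inE.
Qed.

(** By counting arcs, a critical set has a vertex v of in-degree 2 and at most
    three vertices that do not dominate v. These form a directed triangle by
    [critical2_nonin_cyclic], and the arcs found in [critical2_struct] leave
    room for an explicit partition. *)
Lemma dicol2_le6 H : #|H| <= 6 -> dicol 2 H.
Proof.
move=> H6; apply: contraT => /critical_exists[W WH cW].
have W6 := leq_trans (subset_leq_card WH) H6.
have e1 := critical_arcs cW; have e2 := size_arcs_le W.
have [w wW] := critical_neq0 (isT : 0 < 2) cW.
have W0 : 0 < #|W| by apply/card_gt0P; exists w.
have [|v vW dv] := @low_indegree W 2; first by nia.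
have [dv2 _] := critical_deg cW vW.
have {dv2}dv : din W v = 2 by lia.
have cS := card_nonin vW; have nS := critical2_nonin_cyclic cW dv.
have Sn : 2 < #|nonin W v| by rewrite ltnNge; apply: contra nS => /acyclic_card2.
have S3 : #|nonin W v| = 3 by lia.
have [s1 [s2 [s3 [SE s12 s23 s31]]]] := triangle_cyclic S3 nS.
have sa s : s \in nonin W v -> acyclic (nonin W v :\ s).
  by move=> sS; apply: acyclic_card2; have := cardsD1 s (nonin W v); rewrite sS S3; lia.
have si : [/\ s1 \in nonin W v, s2 \in nonin W v & s3 \in nonin W v].
  by rewrite SE !inE !eqxx !orbT.
have [i1 i2 i3] := si.
have [a [b [ab av bv Wc bsa]]] := critical2_struct cW dv i1 (sa _ i1).
have {}bsa s : s \in nonin W v -> d b s /\ d s a.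
  by move=> sS; apply/andP; apply: bsa => //; apply: sa.
have key x y z : nonin W v = [set x; y; z] -> d x y -> d y z -> d z x -> d v x.
  move=> E xy yz zx; apply: contraT => vx; exfalso.
  have [xS yS zS] : [/\ x \in nonin W v, y \in nonin W v & z \in nonin W v].
    by rewrite E !inE !eqxx !orbT.
  have [[[bx xa] [by_ ya]] [bz za]] := (bsa _ xS, bsa _ yS, bsa _ zS).
  apply: (two_covers cW (s := [:: x; y; z]) (s1 := [:: b; y; z]) (s2 := [:: x; a; v]) Wc).
  - by move=> u; rewrite E !inE orbA.
  - by rewrite /= !inE !eqxx !orbT.
  - by apply: acyclic_list; rewrite /= (orient by_) (orient bz) (orient yz).
  - by apply: acyclic_list; rewrite /= (orient xa) (orient av) vx.
have v1 := key _ _ _ SE s12 s23 s31.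
have [[[b1 a1] [b2 a2]] [b3 a3]] := (bsa _ i1, bsa _ i2, bsa _ i3).
exfalso; apply: (two_covers cW (s := [:: s1; s2; s3]) (s1 := [:: b; v; s1]) (s2 := [:: s2; s3; a]) Wc).
- by move=> u; rewrite SE !inE orbA.
- by rewrite /= !inE !eqxx !orbT.
- by apply: acyclic_list; rewrite /= (orient b1) (orient bv) (orient v1).
- by apply: acyclic_list; rewrite /= (orient a2) (orient a3) (orient s23).
Qed.

Lemma dicol_step W a k : has_acyclic W a ->
  (forall W' : {set V}, #|W'| + a <= #|W| -> dicol k W') -> dicol k.+1 W.
Proof.
move=> /has_acyclicP[A [AW aA cA]] h; apply: (dicol_peel aA); apply: h.
by rewrite cardsD (setIidPr AW); have := subset_leq_card AW; lia.
Qed.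

Lemma dicol3_le10 W : #|W| <= 10 -> dicol 3 W.
Proof.
move=> W10; have [W8|W8] := leqP 8 #|W|.
  by apply: (dicol_step (has_acyclic4 W8)) => W' cW'; apply: dicol2_le6; lia.
have [/eqP|W0] := posnP #|W|; first by rewrite cards_eq0 => /eqP->; apply: dicol0.
by apply: (dicol_step (has_acyclic1 W0)) => W' cW'; apply: dicol2_le6; lia.
Qed.

Lemma critical_card7 k W : #|W| = 7 -> e W < 20 -> ~~ dicol 2 W -> k = 2 -> critical k W.
Proof.
move=> W7 eW nc ->; have [H HW cH] := critical_exists nc.
suff <- : H = W by [].
apply/eqP; rewrite eqEcard HW W7 ltnNge; apply: contra (critical_ndicol cH); exact: dicol2_le6.
Qed.

(** Again there is a vertex v of in-degree 2, and S consists of the four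
    vertices that do not dominate v. The cases are that none, exactly one, or
    at least two of the triples of S are directed triangles. Each partition
    that is not a dicolouring forces further arcs, until there are 20 of them
    or a partition succeeds. *)
Lemma dicol2_card7 W : #|W| = 7 -> e W < 20 -> dicol 2 W.
Proof.
move=> W7 eW; apply: contraT => nc.
have cW := critical_card7 W7 eW nc erefl.
have [|v vW dv] := @low_indegree W 2; first by lia.
have [dv2 _] := critical_deg cW vW.
have {dv2}dv : din W v = 2 by lia.
have nS := critical2_nonin_cyclic cW dv.
have S4 : #|nonin W v| = 4 by have := card_nonin vW; lia.
have vS s : s \in nonin W v -> ~~ d s v by apply: nonin_noarc.
move: nS S4 vS (fun s0 => @critical2_struct W v s0 cW dv)
  (fun a b s s1 s2 => @two_covers W v (nonin W v) a b s s1 s2 cW).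
move: (nonin W v) => S nS S4 vS struct cover.
have S3 s : s \in S -> #|S :\ s| = 3 by move=> sS; have := cardsD1 s S; rewrite sS S4; lia.
have big a b s : W \subset v |: (a |: (b |: S)) -> {subset S <= s} -> size s = 4 ->
  uniq [:: v, a, b & s] /\ {subset [:: v, a, b & s] <= W}.
  move=> Wc Ss s4; apply: cover_uniq; last by rewrite /= s4 W7.
  apply/subsetP => x /(subsetP Wc); rewrite !in_setU1 inE !in_cons.
  by case/or4P=> [->|->|->|xS]; rewrite ?orbT // (Ss _ xS) !orbT.
exfalso.
(* No triple is a directed triangle: then b dominates S and S dominates a, and
   every partition of S into two pairs works. *)
have [allg|] := boolP [forall s in S, acyclic (S :\ s)].
  have {allg}sa s : s \in S -> acyclic (S :\ s) by move=> sS; move/forall_inP: allg; apply.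
  have [s [us SE s4]] := card_list S4.
  case: s s4 us SE => [|x [|y [|z [|t []]]]] // _ us SE.
  have [xS yS zS tS] : [/\ x \in S, y \in S, z \in S & t \in S].
    by rewrite SE !inE !eqxx !orbT.
  have [a [b [ab av bv Wc bsa]]] := struct _ xS (sa _ xS).
  have {}bsa s : s \in S -> d b s /\ d s a.
    by move=> sS; apply/andP; apply: bsa => //; apply: sa.
  apply: (cover a b [:: x; y; z; t] [:: b; v; x; y] [:: a; z; t] Wc).
  - by move=> u; rewrite SE inE.
  - by rewrite /= !inE !eqxx !orbT.
  - have -> : [set u in [:: b; v; x; y]] = b |: (v |: [set x; y]).
      by apply/setP => u; rewrite !inE.
    apply: acyclic_src; last apply: acyclic_src (acyclic_pair _ _).
      move=> u; rewrite !inE => /or3P[] /eqP->; first exact: orient.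
        by apply: orient; case: (bsa _ xS).
      by apply: orient; case: (bsa _ yS).
    by move=> u; rewrite !inE => /orP[] /eqP->; apply: vS.
  - have -> : [set u in [:: a; z; t]] = a |: [set z; t] by apply/setP => u; rewrite !inE.
    apply: acyclic_snk (acyclic_pair _ _).
    move=> u; rewrite !inE => /orP[] /eqP->; apply: orient; first by case: (bsa _ zS).
    by case: (bsa _ tS).
rewrite negb_forall_in => /exists_inP[s4 s4S n4].
have [s1 [s2 [s3 [SE s12 s23 s31]]]] := triangle_cyclic (S3 _ s4S) n4.
have SE4 : S = [set x in [:: s1; s2; s3; s4]].
  apply/setP => u; have := congr1 (fun X : {set V} => u \in X) SE; rewrite !inE.
  case: eqP => [->|_] /=; first by rewrite s4S !orbT.
  by rewrite orbF => ->; rewrite orbA.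
have [i1 i2 i3] : [/\ s1 \in S, s2 \in S & s3 \in S] by rewrite SE4 !inE !eqxx !orbT.
(* Exactly one triple, s1 s2 s3, is a directed triangle. *)
have [g|] := boolP [&& acyclic (S :\ s1), acyclic (S :\ s2) & acyclic (S :\ s3)].
  have [a1 a2 a3] := and3P g.
  have [a [b [ab av bv Wc bsa]]] := struct _ i1 a1.
  have [b1 a1'] := andP (bsa _ i1 a1).
  have [b2 a2'] := andP (bsa _ i2 a2).
  have [b3 a3'] := andP (bsa _ i3 a3).
  have Ss (s : seq V) : {subset [:: s1; s2; s3; s4] <= s} -> {subset S <= s}.
    by move=> h u; rewrite SE4 inE => /h.
  have s4b : d s4 b.
    apply: contraT => n4b.
    exfalso; apply: (cover a b [:: s1; s2; s3; s4] [:: b; v; s1; s4] [:: s2; s3; a] Wc).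
    + exact: Ss.
    + by rewrite /= !inE !eqxx !orbT.
    + have -> : [set u in [:: b; v; s1; s4]] = b |: (v |: [set s1; s4]).
        by apply/setP => u; rewrite !inE.
      apply: acyclic_src; last apply: acyclic_src (acyclic_pair _ _).
        by move=> u; rewrite !inE => /or3P[] /eqP-> //; apply: orient.
      by move=> u; rewrite !inE => /orP[] /eqP->; apply: vS.
    + by apply: acyclic_list; rewrite /= (orient s23) (orient a2') (orient a3').
  have key x y z : S = [set u in [:: x; y; z; s4]] -> d x y -> d y z -> d z x ->
      d b x -> d x a -> d b y -> d y a -> d b z -> d z a -> 
      [/\ d a s4, d s4 x & d x a].
    move=> E xy yz zx bx xa by_ ya bz za.
    have [xS yS zS] : [/\ x \in S, y \in S & z \in S] by rewrite E !inE !eqxx !orbT.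
    have : ~~ acyclic [set a; s4; x].
      apply/negP => aa; apply: (cover a b [:: x; y; z; s4] [:: b; v; y; z] [:: a; s4; x] Wc).
      + by move=> u; rewrite E inE.
      + by rewrite /= !inE !eqxx !orbT.
      + by apply: acyclic_list; rewrite /= (orient bv) (orient by_) (orient bz) (orient yz) !vS.
      + by apply: acyclic_sub aa; apply/subsetP => u; rewrite !inE orbA.
    move=> /acyclic_triple/orP[/and3P[? ? ?]|/and3P[ax _ _]]; first by [].
    by have := orient xa; rewrite ax.
  have rot x y z : S = [set u in [:: x; y; z; s4]] -> S = [set u in [:: y; z; x; s4]].
    by move=> ->; apply/setP => u; rewrite !inE; case: (u == x); rewrite ?orbT.
  have E2 := rot _ _ _ SE4; have E3 := rot _ _ _ E2.
  have [as4 s41 _] := key _ _ _ SE4 s12 s23 s31 b1 a1' b2 a2' b3 a3'.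
  have [_ s42 _] := key _ _ _ E2 s23 s31 s12 b2 a2' b3 a3' b1 a1'.
  have [_ s43 _] := key _ _ _ E3 s31 s12 s23 b3 a3' b1 a1' b2 a2'.
  have vx x y z : S = [set u in [:: x; y; z; s4]] -> d y z ->
      d b y -> d b z -> d x a -> d s4 y -> d s4 z -> d v x.
    move=> E yz by_ bz xa y4 z4; apply: contraT => nvx.
    exfalso; apply: (cover a b [:: x; y; z; s4] [:: x; a; v] [:: s4; b; y; z] Wc).
    + by move=> u; rewrite E inE.
    + by rewrite /= !inE !eqxx !orbT.
    + by apply: acyclic_list; rewrite /= (orient xa) (orient av) nvx.
    + by apply: acyclic_list; rewrite /= (orient s4b) (orient y4) (orient z4) (orient by_)
        (orient bz) (orient yz).
  have v1 := vx _ _ _ SE4 s23 b2 b3 a1' s42 s43.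
  have v2 := vx _ _ _ E2 s31 b3 b1 a2' s43 s41.
  have v3 := vx _ _ _ E3 s12 b1 b2 a3' s41 s42.
  have [uv vsW] := big a b [:: s1; s2; s3; s4] Wc (Ss _ (fun u h => h)) erefl.
  have := @arcs_list v [:: v; a; b; s1; s2; s3; s4]
    [:: (1,2); (1,0); (2,0); (2,3); (2,4); (2,5); (3,1); (4,1); (5,1); (3,4); (4,5); (5,3);
        (6,2); (1,6); (6,3); (6,4); (6,5); (0,3); (0,4); (0,5)] W uv isT isT vsW.
  rewrite /= ab av bv b1 b2 b3 a1' a2' a3' s12 s23 s31 s4b as4 s41 s42 s43 v1 v2 v3.
  by move=> /(_ isT); rewrite leqNgt eW.
have rot x y z : S = [set u in [:: x; y; z; s4]] -> S = [set u in [:: y; z; x; s4]].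
  by move=> ->; apply/setP => u; rewrite !inE; case: (u == x); rewrite ?orbT.
have E2 := rot _ _ _ SE4; have E3 := rot _ _ _ E2.
(* Two triples are directed triangles; they share an arc, which a rotation
   makes the arc from x to y. *)
have key x y z : S = [set u in [:: x; y; z; s4]] -> d x y -> d y z -> d z x ->
    ~~ acyclic (S :\ z) -> False; last first.
  move=> nb; have [n1|n1] := boolP (acyclic (S :\ s1)); last exact: (key _ _ _ E2 s23 s31 s12).
  have [n2|n2] := boolP (acyclic (S :\ s2)); last exact: (key _ _ _ E3 s31 s12 s23).
  by apply: (key _ _ _ SE4 s12 s23 s31); rewrite n1 n2 in nb.
move=> {s1 s2 s3 SE SE4 s12 s23 s31 i1 i2 i3 E2 E3 n4} E xy yz zx nz.
have [xS yS zS] : [/\ x \in S, y \in S & z \in S] by rewrite E !inE !eqxx !orbT.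
have [y4 s4x] : d y s4 /\ d s4 x.
  have : ~~ acyclic [set x; y; s4].
    apply: contra nz; apply: acyclic_sub; apply/subsetP => u; rewrite E !inE.
    by case: (u == z) => //=; case: (u == x); case: (u == y).
  move=> /acyclic_triple/orP[/and3P[? ? ?]|/and3P[_ _ yx]]; first by [].
  by have := orient xy; rewrite yx.
have ax : acyclic (S :\ x).
  apply: (@acyclic_sub (y |: [set z; s4])).
    apply/subsetP => u; rewrite E !inE.
    by case: (u == x) => //=; case: (u == y); case: (u == z).
  by apply: acyclic_src (acyclic_pair _ _) => u; rewrite !inE => /orP[] /eqP->; apply: orient.
have ay : acyclic (S :\ y).
  apply: (@acyclic_sub (x |: [set z; s4])).
    apply/subsetP => u; rewrite E !inE.
    by case: (u == x) => //=; case: (u == y); case: (u == z).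
  by apply: acyclic_snk (acyclic_pair _ _) => u; rewrite !inE => /orP[] /eqP->; apply: orient.
have [a [b [ab av bv Wc bsa]]] := struct _ xS ax.
have [bx xa] := andP (bsa _ xS ax).
have [by_ ya] := andP (bsa _ yS ay).
have fin p q : S = [set u in [:: x; y; p; q]] -> d y p -> d p x -> d y q -> d q x ->
    d p q -> d q a -> d a p -> False.
  move=> {}E yp px yq qx pq qa ap.
  have [pS qS] : p \in S /\ q \in S by rewrite E !inE !eqxx !orbT.
  have Ss : {subset S <= [:: x; y; p; q]} by move=> u; rewrite E inE.
  have half r r' : S = [set u in [:: x; y; r; r']] -> d y r' -> d r x -> d v r /\ d r b.
    move=> {}E yr' rx.
    have rS : r \in S by rewrite E !inE !eqxx !orbT.
    have : ~~ acyclic [set b; v; r].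
      apply/negP => bvr; apply: (cover a b [:: x; y; r; r'] [:: b; v; x; r] [:: y; a; r'] Wc).
      + by move=> u; rewrite E inE.
      + by rewrite /= !inE !eqxx !orbT.
      + have -> : [set u in [:: b; v; x; r]] = x |: [set b; v; r].
          by apply/setP => u; rewrite !inE; case: (u == x); rewrite ?orbT //= orbA.
        apply: acyclic_snk bvr => u; rewrite !inE -orbA => /or3P[] /eqP->; last exact: orient.
          exact: orient.
        exact: vS.
      + have -> : [set u in [:: y; a; r']] = y |: [set a; r'] by apply/setP => u; rewrite !inE.
        by apply: acyclic_src (acyclic_pair _ _) => u; rewrite !inE => /orP[] /eqP->; apply: orient.
    move=> /acyclic_triple/orP[/and3P[_ ? ?]|/and3P[_ _ vb]]; first by [].
    by have := orient bv; rewrite vb.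
  have [vp pb] := half p q E yq px.
  have [vq qb] : d v q /\ d q b.
    by apply: (half q p) => //; rewrite E; apply/setP => u; rewrite !inE (orbC (u == p)).
  have [uv vsW] := big a b [:: x; y; p; q] Wc Ss erefl.
  have n19 t : (t == 3) || (t == 4) -> ~~ d v (nth v [:: v; a; b; x; y; p; q] t).
    move=> t34; apply/negP => vt.
    have := @arcs_list v [:: v; a; b; x; y; p; q]
      [:: (0,t); (1,2); (1,0); (2,0); (2,3); (2,4); (3,1); (4,1); (3,4); (4,5); (5,3); (4,6);
          (6,3); (5,6); (6,1); (1,5); (0,5); (0,6); (5,2); (6,2)] W uv _ _ vsW.
    rewrite /= vt ab av bv bx by_ xa ya xy yp px yq qx pq qa ap vp vq pb qb.
    have [/eqP->|/eqP->] := orP t34; move=> /(_ isT isT isT); by rewrite leqNgt eW.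
  apply: (cover a b [:: x; y; p; q] [:: x; y; a; v] [:: p; q; b] Wc Ss).
  - by rewrite /= !inE !eqxx !orbT.
  - apply: acyclic_list; rewrite /= (orient xy) (orient xa) (orient ya) (orient av).
    by rewrite (n19 3) // (n19 4).
  - by apply: acyclic_list; rewrite /= (orient pq) (orient pb) (orient qb).
have : ~~ acyclic [set a; z; s4].
  apply/negP => azs; apply: (cover a b [:: x; y; z; s4] [:: b; v; x; y] [:: a; z; s4] Wc).
  - by move=> u; rewrite E inE.
  - by rewrite /= !inE !eqxx !orbT.
  - by apply: acyclic_list; rewrite /= (orient bv) (orient bx) (orient by_) (orient xy) !vS.
  - by apply: acyclic_sub azs; apply/subsetP => u; rewrite !inE orbA.
move=> /acyclic_triple/orP[/and3P[az zs sa]|/and3P[as_ sz za]].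
  exact: (fin z s4).
apply: (fin s4 z) => //; rewrite E; apply/setP => u; rewrite !inE.
by case: (u == z); case: (u == s4).
Qed.

(** * Digraphs that are critical for three colours *)

Lemma dicol_le6 W a : has_acyclic W a -> #|W| <= a + 6 -> dicol 3 W.
Proof. by move=> hA W6; apply: (dicol_step hA) => W' cW'; apply: dicol2_le6; lia. Qed.

Lemma dout_sub W W' v : W' \subset W -> dout W' v <= dout W v.
Proof.
by move=> WW; apply: subset_leq_card; apply/subsetP => u; rewrite !inE => /andP[/(subsetP WW)-> ->].
Qed.

Lemma din_sub W W' v : W' \subset W -> din W' v <= din W v.
Proof.
by move=> WW; apply: subset_leq_card; apply/subsetP => u; rewrite !inE => /andP[/(subsetP WW)-> ->].
Qed.

Lemma doutU A B v : [disjoint A & B] -> dout (A :|: B) v = dout A v + dout B v.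
Proof.
move=> AB; rewrite /dout -cardsUI; have -> : out A v :&: out B v = set0.
  apply/setP => u; rewrite !inE; apply/negbTE; apply/negP => /andP[/andP[uA _] /andP[uB _]].
  by have := disjointFr AB uA; rewrite uB.
by rewrite cards0 addn0; apply: eq_card => u; rewrite !inE andb_orl.
Qed.

(** An acyclic set of five vertices would leave six vertices, which are
    2-dicolourable. Let v have in-degree 3. Then the seven vertices that do
    not dominate v span a tournament, with 21 arcs, and each in-neighbour u of
    v has four in-neighbours among them, for otherwise three acyclic vertices
    could be put behind u and v. With three arcs out of v and out of each u,
    there are 21 + 12 + 3 + 9 arcs. *)
Lemma critical3_card11 H : critical 3 H -> #|H| = 11 -> 44 <= e H.
Proof.
move=> cH H11; rewrite leqNgt; apply/negP => eH.
have no5 : ~~ has_acyclic H 5.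
  by apply/negP => h5; move: (critical_ndicol cH); rewrite (dicol_le6 h5) // H11.
have [|v vH dv] := @low_indegree H 3; first by rewrite H11.
have [dv2 _] := critical_deg cH vH.
have {dv2}dv : din H v = 3 by apply/eqP; rewrite eqn_leq dv.
have S7 : #|nonin H v| = 7 by have := card_nonin vH; lia.
have eS : 21 <= e (nonin H v).
  rewrite leqNgt; apply: contra no5 => eS; apply: has_acyclic_nonin vH _; exact: has_acyclic7.
have du u : u \in inn H v -> 4 <= din (nonin H v) u.
  rewrite inE => /andP[uH uv]; rewrite leqNgt; apply: contra no5 => ud.
  have : 3 < #|nonin H v :\: inn (nonin H v) u|.
    rewrite cardsD S7; have : inn (nonin H v) u \subset nonin H v.
      by apply/subsetP => x; rewrite inE => /andP[].
    by move/setIidPr => ->; rewrite -/(din _ _); lia.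
  move=> /has_acyclic3/has_acyclicP[T [TS aT T3]].
  have TS' : T \subset nonin H v := subset_trans TS (subsetDl _ _).
  have [avT cvT] := nonin_add TS' aT.
  apply/has_acyclicP; exists (u |: (v |: T)); split.
  - rewrite !subUset !sub1set uH vH; exact: subset_trans TS' (nonin_sub _ _).
  - apply: acyclic_src avT => x; rewrite inE => /orP[/set1P->|xT]; first exact: orient.
    by have := subsetP TS x xT; rewrite !inE; case: (d x u); rewrite //= ?andbT ?andNb.
  - rewrite cardsU1 cvT !inE negb_or; have -> : u != v by apply: contraTneq uv => ->; rewrite dF.
    have -> : u \notin T by apply/negP => /(subsetP TS'); rewrite inE uv !andbF.
    by [].
have disj : [disjoint nonin H v & inn H v].
  rewrite -setI_eq0; apply/eqP/setP => x; rewrite !inE.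
  by case: (d x v); rewrite ?andbF.
have subU : nonin H v :|: inn H v \subset H.
  by apply/subsetP => x; rewrite !inE => /orP[] /andP[].
have c1 : \sum_(x in nonin H v) dout (inn H v) x >= 12.
  rewrite -sum_din (leq_trans _ (leq_sum _ (fun u uI => du u uI))) // sum_nat_const.
  by rewrite -/(din H v) dv.
have c2 : \sum_(x in H :\: nonin H v) dout H x >= 12.
  apply: (@leq_trans (\sum_(x in H :\: nonin H v) 3));
    last by apply: leq_sum => x; rewrite inE => /andP[_ xH]; case: (critical_deg cH xH).
  by rewrite sum_nat_const cardsD (setIidPr (nonin_sub _ _)) H11 S7.
have c3 : \sum_(x in nonin H v) dout H x >= 33.
  apply: (@leq_trans (\sum_(x in nonin H v) (dout (nonin H v) x + dout (inn H v) x))).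
    by rewrite big_split /= -size_arcs_dout; lia.
  by apply: leq_sum => x _; rewrite -doutU //; apply: dout_sub.
have := size_arcs_dout H; rewrite (sum_split _ (nonin_sub H v)); lia.
Qed.

Lemma not_acyclic_add A v : acyclic A -> ~~ acyclic (v |: A) -> 0 < din A v /\ 0 < dout A v.
Proof.
move=> aA H; split; rewrite lt0n; apply: contraNneq H => /eqP; rewrite cards_eq0 => h;
  by apply: acyclic_add => //; rewrite h ?orbT.
Qed.

Lemma max_acyclic W a : has_acyclic W a -> exists A : {set V}, [/\ A \subset W, acyclic A, a <= #|A| &
  forall v, v \in W :\: A -> 0 < din A v /\ 0 < dout A v].
Proof.
move=> /has_acyclicP[A0 [A0W aA0 cA0]].
have [|A /andP[AW aA] mx] := @arg_maxnP _ A0 (fun A => (A \subset W) && acyclic A) (fun A => #|A|).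
  by rewrite A0W.
exists A; split=> //; first by apply: leq_trans cA0 (mx _ _); rewrite A0W.
move=> v; rewrite inE => /andP[vA vW]; apply: not_acyclic_add => //; apply/negP => avA.
have := mx (v |: A); rewrite subUset sub1set vW AW avA cardsU1 vA => /(_ isT); lia.
Qed.

(** All degrees in W are at least 8, and every vertex of H has an arc from A
    and an arc to A, so that at least 2 |H| arcs join H to W - H. Adding the
    two counts gives the bound. *)
Lemma excess W A H : critical 4 W -> A \subset W -> H \subset W :\: A ->
  (forall v, v \in W :\: A -> 0 < din A v /\ 0 < dout A v) ->
  e H + 4 * #|W| <= e W + 3 * #|H|.
Proof.
move=> cW AW HWA hA.
have HW : H \subset W := subset_trans HWA (subsetDl _ _).
have AWH : A \subset W :\: H.
  by apply/subsetP => x xA; rewrite inE (subsetP AW) // andbT; apply/negP => /(subsetP HWA); rewrite inE xA.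
have eW := size_arcs_split HW.
have c1 : \sum_(v in H) 2 <= \sum_(v in H) deg (W :\: H) v.
  apply: leq_sum => v vH; have [i o] := hA v (subsetP HWA v vH).
  have := dout_sub v AWH; have := din_sub v AWH; rewrite /deg; lia.
have c2 : \sum_(v in W :\: H) 8 <= \sum_(v in W :\: H) deg W v.
  apply: leq_sum => v; rewrite inE => /andP[_ vW].
  by have [i o] := critical_deg cW vW; rewrite /deg; lia.
have c3 : \sum_(v in W :\: H) deg W v = 2 * e (W :\: H) + \sum_(v in H) deg (W :\: H) v.
  rewrite -sum_deg (sum_degC H) -big_split /=; apply: eq_bigr => v _.
  by rewrite (deg_split v HW) addnC.
rewrite !sum_nat_const in c1 c2.
have := cardsD W H; rewrite (setIidPr HW); have := subset_leq_card HW; lia.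
Qed.

Lemma sum_tight (A : {set V}) (F : V -> nat) c : (forall x, x \in A -> c <= F x) ->
  \sum_(x in A) F x <= c * #|A| -> forall x, x \in A -> F x = c.
Proof.
move=> h s x xA; apply/eqP; rewrite eqn_leq h // andbT.
have : \sum_(y in A | y != x) c <= \sum_(y in A | y != x) F y.
  by apply: leq_sum => y /andP[yA _]; exact: h.
have : \sum_(y in A) c = c * #|A| by rewrite sum_nat_const mulnC.
by rewrite (bigD1 x) //=; rewrite (bigD1 x) //= in s; lia.
Qed.

Lemma swap_arith (p q : bool) i o : p || q -> q + i = 1 -> p + o = 1 -> i + o <= 1.
Proof. by case: p; case: q => //= _; lia. Qed.

(** With at most 42 arcs all counts are tight for every acyclic set A of five
    vertices: A spans 8 arcs, and every vertex outside A has one in-neighbour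
    and one out-neighbour in A. Exchanging such a vertex for its neighbour in
    A gives another acyclic set of five vertices, and the comparison shows
    that every vertex of A has degree at most 1 in A, so that A spans at most
    two arcs. *)
Lemma critical3_card12 H : critical 3 H -> #|H| = 12 -> 43 <= e H.
Proof.
move=> cH H12; rewrite leqNgt; apply/negP => eH.
have no6 : ~~ has_acyclic H 6.
  by apply/negP => h6; move: (critical_ndicol cH); rewrite (dicol_le6 h6) // H12.
have [|v vH dv] := @low_indegree H 3; first by rewrite H12; lia.
have [dv2 _] := critical_deg cH vH.
have {dv2}dv : din H v = 3 by apply/eqP; rewrite eqn_leq dv.
have S8 : 7 < #|nonin H v| by have := card_nonin vH; lia.
have /has_acyclicP[A [AH aA A5]] := has_acyclic_nonin vH (has_acyclic4 S8).
have card5 B : B \subset H -> acyclic B -> 5 <= #|B| -> #|B| = 5.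
  move=> BH aB B5; apply/eqP; rewrite eqn_leq B5 andbT leqNgt; apply: contra no6 => B6.
  by apply/has_acyclicP; exists B.
have main B : B \subset H -> acyclic B -> 5 <= #|B| -> [/\ e B = 8,
    forall x, x \in B -> deg H x = 6 & forall w, w \in H :\: B -> din B w = 1 /\ dout B w = 1].
  move=> BH aB B5; have B5' := card5 B BH aB B5.
  have W7 : #|H :\: B| = 7 by rewrite cardsD (setIidPr BH) H12 B5'.
  have eW : 20 <= e (H :\: B).
    rewrite leqNgt; apply: contra (critical_ndicol cH) => eW; apply: (dicol_peel aB).
    exact: dicol2_card7.
  have hw w : w \in H :\: B -> 0 < din B w /\ 0 < dout B w.
    rewrite inE => /andP[wB wH]; apply: not_acyclic_add => //; apply/negP => wBa.
    by have := card5 (w |: B); rewrite subUset sub1set wH BH wBa cardsU1 wB B5' => /(_ isT isT isT).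
  have hx x : x \in B -> 6 <= deg H x.
    by move=> /(subsetP BH)/(critical_deg cH)[i o]; rewrite /deg; lia.
  have eHs := size_arcs_split BH.
  have c1 : \sum_(x in B) deg H x = 2 * e B + \sum_(x in B) deg (H :\: B) x.
    by rewrite -sum_deg -big_split /=; apply: eq_bigr => x _; rewrite (deg_split x BH).
  have c2 : \sum_(x in B) deg (H :\: B) x = \sum_(w in H :\: B) deg B w by rewrite sum_degC.
  have c3 : \sum_(x in B) 6 <= \sum_(x in B) deg H x by apply: leq_sum.
  have hw2 w : w \in H :\: B -> 2 <= deg B w by move=> /hw[i o]; rewrite /deg; lia.
  have c4 : \sum_(w in H :\: B) 2 <= \sum_(w in H :\: B) deg B w by apply: leq_sum.
  rewrite !sum_nat_const B5' W7 in c3 c4.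
  split; first by lia.
    by apply: sum_tight hx _; rewrite B5'; lia.
  move=> w wB; have [i o] := hw w wB.
  have : deg B w = 2 by apply: (sum_tight hw2) => //; rewrite W7; lia.
  by rewrite /deg; lia.
have [eA degA nA] := main A AH aA A5.
(* After the exchange, x lies outside the new set and has degree 2 into it. *)
have swap x w : x \in A -> w \in H :\: A -> acyclic (w |: (A :\ x)) -> d x w || d w x -> deg A x <= 1.
  move=> xA wA aB xw; have wHA := wA; move: wA; rewrite inE => /andP[wA wH].
  have [||_ _ nB] := main (w |: (A :\ x)) _ aB _.
  - by rewrite subUset sub1set wH (subset_trans (subsetDl _ _) AH).
  - by rewrite cardsU1 !inE (negPf wA) andbF; rewrite (cardsD1 x) xA in A5.
  have [|i o] := nB x.
    rewrite !inE eqxx (subsetP AH) // andbT orbF; apply: contraNneq wA => <- //.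
  have c1 : din (w |: (A :\ x)) x = d w x + din A x.
    rewrite /din (_ : inn _ x = (if d w x then [set w] else set0) :|: inn A x).
      by case: (d w x); rewrite ?set0U // cardsU1 !inE (negPf wA).
    apply/setP => y; rewrite !inE; case: ifP => wx; rewrite !inE.
      by case: (y =P w) => [->|_]; rewrite ?wx //=; case: (y =P x) => [->|]; rewrite ?dF ?andbF.
    by case: (y =P w) => [->|_]; rewrite ?wx ?andbF //=; case: (y =P x) => [->|]; rewrite ?dF ?andbF.
  have c2 : dout (w |: (A :\ x)) x = d x w + dout A x.
    rewrite /dout (_ : out _ x = (if d x w then [set w] else set0) :|: out A x).
      by case: (d x w); rewrite ?set0U // cardsU1 !inE (negPf wA).
    apply/setP => y; rewrite !inE; case: ifP => wx; rewrite !inE.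
      by case: (y =P w) => [->|_]; rewrite ?wx //=; case: (y =P x) => [->|]; rewrite ?dF ?andbF.
    by case: (y =P w) => [->|_]; rewrite ?wx ?andbF //=; case: (y =P x) => [->|]; rewrite ?dF ?andbF.
  by apply: swap_arith xw _ _; rewrite -?c1 -?c2.
have one x : x \in A -> deg A x <= 1.
  move=> xA; rewrite leqNgt; apply/negP => d2.
  have cA := card5 A AH aA A5.
  have := degA x xA; rewrite (deg_split x AH); have := deg_lt xA; rewrite cA => dx5 dxs.
  have : 0 < deg (H :\: A) x by lia.
  rewrite addn_gt0 !card_gt0 => /orP[] /set0Pn[w]; rewrite inE => /andP[wA xw].
    have [_ o] := nA w wA; suff: deg A x <= 1 by rewrite leqNgt d2.
    apply: (swap x w) => //; last first.
      by rewrite xw orbT.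
    apply: acyclic_add; first exact: acyclic_sub (subsetDl _ _) aA.
    apply/orP; right; rewrite -cards_eq0; have := cardsD1 x (out A w); rewrite -/(dout A w) o inE xA xw.
    move=> /eqP; rewrite eqSS eq_sym => /eqP; move=> h; rewrite -h; apply/eqP; apply: eq_card => y.
    by rewrite !inE; case: (y == x).
  have [i _] := nA w wA; suff: deg A x <= 1 by rewrite leqNgt d2.
    apply: (swap x w) => //; last first.
    by rewrite xw.
  apply: acyclic_add; first exact: acyclic_sub (subsetDl _ _) aA.
  apply/orP; left; rewrite -cards_eq0; have := cardsD1 x (inn A w); rewrite -/(din A w) i inE xA xw.
  move=> /eqP; rewrite eqSS eq_sym => /eqP; move=> h; rewrite -h; apply/eqP; apply: eq_card => y.
  by rewrite !inE; case: (y == x).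
have := sum_deg A; have : \sum_(x in A) deg A x <= \sum_(x in A) 1 by apply: leq_sum.
by rewrite sum1_card (card5 A) // eA; lia.
Qed.

(** * Vertices of least degree in a critical digraph *)

Implicit Types Q : {set V}.

Local Notation uadj := (underlying d).

Definition nbr Q y := [set u in Q | uadj y u].

Lemma card_nbr Q y : #|nbr Q y| = deg Q y.
Proof.
have -> : nbr Q y = inn Q y :|: out Q y.
  by apply/setP => u; rewrite !inE /underlying -andb_orr orbC.
rewrite cardsU (_ : inn Q y :&: out Q y = set0) ?cards0 ?subn0 //.
apply/setP => u; rewrite !inE; apply/negP => /andP[/andP[_ uy] /andP[_ yu]].
by have := orient uy; rewrite yu.
Qed.

Lemma uadj_sym : symmetric uadj.
Proof. by move=> u v; rewrite /underlying orbC. Qed.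

Lemma uadj_neq u v : uadj u v -> u != v.
Proof. by apply: contraTneq => ->; rewrite /underlying dF. Qed.

Lemma size_arcs_D1 Q z : z \in Q -> e Q = e (Q :\ z) + deg (Q :\ z) z.
Proof.
move=> zQ; have zs : [set z] \subset Q by rewrite sub1set.
rewrite (size_arcs_split zs) big_set1; have := size_arcs_le [set z]; rewrite cards1; lia.
Qed.

Lemma deg_D1 Q z y : z \in Q -> deg Q y = uadj y z + deg (Q :\ z) y.
Proof.
move=> zQ; rewrite -!card_nbr (cardsD1 z (nbr Q y)) inE zQ /=; congr (_ + _).
by apply: eq_card => u; rewrite !inE andbA.
Qed.

Lemma periodM (T : Type) (f : nat -> T) m : (forall i, f (i + m) = f i) ->
  forall i a, f (i + m * a) = f i.
Proof.
move=> h i; elim=> [|a IH]; first by rewrite muln0 addn0.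
by rewrite mulnS (addnC m) addnA h.
Qed.

Section Gallai.
Variables (k : nat) (W : {set V}).
Hypothesis cW : critical k W.

(** In a critical set these are the vertices whose in- and out-degree both
    equal k. *)
Definition low := [set v in W | deg W v <= k.*2].
Definition dicolouring (c : V -> 'I_k) (X : {set V}) := forall i, acyclic [set v in X | c v == i].
Definition recol (c : V -> 'I_k) x i v := if v == x then i else c v.

Lemma low_sub v : v \in low -> v \in W.
Proof. by rewrite inE => /andP[]. Qed.

Lemma recol_col c x i : x \in W -> dicolouring c (W :\ x) ->
  (inn [set v in W :\ x | c v == i] x == set0) || (out [set v in W :\ x | c v == i] x == set0) ->
  dicolouring (recol c x i) W.
Proof.
move=> xW cc h j; have [->|ij] := eqVneq j i; last first.
  apply: acyclic_sub (cc j); apply/subsetP => v; rewrite !inE /recol.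
  by have [->|_] := eqVneq v x; rewrite // (negPf (_ : i != j)) ?andbF // eq_sym.
apply: acyclic_sub (acyclic_add (cc i) h); apply/subsetP => v; rewrite !inE /recol.
by have [->|_] := eqVneq v x.
Qed.

(** A colour that is missing among the in-neighbours, or among the
    out-neighbours, could be given to x. So each of the k colours occurs
    there, and exactly once. *)
Lemma low_nbrs c x : x \in low -> dicolouring c (W :\ x) -> forall N, N = inn W x \/ N = out W x ->
  {in N &, injective c} /\ forall i, exists2 u, u \in N & c u = i.
Proof.
move=> xL cc N hN; have xW := low_sub xL.
have [ki ko] := critical_deg cW xW.
have cN : #|N| = k.
  by move: xL; rewrite inE xW /= /deg; case: hN => ->; rewrite -/(din _ _) -/(dout _ _); lia.
have sur i : exists2 u, u \in N & c u = i.
  have [/existsP[u /andP[uN /eqP cu]]|no] := boolP [exists u, (u \in N) && (c u == i)].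
    by exists u.
  exfalso; apply: (negP (critical_ndicol cW)); apply/dicolP; exists (recol c x i).
  have emp (Q : pred V) : (forall u, u \in W -> Q u -> u \in N) ->
      [set u in [set v in W :\ x | c v == i] | Q u] == set0.
    move=> QN; apply/eqP/setP => u; rewrite !inE; apply/negP => /andP[/andP[/andP[_ uW] cu] Qu].
    by move/existsP: no; apply; exists u; rewrite QN.
  apply: recol_col => //; apply/orP; case: hN => E; [left|right];
    by apply: emp => u uW Qu; rewrite E inE uW.
split=> //; apply/imset_injP; rewrite cN.
have -> : c @: N = [set: 'I_k].
  by apply/setP => i; rewrite inE; have [u uN <-] := sur i; apply: imset_f.
by rewrite cardsT card_ord.
Qed.

(** By [low_nbrs], y is the only neighbour of x on its side with the colour of
    y. So x can take over this colour, and the uncoloured vertex moves from x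
    to y. *)
Lemma shift c x y : x \in low -> y \in low -> uadj x y -> dicolouring c (W :\ x) ->
  dicolouring (recol c x (c y)) (W :\ y).
Proof.
move=> xL yL xy cc j; set i := c y.
have yW := low_sub yL.
have [->|ij] := eqVneq j i; last first.
  apply: acyclic_sub (cc j); apply/subsetP => v; rewrite !inE /recol.
  by have [->|_] := eqVneq v x; [rewrite -/i (eq_sym i) (negPf ij) andbF | move=> /andP[/andP[_ ->] ->]].
apply: (@acyclic_sub (x |: [set v in W :\ x :\ y | c v == i])).
  apply/subsetP => v; rewrite !inE /recol; have [//|_] := eqVneq v x.
  by move=> /andP[/andP[-> ->] ->].
apply: acyclic_add.
  by apply: acyclic_sub (cc i); apply/subsetP => v; rewrite !inE => /andP[/andP[_ ->] ->].
have emp N (Q : pred V) : N = inn W x \/ N = out W x -> y \in N ->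
    (forall u, u \in W -> Q u -> u \in N) ->
    [set u in [set v in W :\ x :\ y | c v == i] | Q u] == set0.
  move=> hN yN QN; have [inj _] := low_nbrs xL cc hN.
  apply/eqP/setP => u; rewrite !inE; apply/negP => /andP[/andP[/and3P[uy _ uW] /eqP cu] Qu].
  by move/eqP: uy; apply; apply: inj => //; apply: QN.
apply/orP; case/orP: xy => xy; [right|left].
  by apply: (emp (out W x)); [right| rewrite inE yW |move=> u uW Qu; rewrite inE uW].
by apply: (emp (inn W x)); [left| rewrite inE yW |move=> u uW Qu; rewrite inE uW].
Qed.

(** A cycle of the underlying graph in the set of low vertices; its vertices
    are numbered cyclically by all natural numbers. *)
Definition low_cycle (f : nat -> V) m := [/\ forall i, f (i + m) = f i,
  forall i j, f i = f j -> i = j %[mod m], forall i, f i \in low & forall i, uadj (f i) (f i.+1)].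

Definition directed (f : nat -> V) := (forall i, d (f i) (f i.+1)) \/ (forall i, d (f i.+1) (f i)).

Lemma low_cycle_shift f m i0 : low_cycle f m -> low_cycle (fun i => f (i0 + i)) m.
Proof.
move=> [fp fi fl fa]; split=> [i|i j|i|i]; rewrite ?addnA ?addnS //.
by move=> /fi/eqP; rewrite eqn_modDl => /eqP.
Qed.

Lemma low_cycle_sub f m i0 n : low_cycle f m -> n < m -> uadj (f (i0 + n)) (f i0) ->
  low_cycle (fun i => f (i0 + i %% n.+1)) n.+1.
Proof.
move=> [fp fi fl fa] nm cl; split=> [i|i j|i|i] //=; first by rewrite modnDr.
  move=> /fi/eqP; rewrite eqn_modDl => /eqP.
  have lt a : a %% n.+1 < m by apply: leq_trans nm; rewrite ltn_mod.
  by rewrite (modn_small (lt i)) (modn_small (lt j)).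
rewrite -(addn1 i) -modnDml addn1; have : i %% n.+1 < n.+1 by rewrite ltn_mod.
rewrite ltnS leq_eqVlt => /orP[/eqP->|lt]; first by rewrite modnn addn0.
by rewrite (@modn_small (i %% n.+1).+1) // addnS.
Qed.

Section Cycle.
Variables (f : nat -> V) (l : nat) (c0 : V -> 'I_k).
Hypothesis cf : low_cycle f l.+1.
Hypothesis l0 : 0 < l.
Hypothesis hole : dicolouring c0 (W :\ f 0).

Lemma cyc_neq i t : 0 < t <= l -> f (i + t) != f i.
Proof.
case: cf => _ fi _ _ /andP[t0 tl]; apply/eqP => /fi.
rewrite -[in RHS](addn0 i) => /eqP; rewrite eqn_modDl mod0n modn_small //.
by rewrite eqn0Ngt t0.
Qed.

Lemma on_cycle i u : [\/ u = f i, exists2 t, t < l & u = f (i + t.+1) | forall s, f s != u].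
Proof.
case: cf => fp fi _ _.
have [/existsP[[[|t] /= tl] /eqP <-]|no] := boolP [exists t : 'I_l.+1, f (i + t) == u].
- by constructor 1; rewrite addn0.
- by constructor 2; exists t.
constructor 3 => s; apply: contra no => /eqP <-; apply/existsP.
exists (inord ((s + i * l) %% l.+1)); rewrite inordK ?ltn_mod //.
rewrite -(periodM fp s i) -(periodM fp _ ((s + i * l) %/ l.+1)).
apply/eqP; congr f; have := divn_eq (s + i * l) l.+1; nia.
Qed.

Let g t := c0 (f (t %% l).+1).

Let g_per t : g (t + l) = g t.
Proof. by rewrite /g modnDr. Qed.

(** Once the uncoloured vertex has moved all the way around the cycle, which
    has l + 1 vertices, the sequence g of the l colours on the others has
    turned by one place. As l and l + 1 are coprime, the place i of the
    uncoloured vertex and the offset j of the sequence can be prescribed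
    independently ([st_all]). *)
Let st i j := exists c, [/\ dicolouring c (W :\ f i),
   forall t, t < l -> c (f (i + t.+1)) = g (j + t) & forall u, (forall s, f s != u) -> c u = c0 u].

Let st_step i j : st i j -> st i.+1 j.+1.
Proof.
case: cf => fp fi fl fa [c [cc cg co]].
exists (recol c (f i) (c (f i.+1))); split.
- exact: shift.
- move=> t tl; rewrite /recol addSnnS.
  have [tl1|tl1] := ltnP t.+1 l.
    by rewrite (negPf (cyc_neq _ _)) ?tl1 // cg // addSnnS.
  have -> : t.+2 = l.+1 by lia.
  rewrite fp eqxx -addn1 cg //; have -> : j.+1 + t = j + 0 + l by lia.
  by rewrite g_per.
- by move=> u uf; rewrite /recol eq_sym (negPf (uf i)) co.
Qed.

Let st_all i j : st i j.
Proof.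
case: (cf) => fp _ _ _.
have st0 n : st n n.
  elim: n => [|n /st_step //]; exists c0; split=> // t tl; rewrite /g !add0n modn_small //.
have [c [cc cg co]] := st0 (i + l.+1 * (j + i * l.-1)).
exists c; split=> //; first by rewrite (periodM fp) in cc.
move=> t tl; have := cg t tl; rewrite addnAC (periodM fp) => ->.
rewrite -[RHS](periodM g_per _ (i + j + i * l.-1)); congr g.
have := ltn_predK l0; nia.
Qed.

(** Turning the sequence of colours does not affect the in-neighbours outside
    the cycle, and every colour occurs once among the in-neighbours. So the
    only in-neighbour on the cycle sees the same colour for all offsets. *)
Lemma single_in i t0 : t0 < l -> d (f (i + t0.+1)) (f i) ->
  (forall t, t < l -> d (f (i + t.+1)) (f i) -> t = t0) ->
  forall j j', g j = g j'.
Proof.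
case: (cf) => fp _ fl _ t0l dt u0.
have E j j' : g (j + t0) = g (j' + t0).
  have [c [cc cg co]] := st_all i j; have [c' [cc' cg' co']] := st_all i j'.
  have [_ sur] := low_nbrs (fl i) cc (or_introl erefl).
  have [inj _] := low_nbrs (fl i) cc' (or_introl erefl).
  have [u + cu] := sur (c' (f (i + t0.+1))).
  have yN : f (i + t0.+1) \in inn W (f i) by rewrite inE dt (low_sub (fl _)).
  case: (on_cycle i u) => [uE|[t tl uE]|nu] uN.
  - by move: uN; rewrite uE inE dF andbF.
  - have tt : t = t0 by apply: u0 => //; rewrite -uE; move: uN; rewrite inE => /andP[].
    by move: cu; rewrite uE tt cg // cg'.
  - have := inj u _ uN yN; rewrite co' // -co // => /(_ cu) uE.
    by have := nu (i + t0.+1); rewrite uE eqxx.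
move=> j j'; rewrite -(periodM g_per j t0) -(periodM g_per j' t0).
have := E (j + l.-1 * t0) (j' + l.-1 * t0); rewrite -!addnA -!mulSnr (ltn_predK l0) //.
Qed.

(** The two in-neighbours on the cycle together have, for all offsets, the
    same two colours, by the argument of [single_in]. *)
Lemma double_in i : 1 < l -> d (f i.+1) (f i) -> d (f (i + l)) (f i) ->
  (forall t, t < l -> d (f (i + t.+1)) (f i) -> t = 0 \/ t = l.-1) ->
  forall j j', g j != g (j + l.-1) /\ (g j = g j' \/ g j = g (j' + l.-1)).
Proof.
case: (cf) => fp _ fl _ l1 dy dz u0 j j'.
have ll := ltn_predK l0.
have [c [cc cg co]] := st_all i j'; have [c' [cc' cg' co']] := st_all i j.
have [_ sur] := low_nbrs (fl i) cc (or_introl erefl).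
have [inj _] := low_nbrs (fl i) cc' (or_introl erefl).
have yN : f i.+1 \in inn W (f i) by rewrite inE dy (low_sub (fl _)).
have zN : f (i + l) \in inn W (f i) by rewrite inE dz (low_sub (fl _)).
have gy : c' (f i.+1) = g j by rewrite -addn1 cg' // addn0.
have gz : c' (f (i + l)) = g (j + l.-1) by rewrite -{1}ll cg' // ll.
split.
  rewrite -gy -gz; apply/eqP => /(inj _ _ yN zN)/eqP; rewrite eq_sym.
  have -> : i + l = i.+1 + l.-1 by lia.
  by apply/negP; apply: cyc_neq; lia.
have [u + cu] := sur (c' (f i.+1)).
case: (on_cycle i u) => [uE|[t tl uE]|nu] uN.
- by move: uN; rewrite uE inE dF andbF.
- have : t = 0 \/ t = l.-1 by apply: u0 => //; rewrite -uE; move: uN; rewrite inE => /andP[].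
  rewrite -gy -cu uE cg //; case=> ->; [left|right] => //; by rewrite addn0.
- have := inj u _ uN yN; rewrite co' // -co // => /(_ cu) uE.
  by have := nu i.+1; rewrite uE eqxx.
Qed.

Lemma single_in_mono t0 : t0 < l -> d (f t0.+1) (f 0) ->
  (forall t, t < l -> d (f t.+1) (f 0) -> t = t0) ->
  forall t t', t < l -> t' < l -> c0 (f t.+1) = c0 (f t'.+1).
Proof.
move=> t0l dt u0 t t' tl tl'; have := @single_in 0 t0 t0l dt u0 t t'.
by rewrite /g !modn_small.
Qed.

(** At a sink of the cycle, [double_in] makes the colours alternate along the
    l other vertices, so l is even. Then by [single_in] no vertex has exactly
    one in-neighbour on the cycle, so the directions of the l + 1 edges
    alternate, and l is odd. If there is no sink, the direction of one edge
    propagates to all the others. *)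
Lemma chordless_directed : 1 < l ->
  (forall i t, 0 < t -> t < l.-1 -> ~~ d (f (i + t.+1)) (f i)) -> directed f.
Proof.
case: (cf) => fp _ _ fa l1 nch.
have ll := ltn_predK l0.
pose b i := d (f i) (f i.+1).
have nb i : ~~ b i -> d (f i.+1) (f i) by move=> /negPf bi; have := fa i; rewrite /underlying -/(b i) bi.
have bE i : d (f (i.+1 + l)) (f i.+1) = b i by rewrite addSnnS fp.
have bV i : d (f i.+2) (f i.+1) = ~~ b i.+1.
  by apply/idP/idP; [exact: orient | exact: nb].
have nosink i : ~~ (b i && ~~ b i.+1).
  apply/negP => /andP[bi /nb bi1]; rewrite -bE in bi.
  have dbl := double_in l1 bi1 bi _.
  have {}dbl j j' : g j != g (j + l.-1) /\ (g j = g j' \/ g j = g (j' + l.-1)).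
    apply: dbl => t tl dt; have [->|t0] := posnP t; first by left.
    have [tl1|tl1] := ltnP t l.-1; last by right; lia.
    by have := nch i.+1 t t0 tl1; rewrite dt.
  have gS r : g r.+1 != g r.
    by have [+ _] := dbl r.+1 0; rewrite addSnnS ll g_per.
  have alt r : g r = if odd r then g l.-1 else g 0.
    elim: r => [//|r IH] /=; have [_] := dbl r.+1 0; rewrite add0n.
    by have := gS r; rewrite IH; case: (odd r) => /= + [] // => /[swap] -> /eqP.
  have l_even : ~~ odd l.
    have := alt l; rewrite -[X in g X]add0n g_per; case: (odd l) => // E.
    by have [+ _] := dbl 0 0; rewrite add0n -E eqxx.
  have flip r : b r.+1 = ~~ b r.
    apply: contraTeq (gS 0) => bb; rewrite negbK; apply/eqP.
    have [br|br] := boolP (b r); rewrite ?br /= in bb.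
      apply: (single_in (i := r.+1) (t0 := l.-1)); rewrite ?ll ?bE //.
      move=> t tl; have [->|t0] := posnP t.
        by rewrite addn1 bV; case: (b r.+1) bb.
      have [tl1|tl1] := ltnP t l.-1; last by lia.
      by rewrite (negPf (nch _ _ t0 tl1)).
    apply: (single_in (i := r.+1) (t0 := 0)) => //.
      by rewrite addn1 bV; case: (b r.+1) bb.
    move=> t tl; have [//|t0] := posnP t.
    have [tl1|tl1] := ltnP t l.-1; first by rewrite (negPf (nch _ _ t0 tl1)).
    have -> : t.+1 = l by lia.
    by rewrite bE (negPf br).
  have bn r : b r = b 0 (+) odd r.
    elim: r => [|r IH]; first by rewrite addbF.
    by rewrite flip IH /= addbN.
  have bp : b l.+1 = b 0 by rewrite /b -(fp 0) -(fp 1) add0n add1n.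
  have := bn l.+1; rewrite bp /= addbN.
  by case: (odd l) l_even => //; case: (b 0).
have [/asboolP [i bi]|nb0] := boolP `[< exists i, b i >]; last first.
  by right=> i; apply: nb; apply: contra nb0 => bi; apply/asboolP; exists i.
left=> j; rewrite -/(b j); suff bn n : b (i + n).
  have := bn (j + l * i); rewrite /b; have -> : i + (j + l * i) = j + l.+1 * i by nia.
  by rewrite -addSn !(periodM fp).
elim: n => [|n IH]; first by rewrite addn0.
by rewrite addnS; have := nosink (i + n); rewrite IH negbK.
Qed.

End Cycle.

(** An arc from x to w across the cycle splits it into two shorter cycles,
    which are directed; x has an in-neighbour on each of them. By
    [single_in_mono] both have the colour of w, which contradicts
    [low_nbrs]. *)
Lemma no_chord f m : (forall m' f', 2 < m' < m -> low_cycle f' m' -> directed f') -> low_cycle f m ->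
  forall i a, 1 < a -> a.+1 < m -> ~~ d (f i) (f (i + a)).
Proof.
move=> IH cf i a a1 am; apply/negP => xw; case: (cf) => fp fi fl fa.
have Nwx := orient xw.
have c1 : low_cycle (fun s => f (i + s %% a.+1)) a.+1.
  by apply: (low_cycle_sub cf (ltnW am)); rewrite /underlying xw orbT.
have fim : f (i + a + (m - a)) = f i by have -> : i + a + (m - a) = i + m by lia.
have c2 : low_cycle (fun s => f (i + a + s %% (m - a).+1)) (m - a).+1.
  by apply: (low_cycle_sub cf); [lia | rewrite /underlying fim xw].
have y1 : d (f i.+1) (f i).
  have [|D|D] := IH a.+1 _ _ c1; first by lia.
    by have := D a; rewrite modnn addn0 modn_small // (negPf Nwx).
  by have := D 0; rewrite mod0n modn_small ?addn1 ?addn0 //; lia.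
have y2 : d (f (i + m.-1)) (f i).
  have [|D|D] := IH (m - a).+1 _ _ c2; first by lia.
    have nn : (m - a).-1.+1 = m - a by lia.
    have jj : i + a + (m - a).-1 = i + m.-1 by lia.
    by have := D (m - a).-1; rewrite nn (modn_small (ltnSn _)) fim modn_small ?ltnS ?leq_pred // jj.
  by have := D (m - a); rewrite modnn addn0 modn_small // fim (negPf Nwx).
(* The only in-neighbours of x on the two cycles are the two just found, as
   another one would close a shorter cycle that is not directed. *)
have u1 t : t < a -> d (f (i + t.+1)) (f i) -> t = 0.
  move=> ta dt; have [//|t0] := posnP t.
  have [ta1|ta1] := ltnP t.+1 a; last first.
    by move: dt; rewrite (_ : t.+1 = a) ?(negPf Nwx) //; lia.
  have c3 : low_cycle (fun s => f (i + s %% t.+2)) t.+2.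
    by apply: (low_cycle_sub cf); [lia | rewrite /underlying dt].
  have [|D|D] := IH t.+2 _ _ c3; first by lia.
    by have := D 0; rewrite mod0n modn_small // addn0 addn1 (negPf (orient y1)).
  by have := D t.+1; rewrite modnn addn0 modn_small // (negPf (orient dt)).
have u2 s : s < m - a -> d (f (i + a + s)) (f i) -> s = (m - a).-1.
  move=> sma ds; have [s1|s1] := ltnP s.+1 (m - a); last by lia.
  pose n := m - a - s; have n1 : n < m by rewrite /n; lia.
  have fn : f (i + a + s + n) = f i by have -> : i + a + s + n = i + m by rewrite /n; lia.
  have c3 : low_cycle (fun t => f (i + a + s + t %% n.+1)) n.+1.
    by apply: (low_cycle_sub cf) => //; rewrite /underlying fn ds orbT.
  have [|D|D] := IH n.+1 _ _ c3; first by rewrite /n; lia.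
    by have := D n; rewrite modnn addn0 modn_small // fn (negPf (orient ds)).
  have nn : n.-1.+1 = n by rewrite /n; lia.
  have jj : i + a + s + n.-1 = i + m.-1 by rewrite /n; lia.
  have := D n.-1; rewrite nn (modn_small (ltnSn n)) fn modn_small ?ltnS ?leq_pred //.
  by rewrite jj (negPf (orient y2)).
have [c cc] : exists c, dicolouring c (W :\ f i).
  have /andP[_ /forall_inP/(_ _ (low_sub (fl i)))/dicolP[c cc]] := cW.
  by exists c.
have E1 : c (f i.+1) = c (f (i + a)).
  pose F s := f (i + s %% a.+1).
  have FE s : s < a.+1 -> F s = f (i + s) by move=> sa; rewrite /F modn_small.
  have F0 : F 0 = f i by rewrite FE ?addn0.
  have aa : a.-1.+1 = a by lia.
  rewrite -addn1 -!FE //; last by lia.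
  rewrite -aa; apply: (@single_in_mono F a c c1 _ _ 0); rewrite ?F0 ?FE ?addn1 //; try lia.
  by move=> t ta; rewrite FE //; apply: u1.
have E2 : c (f (i + a)) = c (f (i + m.-1)).
  pose F s := f (i + a + (m - a + s) %% (m - a).+1).
  have FE s : s < m - a -> F s.+1 = f (i + a + s).
    by move=> sm; rewrite /F -addSnnS modnDl modn_small //; lia.
  have F0 : F 0 = f i by rewrite /F addn0 modn_small.
  have mm : i + m.-1 = i + a + (m - a).-1 by lia.
  rewrite mm -[i + a in LHS]addn0 -!FE; [|lia..].
  apply: (@single_in_mono F (m - a) c (low_cycle_shift (m - a) c2) _ _ (m - a).-1);
    rewrite ?F0 ?FE -?mm //; try lia.
  by move=> t ta; rewrite FE //; apply: u2.
have [inj _] := low_nbrs (fl i) cc (or_introl erefl).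
have := inj _ _ _ _ (etrans E1 E2); rewrite !inE y1 y2 !(low_sub (fl _)) => /(_ isT isT)/fi/eqP.
by rewrite -addn1 eqn_modDl !modn_small; lia.
Qed.

(** This is the analogue of Gallai's theorem, by which the blocks of the low
    vertices of a critical graph are odd cycles and complete graphs. *)
Lemma low_cycle_directed m f : 2 < m -> low_cycle f m -> directed f.
Proof.
elim/ltn_ind: m f => m IH f m2 cf.
have nc := no_chord _ cf.
case: (cf) => fp fi fl fa.
have [c cc] : exists c, dicolouring c (W :\ f 0).
  have /andP[_ /forall_inP/(_ _ (low_sub (fl 0)))/dicolP[c cc]] := cW.
  by exists c.
case: m m2 cf IH nc fp fi => // l m2 cf IH nc fp fi.
apply: (chordless_directed cf _ cc) => [||i t t0 tl]; [lia..|].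
have := nc _ (i + t.+1) (l - t); rewrite (_ : i + t.+1 + (l - t) = i + l.+1) ?fp; last by lia.
by apply=> [m' f' /andP[m1 m2']||]; [exact: IH| lia..].
Qed.

Lemma consistent y a p : y \in low -> {subset a :: p <= low} -> uniq (y :: a :: p) -> p != [::] ->
  uadj y a -> path uadj a p -> uadj (last a p) y -> d y a = d (last a p) y.
Proof.
move=> yL pL up p0 ya ap py; set s := y :: a :: p in up *.
have sL u : u \in s -> u \in low by rewrite inE => /orP[/eqP->|/pL].
pose m := size s; have m2 : 2 < m by rewrite /m /s; case: (p) p0.
pose f i := nth y s (i %% m).
have im i : i %% m < m by rewrite ltn_mod; lia.
have cf : low_cycle f m.
  split=> [i|i j|i|i]; rewrite /f.
  - by rewrite modnDr.
  - by move=> /eqP; rewrite nth_uniq // => /eqP.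
  - by apply: sL; rewrite mem_nth.
  rewrite -(addn1 i) -modnDml addn1; have := im i.
  rewrite leq_eqVlt => /orP[/eqP E|lt].
    have -> : i %% m = m.-1 by have := congr1 predn E.
    by rewrite prednK ?modnn ?nth_last //; lia.
  rewrite (modn_small lt); have /(pathP y)/(_ (i %% m)) : path uadj y (a :: p) by rewrite /= ya.
  by apply.
have f0 : f 0 = y by rewrite /f mod0n.
have f1 : f 1 = a by rewrite /f modn_small //; lia.
have fl : f m.-1 = last a p by rewrite /f modn_small ?nth_last //; lia.
have fm : f m = y by rewrite /f modnn.
have mm : m.-1.+1 = m by lia.
case: (low_cycle_directed m2 cf) => D; have := D 0; have := D m.-1; rewrite mm f0 f1 fl fm.
  by move=> -> ->.
by move=> /orient/negPf-> /orient/negPf->.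
Qed.

Section Block.
Variable Q : {set V}.
Hypothesis QL : Q \subset low.

Definition avoid y := [rel u v | [&& u \in Q :\ y, v \in Q :\ y & uadj u v]].

Lemma avoid_sym y : connect_sym (avoid y).
Proof. by apply: sym_connect_sym => u v /=; rewrite uadj_sym andbCA. Qed.

(** A path from a to b that avoids y closes to a cycle through y, and this
    cycle is directed. *)
Lemma two_arms y a b : y \in Q -> a \in nbr Q y -> b \in nbr Q y -> a != b ->
  connect (avoid y) a b -> d y a = d b y.
Proof.
move=> yQ; rewrite !inE => /andP[aQ ya] /andP[bQ yb] + /connectP[p pp bE].
move: yb; rewrite bE; case/shortenP: pp => p' pp up _ yb ab.
have sub : {subset a :: p' <= Q :\ y}.
  move=> u; rewrite inE => /orP[/eqP->|].
    by rewrite !inE aQ eq_sym (uadj_neq ya).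
  elim: p' a {ya aQ up bE ab yb} pp => // v p' IH a /= /andP[/and3P[_ vQ _] pp].
  by rewrite inE => /orP[/eqP->//|/(IH v pp)].
apply: consistent.
- exact: (subsetP QL).
- by move=> u /sub; rewrite inE => /andP[_ /(subsetP QL)].
- by rewrite cons_uniq up andbT; apply/negP => /sub; rewrite !inE eqxx.
- by apply: contraNneq ab => ->.
- by [].
- by apply: sub_path pp => u v /= /and3P[].
- by rewrite uadj_sym.
Qed.

(** Three neighbours of y in one component of Q - y would give three cycles
    through y, one for each pair of them; not all of these can be directed. *)
Lemma deg_le2 y r : y \in Q -> (forall u, u \in nbr Q y -> connect (avoid y) r u) -> deg Q y <= 2.
Proof.
move=> yQ h; rewrite -card_nbr leqNgt; apply/negP => /card_gt2P[a [b [c [[aN bN cN] [ab bc ca]]]]].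
have con u v : u \in nbr Q y -> v \in nbr Q y -> connect (avoid y) u v.
  by move=> uN vN; apply: connect_trans (h v vN); rewrite avoid_sym h.
have e1 := two_arms yQ aN bN ab (con _ _ aN bN).
have e2 := two_arms yQ bN cN bc (con _ _ bN cN).
have e3 : d y a = d c y by apply: two_arms => //; [rewrite eq_sym | apply: con].
have : d y b = d b y by rewrite e2 -e3.
move: bN; rewrite inE /underlying => /andP[_]; case: (boolP (d y b)) => [yb _ E|_ /= -> //].
by have := orient yb; rewrite -E.
Qed.

Lemma avoid_path y p x : x \in p -> {subset p <= Q} -> y \notin p -> sorted uadj p ->
  exists r, forall u, u \in p -> connect (avoid y) r u.
Proof.
case: p => // r p _ pQ yp pp; exists r; apply: path_connect.
elim: p r pQ yp pp => // v p IH r pQ; rewrite inE negb_or => /andP[yr yv] /= /andP[rv pp].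
rewrite IH ?andbT //; last by move=> u uv; apply: pQ; rewrite inE uv orbT.
move: yv; rewrite inE negb_or => /andP[yv _].
by rewrite !inE rv !pQ ?inE ?eqxx ?orbT // ![_ == y]eq_sym yr yv.
Qed.

(** Let x, y be the first two vertices of a longest path of Q. All neighbours
    of x lie on the path; a neighbour of y that does not lie on it is itself
    the first vertex of a longest path, with the same continuation. If all
    degrees are at least 2, then the neighbours of x, and those of y, lie in
    one component of the rest, and [deg_le2] applies to both. *)
Lemma end_block : Q != set0 -> (exists2 z, z \in Q & deg Q z <= 1) \/
  exists x y, [/\ x \in Q, y \in Q, uadj x y, deg Q x <= 2 & deg Q y <= 2].
Proof.
move=> /set0Pn[z0 z0Q].
have [/exists_inP[z zQ dz]|] := boolP [exists z in Q, deg Q z <= 1]; first by left; exists z.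
rewrite negb_exists_in => /forall_inP deg2; right.
pose good s := [&& uniq s, all (mem Q) s & sorted uadj s].
have ex1 : exists n, [exists t : n.-tuple V, good t].
  by exists 1; apply/existsP; exists [tuple z0]; rewrite /good /= z0Q.
have bnd n : [exists t : n.-tuple V, good t] -> n <= #|V|.
  by move=> /existsP[t /and3P[/card_uniqP ut _ _]]; rewrite -(size_tuple t) -ut max_card.
case: (ex_maxnP ex1 bnd) => N /existsP[t gt] mx.
have {}mx s : good s -> size s <= N.
  by move=> gs; apply: mx; apply/existsP; exists (in_tuple s).
have first x p : good (x :: p) -> size (x :: p) = N -> {subset nbr Q x <= p}.
  move=> /and3P[/= /andP[xp up] /andP[xQ pQ] pp] sN u; rewrite inE => /andP[uQ xu].
  apply: contraT => nup; have := mx (u :: x :: p); rewrite /= -sN ltnn; apply.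
  rewrite /good /= inE negb_or eq_sym (uadj_neq xu) nup xp up pQ uadj_sym xu pp.
  by rewrite -!topredE /= in uQ xQ *; rewrite uQ xQ.
have other x y : x \in Q -> exists2 w, w \in nbr Q x & w != y.
  move=> /deg2; rewrite -ltnNge -card_nbr => n2.
  have : 0 < #|nbr Q x :\ y| by have := cardsD1 y (nbr Q x); lia.
  by move=> /card_gt0P[w]; rewrite !inE => /andP[wy wx]; exists w; rewrite ?inE.
case: t gt => -[|x p] /= st gt.
  by have := mx [:: z0]; rewrite -(eqP st) /good /= z0Q => /(_ isT).
have pN := eqP st.
have xp := first x p gt pN.
have [xnp up /andP[xQ pQ] pp] : [/\ x \notin p, uniq p, (x \in Q) && all (mem Q) p & sorted uadj p].
  by move: (gt); rewrite /good /= => /and3P[/andP[? ?] ? /path_sorted].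
have /allP pQ' := pQ.
exists x; have [y0 /xp y0p _] := other x x xQ.
case: p xp pN gt up pQ pQ' pp y0p xnp st => // y q xp pN gt up pQ pQ' pp _ xnp st.
have yQ : y \in Q by apply: pQ'; rewrite mem_head.
have xy : uadj x y by case/and3P: gt => _ _ /= /andP[].
exists y; split=> //.
  have [r hr] := avoid_path (mem_head y q) pQ' xnp pp.
  by apply: (deg_le2 (r := r) xQ) => u /xp/hr.
have [yq uq] : y \notin q /\ uniq q by apply/andP.
have qQ : {subset q <= Q} by move=> u uq'; apply: pQ'; rewrite inE uq' orbT.
have [w wN wy] := other x y xQ.
have wq : w \in q by have := xp w wN; rewrite inE (negPf wy).
have [r hr] := avoid_path wq qQ yq (path_sorted pp).
have viaq u : u \in Q -> u != y -> (exists2 v, v \in nbr Q u & v \in q) -> connect (avoid y) r u.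
  move=> uQ uy [v vN vq]; apply: connect_trans (hr v vq) _; apply: connect1.
  move: vN; rewrite /= !inE => /andP[vQ uv]; rewrite uQ uy vQ uadj_sym uv !andbT.
  by apply: contraNneq yq => <-.
apply: (deg_le2 (r := r) yQ) => u; rewrite inE => /andP[uQ yu].
have uy : u != y by rewrite eq_sym uadj_neq.
have [uq'|nuq] := boolP (u \in q); first exact: hr.
apply: viaq => //; have [->|ux] := eqVneq u x; first by exists w.
have gu : good [:: u, y & q].
  rewrite /good /= inE negb_or uy nuq yq uq uadj_sym yu; move: pQ pp => /= -> ->.
  by rewrite -!topredE /= in uQ *; rewrite uQ.
have fu := first u (y :: q) gu pN.
have [v vN vy] := other u y uQ; exists v => //.
by have := fu v vN; rewrite inE (negPf vy).
Qed.

End Block.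

Lemma low_deg2 Q : Q \subset low -> Q != set0 -> exists2 z, z \in Q & deg Q z <= 2.
Proof.
move=> QL /(end_block QL)[[z zQ dz]|[x [y [xQ _ _ dx _]]]]; last by exists x.
by exists z => //; lia.
Qed.

(** The underlying graph of the low vertices is a cactus. By [end_block] it
    can be taken apart by removing one vertex with at most one arc, or two
    vertices with three arcs. *)
Lemma low_arcs Q : Q \subset low -> Q != set0 -> 2 * e Q + 3 <= 3 * #|Q|.
Proof.
have [n] := ubnP #|Q|; elim: n Q => // n IH Q Qn QL Q0.
have d0 z : deg (Q :\ z) z <= deg Q z.
  by apply: leq_add; [apply: din_sub|apply: dout_sub]; exact: subsetDl.
have [[z zQ dz]|[x [y [xQ yQ xy dx dy]]]] := end_block QL Q0.
  have c1 := cardsD1 z Q; rewrite zQ in c1; rewrite (size_arcs_D1 zQ).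
  have dz1 := leq_trans (d0 z) dz.
  have [E|Qz] := eqVneq (Q :\ z) set0.
    have := size_arcs_le (Q :\ z); have := card_nbr (Q :\ z) z.
    rewrite E cards0 (_ : nbr set0 z = set0) ?cards0; last by apply/setP => u; rewrite !inE.
    by rewrite E cards0 in c1 *; rewrite c1; lia.
  have := IH (Q :\ z) _ (subset_trans (subsetDl _ _) QL) Qz; lia.
have c1 := cardsD1 x Q; rewrite xQ in c1.
have yQx : y \in Q :\ x by rewrite !inE yQ eq_sym uadj_neq.
have c2 := cardsD1 y (Q :\ x); rewrite yQx in c2.
rewrite (size_arcs_D1 xQ) (size_arcs_D1 yQx).
have e1 : deg (Q :\ x :\ y) y < 2.
  have := deg_D1 y xQ; rewrite uadj_sym xy => E; rewrite E in dy.
  apply: leq_trans dy; rewrite add1n ltnS; apply: leq_add; [apply: din_sub|apply: dout_sub]; exact: subsetDl.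
have dx2 := leq_trans (d0 x) dx.
have [E|Qz] := eqVneq (Q :\ x :\ y) set0.
  rewrite E cards0 in c2 e1 *.
  have := size_arcs_D1 xQ; rewrite (size_arcs_D1 yQx) E => eQ.
  by have := size_arcs_le Q; rewrite c1 c2 eQ; lia.
have := IH (Q :\ x :\ y) _ (subset_trans (subset_trans (subsetDl _ _) (subsetDl _ _)) QL) Qz; lia.
Qed.

(** A vertex of degree at most 2 in Q has degree at most 3 in z |: Q, so its
    in-degree or its out-degree is at most 1 and it can be coloured last. *)
Lemma low_dicol2 Q z : Q \subset low -> dicol 2 (z |: Q).
Proof.
have [n] := ubnP #|Q|; elim: n Q => // n IH Q Qn QL.
have [->|Q0] := eqVneq Q set0.
  by rewrite setU0 -(setUid [set z]); apply: (@dicol_union 1 1); apply: dicol1;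
    rewrite -(setUid [set z]); apply: acyclic_pair.
have [v vQ dv] := low_deg2 QL Q0.
have c1 := cardsD1 v Q; rewrite vQ in c1.
have := IH (Q :\ v) _ (subset_trans (subsetDl _ _) QL); move=> /(_ ltac:(lia)) c2.
apply: (@dicol_sub 2 (v |: (z |: Q :\ v))).
  by apply/subsetP => u; rewrite !inE; case: (u == z); case: (u == v).
apply: dicol_greedy c2 _.
have : deg (z |: Q :\ v) v <= 3.
  rewrite -card_nbr; apply: (@leq_trans #|z |: nbr Q v|).
    apply: subset_leq_card; apply/subsetP => u; rewrite !inE.
    by case: (u == z) => //=; case: (u \in Q); rewrite /= ?andbF //; case: (u == v).
  by rewrite cardsU1 card_nbr; lia.
by rewrite /deg; case: (ltnP (din _ v) 2) => //=; lia.
Qed.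

End Gallai.

(** * Sparse digraphs are 4-dicolourable *)

Lemma size_arcs_sub W W' : W' \subset W -> e W' <= e W.
Proof.
move=> /subsetP s; apply: subset_leq_card; apply/subsetP => p; rewrite !inE.
by move=> /and3P[/s-> /s-> ->].
Qed.

(** A critical subset has seven vertices and too few arcs, or eight vertices
    and 16 arcs; in the latter case all of them are low, which contradicts
    [low_deg2]. *)
Lemma dicol2_sparse W : e W <= 16 -> dicol 2 W.
Proof.
move=> eW; apply: contraT => /critical_exists[H HW cH].
have e1 := critical_arcs cH; have e2 := leq_trans (size_arcs_sub HW) eW.
have h6 : 6 < #|H| by rewrite ltnNge; apply: contra (critical_ndicol cH); exact: dicol2_le6.
have [H7|H7] := eqVneq #|H| 7.
  by move: (critical_ndicol cH); rewrite dicol2_card7 //; lia.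
have H8 : #|H| = 8 by lia.
have d4 v : v \in H -> 4 <= deg H v.
  by move=> /(critical_deg cH)[i o]; rewrite /deg; lia.
have [v vH] : exists v, v \in H by apply: (critical_neq0 _ cH).
have HL : H \subset low 2 H.
  apply/subsetP => u uH; rewrite inE uH /=.
  by rewrite (sum_tight d4 _ uH) ?sum_deg ?H8 //; lia.
have [|z zH] := low_deg2 cH HL; first by apply/set0Pn; exists v.
by have := d4 z zH; lia.
Qed.

Lemma critical_peel k W A : critical k.+1 W -> A \subset W -> acyclic A ->
  exists2 H : {set V}, H \subset W :\: A & critical k H.
Proof.
move=> cW AW aA; apply: critical_exists; apply: contra (critical_ndicol cW); exact: dicol_peel.
Qed.

(** Outside a suitable maximal acyclic set there are at most 12 vertices,
    among which there is a set that is critical for three colours. By [excess]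
    it has fewer arcs than such a set needs. *)
Lemma critical4_ge19 W : critical 4 W -> e W <= 3 * #|W| + 24 -> 18 < #|W|.
Proof.
move=> cW eW; rewrite ltnNge; apply/negP => W18.
have [v0 v0W] : exists v, v \in W by apply: (critical_neq0 _ cW).
have n10 : 10 < #|W|.
  rewrite ltnNge; apply: contra (critical_ndicol cW) => W10; apply: (@dicol_step _ 1).
    by apply: has_acyclic1; apply/card_gt0P; exists v0.
  by move=> W' cW'; apply: dicol3_le10; lia.
have n14 : 14 < #|W|.
  rewrite ltnNge; apply: contra (critical_ndicol cW) => W14; apply: (@dicol_step _ 4).
    by apply: has_acyclic4; lia.
  by move=> W' cW'; apply: dicol3_le10; lia.
have [|v vW dv] := @low_indegree W 4; first by lia.
have [dv2 _] := critical_deg cW vW.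
have {dv2}dv : din W v = 4 by apply/eqP; rewrite eqn_leq dv.
have cb := card_nonin vW.
have [a [a1 a2 a3]] : exists a, [/\ has_acyclic W a, #|W| <= a + 12 & #|W| < 18 -> #|W| <= a + 11].
  have [n16|n16] := leqP #|W| 16.
    exists 5; split; [|lia..]; apply: (has_acyclic_nonin vW); apply: has_acyclic4; lia.
  exists 6; split; [|lia..]; apply: (has_acyclic_nonin vW).
  pose S := nonin W v; rewrite -/S in cb *; have SW : S \subset W := nonin_sub W v.
  have eS := size_arcs_split SW.
  have c0 : #|W :\: S| = 5 by rewrite cardsD (setIidPr SW); lia.
  have c1 := size_arcs_le (W :\: S); rewrite c0 /= in c1.
  have c2 : \sum_(x in W :\: S) 8 <= \sum_(x in W :\: S) deg W x.
    apply: leq_sum => x; rewrite inE => /andP[_ /(critical_deg cW)[i o]]; rewrite /deg; lia.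
  have c3 : \sum_(x in W :\: S) deg W x = 2 * e (W :\: S) + \sum_(x in S) deg (W :\: S) x.
    rewrite -sum_deg (sum_degC S) -big_split /=; apply: eq_bigr => x _.
    by rewrite (deg_split x SW) addnC.
  rewrite sum_nat_const c0 in c2.
  have [|u uS du] := @low_indegree S 3; first by lia.
  apply: (has_acyclic_nonin uS); apply: has_acyclic4.
  by have := card_nonin uS; lia.
have [A [AW aA cA hA]] := max_acyclic a1.
have [H HA cH] := critical_peel cW AW aA.
have x1 := excess cW AW HA hA.
have hH : 10 < #|H|.
  by rewrite ltnNge; apply: contra (critical_ndicol cH); exact: dicol3_le10.
have := subset_leq_card HA; rewrite cardsD (setIidPr AW) => cHA.
have [H11|H11] := eqVneq #|H| 11; first by have := critical3_card11 cH H11; lia.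
have H12 : #|H| = 12 by lia.
by have := critical3_card12 cH H12; lia.
Qed.

Theorem sparse_dicol4 : (forall W, W != set0 -> e W <= 3 * #|W| + 24) -> forall W, dicol 4 W.
Proof.
move=> sparse W0; apply: contraT => /critical_exists[W _ cW] {W0}; exfalso.
have [v0 v0W] : exists v, v \in W by apply: (critical_neq0 _ cW).
have eW : e W <= 3 * #|W| + 24 by apply: sparse; apply/set0Pn; exists v0.
have n19 := critical4_ge19 cW eW.
pose L := low 4 W; pose N := W :\: L.
have LW : L \subset W by apply/subsetP => x; exact: low_sub.
have cLN : #|W| = #|L| + #|N|.
  by rewrite /N cardsD (setIidPr LW) subnKC // subset_leq_card.
have dL x : x \in L -> deg W x = 8.
  rewrite inE => /andP[/(critical_deg cW)[i o]]; rewrite /deg; lia.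
have s1 : \sum_(x in L) deg W x = 8 * #|L|.
  by rewrite (eq_bigr _ dL) sum_nat_const mulnC.
have s2 : 9 * #|N| <= \sum_(x in N) deg W x.
  rewrite mulnC -sum_nat_const; apply: leq_sum => x.
  by rewrite !inE negb_and -ltnNge => /andP[/orP[/negPf->|]].
have s3 := sum_deg W; rewrite (sum_split _ LW) -/N s1 in s3.
have s4 : \sum_(x in L) deg W x = 2 * e L + \sum_(x in L) deg N x.
  by rewrite -sum_deg -big_split /=; apply: eq_bigr => x _; rewrite (deg_split x LW).
have s5 := size_arcs_split LW; rewrite -/N in s5.
have L0 : L != set0 by rewrite -card_gt0; lia.
have eL := low_arcs cW (subxx L) L0.
have fin z : e (N :\ z) <= 16 -> False.
  move=> /dicol2_sparse cN; move/negP: (critical_ndicol cW); apply.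
  apply: dicol_sub (dicol_union cN (low_dicol2 cW z (subxx L))).
  apply/subsetP => x xW; rewrite in_setU in_setD1 in_setU1 in_setD xW.
  by case: (x == z); case: (x \in L).
have eD z := size_arcs_sub (subsetDl N [set z]).
have e4 := critical_arcs cW.
have [|Nz] := leqP (e N) 16; first by move=> eN; apply: (fin v0); apply: leq_trans (eD _) eN.
have N6 : 6 < #|N|.
  rewrite ltnNge; apply/negP => N6; have := size_arcs_le N.
  have : #|N| * #|N|.-1 <= 6 * 5 by apply: leq_mul => //; lia.
  by lia.
(* Only n = 19 with nine low vertices is left. A vertex z of maximum degree
   among the ten others is moved to the low vertices. *)
have [L9 N10 eN] : [/\ #|L| = 9, #|N| = 10 & e N <= 21] by split; lia.
have [z zN dz] : exists2 z, z \in N & e N <= deg N z + 16.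
  apply/exists_inP; apply: contraT; rewrite negb_exists_in => /forall_inP h.
  have : \sum_(x in N) deg N x <= \sum_(x in N) (e N - 17).
    by apply: leq_sum => x /h; lia.
  by rewrite sum_deg sum_nat_const N10; lia.
by apply: (fin z); have := size_arcs_D1 zN; have := deg_D1 z zN; rewrite /underlying dF; lia.
Qed.

Lemma acyclic_no_cycle A (p : seq V) : acyclic A -> p != [::] -> {subset p <= A} -> cycle d p -> False.
Proof.
move=> /acyclicP/(_ [set x in p]) h p0 pA cp; case: h => [||v].
- by apply/subsetP => x; rewrite inE => /pA.
- by case: p p0 {pA cp} => // x p _; apply/set0Pn; exists x; rewrite inE mem_head.
- rewrite inE => vp h; have := h (prev p v); rewrite inE mem_prev vp => /(_ isT).
  by rewrite prev_cycle.
Qed.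

End Colouring.

(** * Minors of a cell complex modulo 2 *)

Local Notation "\xor_ ( i | P ) F" := (\big[addb/false]_(i | P) F)
  (at level 41, F at level 41, i, P at level 50).
Local Notation "\xor_ i F" := (\big[addb/false]_i F)
  (at level 41, F at level 41, i at level 0).

Section Complex.
Variables (P E F : finType) (src tgt : E -> P) (sd1 sd2 : E -> F) (good : pred E).

(** Chains modulo 2 are boolean functions; E may list edges that do not belong
    to the complex, and [good] selects those that do. *)
Definition bnd (z : E -> bool) (p : P) : bool :=
  \xor_(e | good e) (z e && ((src e == p) (+) (tgt e == p))).

(** The edges between the region w and its complement, that is, the boundary
    of the chain w of faces. *)
Definition cobnd (w : F -> bool) (e : E) : bool := w (sd1 e) (+) w (sd2 e).

Lemma bndD z1 z2 p : bnd (fun e => z1 e (+) z2 e) p = bnd z1 p (+) bnd z2 p.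
Proof.
by rewrite /bnd -big_split /=; apply: eq_bigr => e _; rewrite andb_addl.
Qed.

Lemma bnd_xor (J : finType) (t : J -> bool) (Z : J -> E -> bool) p :
  bnd (fun e => \xor_j (t j && Z j e)) p = \xor_j (t j && bnd (Z j) p).
Proof.
under [RHS]eq_bigr do rewrite /bnd big_distrr.
rewrite /bnd exchange_big /=; apply: eq_bigr => e _.
by rewrite big_distrl; apply: eq_bigr => j _ /=; rewrite andbA.
Qed.

Section Minor.
Variables (V I : finType) (a b : I -> V) (br : P -> option V) (link : I -> E).
Hypothesis ab : forall i, a i != b i.
Hypothesis simple : forall i j, [set a i; b i] = [set a j; b j] -> i = j.

Definition joins (e : E) (p q : P) :=
  good e && (((src e == p) && (tgt e == q)) || ((src e == q) && (tgt e == p))).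

(** The set of the points p with [br p = Some v] is the branch set of v in the
    minor. *)
Definition branch_adj (p q : P) : bool := (br p == br q) && [exists e, joins e p q].

Hypothesis conn : forall p q, br p != None -> br p = br q -> connect branch_adj p q.
Hypothesis link_good : forall i, good (link i).
Hypothesis link_ends : forall i,
  (br (src (link i)) = Some (a i) /\ br (tgt (link i)) = Some (b i)) \/
  (br (src (link i)) = Some (b i) /\ br (tgt (link i)) = Some (a i)).

Definition inner (e : E) := good e && (br (src e) == br (tgt e)).

Lemma link_inj : injective link.
Proof.
move=> i j ij; apply: simple; move: (link_ends i) (link_ends j); rewrite ij.
move=> [[-> ->]|[-> ->]] [[[-> ] [->]]|[[->] [->]]] //; by rewrite setUC.
Qed.

Lemma link_inner i : inner (link i) = false.
Proof.
rewrite /inner link_good /=.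
by case: (link_ends i) => [[-> ->]|[-> ->]]; apply/eqP => -[/eqP];
  [|rewrite eq_sym]; apply/negP.
Qed.

Lemma bnd1 e x : good e -> bnd (pred1 e) x = (src e == x) (+) (tgt e == x).
Proof.
move=> ge; rewrite /bnd (bigD1 e) //= eqxx /= big1 ?addbF // => e' /andP[_ /negPf->].
by [].
Qed.

Lemma path_chain p q : connect branch_adj p q ->
  exists z : E -> bool, (forall e, z e -> inner e) /\
    forall x, bnd z x = (x == p) (+) (x == q).
Proof.
move=> /connectP [s ps ->] {q}; elim: s p ps => [|q s IH] p /=.
  move=> _; exists (fun=> false); split=> // x.
  by rewrite /bnd big1 // addbb.
move=> /andP[/andP[brpq /existsP[e]]] /andP[ge eP] /IH [z [zin zb]].
exists (fun e' => pred1 e e' (+) z e'); split.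
  move=> e' /=; case: eqP => [->|_ /zin //] _; rewrite /inner ge /=.
  by case/orP: eP => /andP[/eqP-> /eqP->] //; rewrite eq_sym.
move=> x; rewrite bndD zb bnd1 // ![x == _]eq_sym.
by case/orP: eP => /andP[/eqP-> /eqP->]; case: (p == x) (q == x) => -[] //=;
 case: (_ == _).
Qed.

(** Join each point of t to a fixed point of its branch set by a path. The
    number of paths that end in the fixed point is even. *)
Lemma even_boundary (t : P -> bool) :
  (forall p, t p -> br p != None) ->
  (forall v, \xor_(p | br p == Some v) t p = false) ->
  exists z : E -> bool, (forall e, z e -> inner e) /\ forall x, bnd z x = t x.
Proof.
move=> tbr t0.
pose base p := odflt p [pick q | br q == br p].
have base_br p : br (base p) = br p.
  by rewrite /base; case: pickP => [q /eqP //|/(_ p)]; rewrite eqxx.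
have baseE p q : br p = br q -> base p = base q.
  by rewrite /base => ->; case: pickP => // /(_ q); rewrite eqxx.
have /fin_all_exists [Z ZP] : forall p, exists z : E -> bool,
    t p -> (forall e, z e -> inner e) /\
    forall x, bnd z x = (x == p) (+) (x == base p).
  move=> p; case tp : (t p); last by exists (fun=> false).
  have [z zP] := path_chain (conn (tbr _ tp) (esym (base_br p))).
  by exists z.
exists (fun e => \xor_p (t p && Z p e)); split.
  move=> e; apply: contraLR => ne; rewrite big1 // => p _.
  case tp : (t p) => //=; apply/negbTE; apply: contra ne => /(proj1 (ZP p tp)).
  by [].
move=> x; rewrite bnd_xor.
transitivity (\xor_p ((t p && (x == p)) (+) (t p && (x == base p)))).
  apply: eq_bigr => p _; case tp : (t p) => //=.
  by rewrite (proj2 (ZP p tp)).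
rewrite big_split /= (bigD1 x) //= eqxx andbT big1 ?addbF; last first.
  by move=> p /negPf; rewrite eq_sym => ->; rewrite andbF.
suff -> : \xor_p (t p && (x == base p)) = false by rewrite addbF.
have [p /eqP xp|nx] := pickP (fun p => x == base p); last first.
  by rewrite big1 // => p _; rewrite nx andbF.
case brp : (br p) => [v|]; last first.
  rewrite big1 // => q _; case tq : (t q) => //=; apply/eqP => xq.
  by move: (tbr _ tq); rewrite -(base_br q) -xq xp base_br brp.
rewrite -[RHS](t0 v) [RHS]big_mkcond; apply: eq_bigr => q _; rewrite xp.
case: (eqVneq (br q) (Some v)) => [qv|qv].
  by rewrite -(baseE q p) ?eqxx ?andbT // qv brp.
case: eqP => [e|]; rewrite ?andbF //.
by move: qv; rewrite -(base_br q) -e base_br brp eqxx.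
Qed.

Definition even (c : I -> bool) :=
  forall v, \xor_(i | (a i == v) || (b i == v)) c i = false.

Lemma ends_parity (i : I) (v : V) :
  (br (src (link i)) == Some v) (+) (br (tgt (link i)) == Some v) =
  ((a i == v) || (b i == v)).
Proof.
have e (x y : V) : (Some x == Some y) = (x == y) by [].
have nab : (b i == a i) = false by rewrite eq_sym; apply/negbTE.
case: (link_ends i) => [[-> ->]|[-> ->]]; rewrite !e;
by case: (eqVneq (a i) v) => [<-|_]; rewrite ?nab ?addbF.
Qed.

Lemma xor_pick1 (J : finType) (Q : pred J) x :
  \xor_(p | Q p) (x == p) = Q x.
Proof.
case Qx : (Q x).
  by rewrite (bigD1 x) //= eqxx big1 // => p /andP[_]; rewrite eq_sym => /negPf.
by rewrite big1 // => p; case: eqP => // <-; rewrite Qx.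
Qed.

(** Every cycle of the minor becomes a cycle of the complex: inside the branch
    sets the ends of its links can be joined, by [even_boundary]. *)
Lemma lift_even (c : I -> bool) : even c -> exists z : E -> bool,
  [/\ forall x, bnd z x = false, forall i, z (link i) = c i &
    forall e, z e -> good e -> inner e \/ exists i, e = link i].
Proof.
move=> ce.
pose l e := \xor_i (c i && pred1 (link i) e).
pose t x := bnd l x.
have tE x : t x = \xor_i (c i && ((src (link i) == x) (+) (tgt (link i) == x))).
  rewrite /t /l bnd_xor; apply: eq_bigr => i _; by rewrite bnd1.
have lE i : l (link i) = c i.
  rewrite /l (bigD1 i) //= eqxx andbT big1 ?addbF // => j /negPf ji.
  by rewrite (inj_eq link_inj) eq_sym ji andbF.
have lx e : l e -> exists i, e = link i.
  have [i /eqP ->|ni] := pickP (fun i => e == link i); first by exists i.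
  by rewrite /l big1 // => i _; rewrite /= ni andbF.
have [| |z0 [z0in z0b]] := @even_boundary t.
- move=> p; rewrite tE; apply: contraTneq => np; rewrite big1 // => i _.
  have [/eqP sp|_] := boolP (src (link i) == p).
    by move: (link_ends i); rewrite sp np => -[[]|[]].
  have [/eqP tp|_] := boolP (tgt (link i) == p).
    by move: (link_ends i); rewrite tp np => -[[]|[]].
  by rewrite andbF.
- move=> v; under eq_bigr do rewrite tE.
  rewrite exchange_big /= -[RHS](ce v) [RHS]big_mkcond; apply: eq_bigr => i _.
  rewrite -big_distrr /= big_split /= !xor_pick1 ends_parity.
  by case: ifP; rewrite ?andbT ?andbF.
exists (fun e => l e (+) z0 e); split.
- by move=> x; rewrite bndD z0b addbb.
- move=> i; rewrite lE; case z0l: (z0 (link i)); rewrite ?addbF //.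
  by move: (z0in _ z0l); rewrite link_inner.
- move=> e /=; case le : (l e) => /= ze _; [by right; exact: lx|by left; exact: z0in].
Qed.

Hypothesis dd : forall w p, bnd (cobnd w) p = false.
Variables (h : nat) (T : finType) (s : (E -> bool) -> T).
Hypothesis cardT : #|T| = 2 ^ h.
Hypothesis hom : forall z1 z2 : E -> bool,
  (forall p, bnd z1 p = false) -> (forall p, bnd z2 p = false) -> s z1 = s z2 ->
  exists w, forall e, good e -> z1 e (+) z2 e = cobnd w e.

Definition in_minor (e : E) := inner e || [exists i, e == link i].

(** Two faces are adjacent across an edge that is not in the minor, so the
    components are the regions into which the minor divides the surface. *)
Definition dual_adj (f g : F) := [exists e, [&& good e, ~~ in_minor e &
  ((sd1 e == f) && (sd2 e == g)) || ((sd1 e == g) && (sd2 e == f))]].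

Lemma dual_adj_sym : symmetric dual_adj.
Proof. by move=> f g; apply: eq_existsb => e; rewrite orbC. Qed.

Let csym : connect_sym dual_adj := sym_connect_sym dual_adj_sym.

Definition in_face (C : F) (f : F) : bool := root dual_adj f == C.

Lemma cobnd_in_face C e : good e -> cobnd (in_face C) e -> in_minor e.
Proof.
move=> ge; apply: contraLR => nH; rewrite /cobnd /in_face.
have /eqP-> : root dual_adj (sd1 e) == root dual_adj (sd2 e).
  apply/eqP; apply/rootP => //; apply/connect1/existsP; exists e.
  by rewrite ge nH !eqxx.
by rewrite addbb.
Qed.

Definition rim (C : F) (i : I) : bool := cobnd (in_face C) (link i).

(** Sum the identity dd = 0 over the branch set of v; the edges inside the
    branch set cancel. *)
Lemma rim_even w : (forall e, good e -> cobnd w e -> in_minor e) ->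
  even (fun i => cobnd w (link i)).
Proof.
move=> wH v.
have: \xor_(p | br p == Some v) bnd (cobnd w) p = false.
  by rewrite big1 // => p _; rewrite dd.
rewrite /bnd exchange_big /=.
under eq_bigr => e _.
  rewrite -big_distrr /= big_split /= !xor_pick1. over.
move=> sum0; rewrite -[RHS]sum0 {sum0}.
rewrite (bigID (fun e => e \in codom link)) /= [X in _ = _ (+) X]big1 ?addbF.
  rewrite [RHS](eq_bigl (fun e => e \in [set link i | i in I])); last first.
    move=> e; apply/andP/imsetP => [[_ /codomP[i ->]]|[i _ ->]]; first by exists i.
    by rewrite link_good codom_f.
  rewrite big_imset /=; last by move=> ? ? _ _; apply: link_inj.
  rewrite [LHS]big_mkcond; apply: eq_big => // i _; rewrite ends_parity.
  by case: ifP; rewrite ?andbT ?andbF.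
move=> e /andP[ge ne]; case we: (cobnd w e) => //=.
have /orP[/andP[_ /eqP->]|/existsP[i /eqP ei]] := wH e ge we; first by rewrite addbb.
by move: ne; rewrite ei codom_f.
Qed.

(** At both ends of an edge another edge must follow, and the two are distinct
    in a simple graph. *)
Lemma even_three (c : I -> bool) : even c -> (exists i, c i) -> 2 < #|[set i | c i]|.
Proof.
move=> ce [i ci].
have other v : (a i == v) || (b i == v) ->
    exists2 j, j != i & c j && ((a j == v) || (b j == v)).
  move=> iv; have := ce v; rewrite (bigD1 i) //= ci => /negbT; rewrite negb_add.
  have [j /and3P[jv ji cj]|nj] :=
    pickP (fun j => [&& (a j == v) || (b j == v), j != i & c j]).
    by move=> _; exists j => //; rewrite cj jv.
  by rewrite big1 // => j /andP[jv ji]; move: (nj j); rewrite jv ji /=.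
have [|j ji /andP[cj ja]] := other (a i); first by rewrite eqxx.
have [|k ki /andP[ck kb]] := other (b i); first by rewrite eqxx orbT.
have jk : j != k.
  apply: contra_neq ji => jk; apply: simple; subst k.
  have nab := ab i.
  case/orP: ja => /eqP ja; case/orP: kb => /eqP kb; rewrite ?ja ?kb //.
  - by rewrite -ja -kb eqxx in nab.
  - by rewrite setUC.
  - by rewrite -ja -kb eqxx in nab.
have: [set i; j; k] \subset [set i | c i].
  by apply/subsetP => x; rewrite !inE => /orP[/orP[]|] /eqP->.
move/subset_leq_card; rewrite -setUA cardsU1 !inE cards2 jk.
by rewrite eq_sym (negPf ji) eq_sym (negPf ki).
Qed.

(** The restrictions to the links of those boundaries that stay inside the
    minor. *)
Definition bounding : {set {ffun I -> bool}} :=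
  [set c : {ffun I -> bool} | [exists w : {ffun F -> bool},
     [forall e, (good e && cobnd w e) ==> in_minor e] &&
     [forall i, c i == cobnd w (link i)]]].

Definition faces : {set F} := [set C | [exists i, rim C i]].

Lemma rim_face i C : rim C i -> C = root dual_adj (sd1 (link i)) \/ C = root dual_adj (sd2 (link i)).
Proof.
by rewrite /rim /cobnd /in_face; do 2 case: eqP => [->|_]; auto.
Qed.

Lemma faces_count : 3 * #|faces| <= 2 * #|I|.
Proof.
have -> : 3 * #|faces| = \sum_(C in faces) 3 by rewrite sum_nat_const mulnC.
apply: (@leq_trans (\sum_(C in faces) \sum_(i | rim C i) 1)).
  apply: leq_sum => C; rewrite inE => /existsP[i ri]; rewrite sum1_card.
  have := @even_three (rim C) (rim_even (@cobnd_in_face C)) (ex_intro _ i ri).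
  by rewrite cardsE.
rewrite (exchange_big_dep xpredT) //= mulnC -sum_nat_const.
apply: leq_sum => i _; rewrite sum1_card.
apply: leq_trans (subset_leq_card (_ : _ \subset
  [set root dual_adj (sd1 (link i)); root dual_adj (sd2 (link i))])) _.
  by apply/subsetP => C /andP[_ /rim_face]; rewrite !inE => -[->|->]; rewrite eqxx ?orbT.
by rewrite cards2; case: eqP.
Qed.

(** So w is a union of regions. *)
Lemma root_const (w : F -> bool) : (forall e, good e -> cobnd w e -> in_minor e) ->
  forall f, w (root dual_adj f) = w f.
Proof.
move=> wH f; have /connectP[p pp ->] := connect_root dual_adj f.
elim: p f pp => //= g p IH f /andP[/existsP[e /and3P[ge nH eP]] /IH ->].
have: cobnd w e = false by apply: contraNF nH; apply: wH.
by rewrite /cobnd; case/orP: eP => /andP[/eqP-> /eqP->]; case: (w f); case: (w g).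
Qed.

(** The union w of regions may be replaced by its complement, so one region
    can be left out. *)
Lemma card_bounding : #|bounding| <= 2 ^ (#|faces|.-1).
Proof.
have [C0 C0f|f0] := pickP (mem faces); last first.
  rewrite (_ : #|faces| = 0); last by apply: eq_card0.
  have: bounding \subset [set [ffun=> false]].
    apply/subsetP => c; rewrite !inE => /existsP[w /andP[/forallP wH /forallP cw]].
    apply/eqP/ffunP => i; rewrite ffunE (eqP (cw i)) /cobnd.
    have wH' e : good e -> cobnd w e -> in_minor e.
      by move=> ge we; have := wH e; rewrite ge we.
    rewrite -(root_const wH' (sd1 _)) -(root_const wH' (sd2 _)).
    have := f0 (root dual_adj (sd1 (link i))); rewrite /= inE => /negbT/existsPn/(_ i).
    rewrite /rim /cobnd /in_face eqxx /= negbK => /eqP ->; exact: addbb.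
  by move/subset_leq_card; rewrite cards1.
have wP c : exists w : {ffun F -> bool}, c \in bounding ->
   [/\ forall e, good e -> cobnd w e -> in_minor e, forall i, c i = cobnd w (link i) &
     w C0 = false].
  have [|_] := boolP (c \in bounding); last by exists [ffun=> false].
  rewrite inE => /existsP[w /andP[/forallP wH /forallP cw]].
  exists [ffun f => w f (+) w C0] => _.
  have wE e : cobnd [ffun f => w f (+) w C0] e = cobnd w e.
    by rewrite /cobnd !ffunE addbACA addbb addbF.
  split; last by rewrite ffunE addbb.
    by move=> e ge; rewrite wE => we; have := wH e; rewrite ge we.
  by move=> i; rewrite wE; apply/eqP.
have [W WP] := fin_all_exists wP.
pose code (c : {ffun I -> bool}) := [set C in faces :\ C0 | W c C].
have code_inj : {in bounding &, injective code}.
  move=> c c' cM c'M /setP cc'.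
  have [wH cE w0] := WP c cM; have [wH' cE' w0'] := WP c' c'M.
  apply/ffunP => i; rewrite cE cE' /cobnd.
  rewrite -(root_const wH (sd1 _)) -(root_const wH (sd2 _)).
  rewrite -(root_const wH' (sd1 _)) -(root_const wH' (sd2 _)).
  set x := root dual_adj (sd1 _); set y := root dual_adj (sd2 _).
  have [->|xy] := eqVneq x y; first by rewrite !addbb.
  have agree C : C \in faces -> W c C = W c' C.
    move=> Cf; have [->|CC0] := eqVneq C C0; first by rewrite w0 w0'.
    by have := cc' C; rewrite !inE CC0 /=; move: Cf; rewrite inE => ->.
  have xf : x \in faces.
    rewrite inE; apply/existsP; exists i.
    by rewrite /rim /cobnd /in_face -/x -/y eqxx eq_sym (negPf xy).
  have yf : y \in faces.
    rewrite inE; apply/existsP; exists i.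
    by rewrite /rim /cobnd /in_face -/x -/y eqxx (negPf xy).
  by rewrite !agree.
rewrite -(card_in_imset code_inj).
have: code @: bounding \subset powerset (faces :\ C0).
  apply/subsetP => _ /imsetP[c _ ->]; rewrite inE; apply/subsetP => C.
  by rewrite inE => /andP[].
move/subset_leq_card; rewrite card_powerset.
by rewrite (cardsD1 C0 faces) (C0f : C0 \in faces) add1n.
Qed.

Lemma card_fibers (X Y : finType) (A : {set X}) (B : {set Y}) (f : X -> Y) k :
  (forall x, x \in A -> f x \in B) ->
  (forall y, y \in B -> #|[set x in A | f x == y]| <= k) ->
  #|A| <= #|B| * k.
Proof.
move=> fAB fk; rewrite -sum1_card (partition_big f (mem B)) //=.
rewrite -sum_nat_const; apply: leq_sum => y yB; rewrite sum1_card.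
by apply: leq_trans (fk y yB); rewrite cardsE.
Qed.

Definition cycles : {set {ffun I -> bool}} :=
  [set c : {ffun I -> bool} | [forall v, ~~ \xor_(i | (a i == v) || (b i == v)) c i]].

Definition addf (c d : {ffun I -> bool}) : {ffun I -> bool} := [ffun i => c i (+) d i].

Lemma addf_inj c : injective (addf c).
Proof.
by move=> d d' /ffunP e; apply/ffunP => i; have := e i; rewrite !ffunE => /addbI.
Qed.

(** The chains with given odd vertices form a coset of the space of cycles,
    and the number of odd vertices is even, so that one vertex can be left
    out. *)
Lemma card_cycles (v0 : V) : 2 ^ #|I| <= 2 ^ (#|V|.-1) * #|cycles|.
Proof.
have -> : 2 ^ #|I| = #|[set: {ffun I -> bool}]|.
  by rewrite cardsT card_ffun card_bool.
pose odds (c : {ffun I -> bool}) :=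
  [set v | (v != v0) && \xor_(i | (a i == v) || (b i == v)) c i].
have -> : #|V|.-1 = #|[set~ v0]| by rewrite cardsC1.
rewrite -card_powerset; apply: (@card_fibers _ _ _ _ odds).
  by move=> c _; rewrite inE; apply/subsetP => v; rewrite !inE => /andP[].
move=> S _; have [c0 /eqP c0S|no] := pickP (fun c => odds c == S); last first.
  by rewrite (_ : [set _ in _ | _] = set0) ?cards0 //; apply/setP => c; rewrite !inE no.
have sub : [set addf c0 x | x in [set x in [set: {ffun I -> bool}] | odds x == S]]
    \subset cycles.
  apply/subsetP => _ /imsetP[c cS ->]; move: cS; rewrite !inE => /eqP cS.
  have off v : v != v0 -> \xor_(i | (a i == v) || (b i == v)) addf c0 c i = false.
    move=> vv0; under eq_bigr do rewrite ffunE.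
    rewrite big_split /=; have /setP/(_ v) : odds c = odds c0 by rewrite cS c0S.
    by rewrite !inE vv0 /= => ->; rewrite addbb.
  apply/forallP => v; have [->|/off -> //] := eqVneq v v0.
  have sum0: \xor_v \xor_(i | (a i == v) || (b i == v)) addf c0 c i = false.
    rewrite (exchange_big_dep xpredT) //=; apply: big1 => i _.
    rewrite (bigD1 (a i)) ?eqxx //= (bigD1 (b i)) ?eqxx ?orbT //=; last first.
      by rewrite eq_sym.
    rewrite big1 ?addbF ?addbb // => v'.
    by rewrite ![v' == _]eq_sym; case: (_ == _) => //=; case: (_ == _).
  move: sum0; rewrite (bigD1 v0) //= [X in _ (+) X]big1 ?addbF; first by move=> ->.
  by move=> v1 /off ->.
by rewrite -(card_imset _ (@addf_inj c0)) subset_leq_card.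
Qed.

(** Two cycles whose lifts have the same class differ by a boundary. *)
Lemma card_cycles_bounding : #|cycles| <= 2 ^ h * #|bounding|.
Proof.
have liftP (c : {ffun I -> bool}) : exists z : E -> bool, c \in cycles ->
  [/\ forall x, bnd z x = false, forall i, z (link i) = c i &
    forall e, z e -> good e -> in_minor e].
  have [|_] := boolP (c \in cycles); last by exists (fun=> false).
  rewrite inE => /forallP cZ.
  have [|z [z1 z2 z3]] := @lift_even c; first by move=> v; apply/negbTE.
  exists z => _; split=> // e ze ge; rewrite /in_minor.
  by have [->|[i ->]] := z3 e ze ge; rewrite // orbC; apply/orP; left; apply/existsP; exists i.
have [Z ZP] := fin_all_exists liftP.
rewrite -cardT -cardsT; apply: (@card_fibers _ _ _ _ (fun c => s (Z c))).
  by move=> c; rewrite inE.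
move=> y _; have [c0 /andP[c0Z /eqP c0y]|no] := pickP (fun c => (c \in cycles) && (s (Z c) == y)); last first.
  by rewrite (_ : [set _ in _ | _] = set0) ?cards0 //; apply/setP => c; rewrite inE no in_set0.
rewrite -(card_imset _ (@addf_inj c0)); apply: subset_leq_card.
apply/subsetP => _ /imsetP[c cZy ->]; move: cZy; rewrite inE => /andP[cZ /eqP cy].
have [b1 l1 h1] := ZP c0 c0Z; have [b2 l2 h2] := ZP c cZ.
have [|w wP] := hom b1 b2; first by rewrite c0y cy.
rewrite inE; apply/existsP; exists [ffun f => w f].
have wE e : cobnd [ffun f => w f] e = cobnd w e by rewrite /cobnd !ffunE.
apply/andP; split; apply/forallP; last first.
  by move=> i; rewrite wE -wP // l1 l2 ffunE.
move=> e; apply/implyP => /andP[ge]; rewrite wE -wP //.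
by case z1: (Z c0 e) => /= z2; [exact: h1|exact: h2].
Qed.

(** This is the inequality part of Euler's formula, with h in place of 2 minus
    the Euler characteristic: the counts above give m - n + 1 <= h + f - 1,
    where 3 f <= 2 m. *)
Lemma minor_edge_bound (v0 : V) : 1 < h -> #|I| + 6 <= 3 * (#|V| + h).
Proof.
move=> h_gt1; have V0 : 0 < #|V| by apply/card_gt0P; exists v0.
have h1 := card_cycles v0; have h2 := card_cycles_bounding; have h3 := card_bounding.
have h4 := faces_count.
have : 2 ^ #|I| <= 2 ^ (#|V|.-1 + h + #|faces|.-1).
  rewrite !expnD; apply: leq_trans h1 _; rewrite -!mulnA leq_mul2l expn_eq0 /=.
  by apply: leq_trans h2 _; rewrite leq_mul2l h3 orbT.
rewrite leq_exp2l //; lia.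
Qed.

End Minor.
End Complex.

(** * Minors from overlapping connected sets *)

Section Thicken.
Variables (P E F : finType) (src tgt : E -> P) (sd1 sd2 : E -> F) (good : pred E).
Variables (V I : finType) (a b : I -> V) (Bs : V -> {set P}) (Cs : I -> {set P}).

Definition edge_adj (p q : P) := [exists e, joins src tgt good e p q].
Definition radj (S : {set P}) (p q : P) := [&& p \in S, q \in S & edge_adj p q].
Definition connected_in (S : {set P}) :=
  forall p q, p \in S -> q \in S -> connect (radj S) p q.

Hypothesis ab : forall i, a i != b i.
Hypothesis simple : forall i j, [set a i; b i] = [set a j; b j] -> i = j.
Hypothesis Bconn : forall v, connected_in (Bs v).
Hypothesis Cconn : forall i, connected_in (Cs i).
Hypothesis Bdisj : forall u v p, p \in Bs u -> p \in Bs v -> u = v.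
Hypothesis Cdisj : forall i j p, p \in Cs i -> p \in Cs j -> i = j.
Hypothesis CB : forall i v p, p \in Cs i -> p \in Bs v -> v = a i \/ v = b i.
Hypothesis CBa : forall i, exists p, p \in Cs i :&: Bs (a i).
Hypothesis CBb : forall i, exists p, p \in Cs i :&: Bs (b i).

(** The sets Cs i of the edges overlap those of their ends. The part of Cs i
    that can be reached from Bs (a i) before Bs (b i) is entered is added to
    the branch set of a i; then a single edge of the complex leads into Bs (b
    i). *)
Definition Ds i : {set P} := [set p in Cs i :\: Bs (b i) |
  [exists q in Cs i :&: Bs (a i), connect (radj (Cs i :\: Bs (b i))) q p]].

Definition branch (p : P) : option V :=
  if [pick v | p \in Bs v] is Some v then Some v
  else if [pick i | p \in Ds i] is Some i then Some (a i) else None.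

Lemma edge_adj_sym : symmetric edge_adj.
Proof. by move=> p q; apply: eq_existsb => e; rewrite /joins orbC. Qed.

Lemma radj_sym S : symmetric (radj S).
Proof. by move=> p q; rewrite /radj edge_adj_sym andbCA. Qed.

Lemma branchB v p : p \in Bs v -> branch p = Some v.
Proof.
move=> pv; rewrite /branch; case: pickP => [u pu|/(_ v)]; last by rewrite pv.
by rewrite (Bdisj pu pv).
Qed.

Lemma branchD i p : p \in Ds i -> branch p = Some (a i).
Proof.
move=> pD; have : p \in Ds i by []; rewrite !inE => /andP[/andP[pb pC] _].
rewrite /branch; case: pickP => [v pv|_].
  by case: (CB pC pv) => vE; rewrite vE // in pv *; rewrite pv in pb.
case: pickP => [j|/(_ i)]; last by rewrite pD.
by rewrite !inE => /andP[/andP[_ pCj] _]; rewrite (Cdisj pC pCj).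
Qed.

Lemma branchP p v : branch p = Some v ->
  p \in Bs v \/ exists2 i, p \in Ds i & a i = v.
Proof.
rewrite /branch; case: pickP => [u pu [<-]|_]; first by left.
by case: pickP => // i pi [<-]; right; exists i.
Qed.

Notation bradj := (branch_adj src tgt good branch).

Lemma bradj_sym : connect_sym bradj.
Proof.
apply: sym_connect_sym => p q; rewrite /branch_adj eq_sym; congr (_ && _).
exact: edge_adj_sym.
Qed.

Lemma connect_bradj (S : {set P}) v p q : (forall x, x \in S -> branch x = Some v) ->
  connect (radj S) p q -> connect bradj p q.
Proof.
move=> Sv; apply: connect_sub => x y /and3P[xS yS xy]; apply: connect1.
by rewrite /branch_adj (Sv _ xS) (Sv _ yS) eqxx.
Qed.

Lemma Ds_conn i p : p \in Ds i -> exists2 q, q \in Bs (a i) & connect bradj q p.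
Proof.
move=> pD; move: (pD); rewrite inE => /andP[pCb /existsP[q /andP[qC qp]]].
have qB : q \in Bs (a i) by case/setIP: qC.
have qCb : q \in Cs i :\: Bs (b i).
  rewrite inE; case/setIP: qC => -> _; rewrite andbT; apply/negP => qb.
  by have := ab i; rewrite (Bdisj qB qb) eqxx.
exists q => //; have /connectP[s sp ->] := qp.
have qD : q \in Ds i by rewrite inE qCb; apply/existsP; exists q; rewrite qC connect0.
elim: s q sp qD {qC qp qB qCb} => [|y s IH] q /=; first by rewrite connect0.
move=> /andP[qy sp] qD; have yD : y \in Ds i.
  case/and3P: (qy) => _ yC _; move: qD; rewrite !inE => /andP[_ /existsP[x /andP[xC xq]]].
  move: yC; rewrite !inE => -> /=; apply/existsP; exists x; rewrite xC /=.
  exact: connect_trans xq (connect1 qy).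
apply: connect_trans (IH y sp yD); apply: connect1.
rewrite /branch_adj (branchD qD) (branchD yD) eqxx /=.
by case/and3P: qy.
Qed.

Lemma branch_conn p q : branch p != None -> branch p = branch q -> connect bradj p q.
Proof.
case bp : (branch p) => [v|] // _ /esym bq.
have toB x : branch x = Some v -> exists2 y, y \in Bs v & connect bradj y x.
  move=> /branchP[xB|[i xi <-]]; first by exists x; rewrite // connect0.
  exact: Ds_conn.
have [x xB xp] := toB p bp; have [y yB yq] := toB q bq.
apply: connect_trans yq; rewrite bradj_sym in xp; apply: connect_trans xp _.
by apply: (connect_bradj (v := v)) (Bconn xB yB) => z /branchB.
Qed.

Lemma link_exists i : exists e, good e /\
  ((branch (src e) = Some (a i) /\ branch (tgt e) = Some (b i)) \/
   (branch (src e) = Some (b i) /\ branch (tgt e) = Some (a i))).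
Proof.
have [x xC] := CBa i; have [y yC] := CBb i.
have /setIP[xi xa] := xC; have /setIP[yi yb] := yC.
have xD : x \in Ds i.
  rewrite inE; apply/andP; split; last by apply/existsP; exists x; rewrite xC connect0.
  rewrite inE xi andbT; apply/negP => xb.
  by have := ab i; rewrite (Bdisj xa xb) eqxx.
have /connectP[s sp sy] := Cconn xi yi.
rewrite {}sy in yb; elim: s x sp yb xD {xC yC xi xa yi} => [|z s IH] x /=.
  by move=> _ xb; rewrite !inE xb.
move=> /andP[/and3P[xi zi xz] sp] yb xD.
have [zb|zb] := boolP (z \in Bs (b i)).
  case/existsP: xz => e /andP[ge eP]; exists e; split=> //.
  by case/orP: eP => /andP[/eqP-> /eqP->]; rewrite (branchD xD) (branchB zb); auto.
apply: IH sp yb _.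
move: xD; rewrite !inE zi zb => /andP[/andP[xb _] /existsP[w /andP[wC wx]]] /=.
apply/existsP; exists w; rewrite wC /=; apply: connect_trans wx (connect1 _).
by rewrite /radj !inE xb xi zb zi.
Qed.

Hypothesis dd : forall w p, bnd src tgt good (cobnd sd1 sd2 w) p = false.
Variables (h : nat) (T : finType) (s : (E -> bool) -> T).
Hypothesis cardT : #|T| = 2 ^ h.
Hypothesis hom : forall z1 z2 : E -> bool,
  (forall p, bnd src tgt good z1 p = false) ->
  (forall p, bnd src tgt good z2 p = false) -> s z1 = s z2 ->
  exists w, forall e, good e -> z1 e (+) z2 e = cobnd sd1 sd2 w e.

Lemma thick_edge_bound (v0 : V) : 1 < h -> #|I| + 6 <= 3 * (#|V| + h).
Proof.
move=> h1; have [link lP] := fin_all_exists link_exists.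
apply: (@minor_edge_bound _ _ _ src tgt sd1 sd2 good V I a b branch link) cardT _ v0 h1.
all: try by move=> i; case: (lP i).
all: eauto using branch_conn.
Qed.

End Thicken.

(** * A square grid with holes that are glued *)

Section Grid.
Variables (hd : bool) (N b : nat).
(* The holes reach up to 37 units to the right of the origin. *)
Hypotheses (N0 : 0 < N) (bN : 41 * N <= b).

(** The grid points are the pairs (i, j) with 0 <= i, j <= 2 b; the origin of
    the plane is (b, b), and N steps make one unit. The holes are the squares
    of half side N with centres (hole_x k, b). They are glued in pairs, to
    give handles, if [hd] holds, and each to itself, to give cross-caps,
    otherwise. *)
Definition hole_x k := b + 4 * k * N.
Definition mate k := if hd then (if odd k then k.-1 else k.+1) else k.
(** The only k such that the k-th hole can contain points with first
    coordinate i. *)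
Definition hole_of i := (i + N - b) %/ (4 * N).

Definition on_circle k i j := [&& k < 10, hole_x k - N <= i <= hole_x k + N, b - N <= j <= b + N &
  [|| i == hole_x k - N, i == hole_x k + N, j == b - N | j == b + N]].
Definition glue_x k i := hole_x k + hole_x (mate k) - i.
Definition glue_y j := if hd then j else 2 * b - j.
(** This chooses one of any two glued points. *)
Definition first_half_pt k i j := if hd then ~~ odd k else (b < j) || ((j == b) && (hole_x k < i)).

Definition hole_square k i j := [&& k < 10, hole_x k - N <= i < hole_x k + N & b - N <= j < b + N].

Definition on_circle_edge k (h : bool) i j := (k < 10) &&
  if h then (hole_x k - N <= i < hole_x k + N) && ((j == b - N) || (j == b + N))
  else ((i == hole_x k - N) || (i == hole_x k + N)) && (b - N <= j < b + N).
Definition hole_edge k (h : bool) i j := (k < 10) &&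
  if h then (hole_x k - N <= i < hole_x k + N) && (b - N < j < b + N)
  else (hole_x k - N < i < hole_x k + N) && (b - N <= j < b + N).
(** An edge is named by its lower left end, and a reflection exchanges the two
    ends of the edges that it reverses; hence the predecessors. *)
Definition glue_ex k (h : bool) i := if h then (glue_x k i).-1 else glue_x k i.
Definition glue_ey (h : bool) j := if h then glue_y j else if hd then j else (2 * b - j).-1.
Definition first_half_edge k (h : bool) (i j : nat) :=
  if hd then ~~ odd k else if h then b < j else b <= j.

Lemma hole_x_bnd k : k < 10 -> b <= hole_x k /\ hole_x k + 5 * N <= 2 * b.
Proof. by rewrite /hole_x; move=> k10; have := leq_mul k10 (leqnn (4 * N)); lia. Qed.

Lemma mesh_bnd : 41 * N <= b /\ 0 < N. Proof. by []. Qed.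

Lemma mate_lt k : k < 10 -> mate k < 10.
Proof.
rewrite /mate; case: hd => //; case: ifP => ok; first lia.
by move: ok; do 10 (case: k => [//|k]).
Qed.

Lemma mateK k : mate (mate k) = k.
Proof.
rewrite /mate; case: hd => //; case: (boolP (odd k)) => ok /=; last by rewrite ok.
by case: k ok => //= k /negPf ->.
Qed.

Lemma odd_mate k : hd -> odd (mate k) = ~~ odd k.
Proof.
rewrite /mate => ->; case: (boolP (odd k)) => ok /=; last by [].
by case: k ok => //= k /negPf ->.
Qed.

Lemma hole_ofE k i : k < 10 -> hole_x k - N <= i <= hole_x k + N -> hole_of i = k.
Proof.
move=> k10 ik; have [_ _] := hole_x_bnd k10; rewrite /hole_of.
have -> : i + N - b = k * (4 * N) + (i + N - hole_x k).
  by rewrite /hole_x in ik *; lia.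
rewrite divnMDl ?divn_small ?addn0 //; last lia.
by have := mesh_bnd; lia.
Qed.

Lemma hole_of_circle k i j : on_circle k i j -> hole_of i = k.
Proof. by case/and4P=> k10 ik _ _; apply: hole_ofE. Qed.

Lemma hole_of_circle_edge k h i j : on_circle_edge k h i j -> hole_of i = k.
Proof.
case/andP=> k10; case: h => /andP[H1 H2]; apply: hole_ofE => //; first lia.
by case/orP: H1 => /eqP->; have := hole_x_bnd k10; have := mesh_bnd; lia.
Qed.

Lemma hole_of_edge k h i j : hole_edge k h i j -> hole_of i = k.
Proof. by case/andP=> k10; case: h => /andP[H1 H2]; apply: hole_ofE => //; lia. Qed.

Lemma hole_of_square k i j : hole_square k i j -> hole_of i = k.
Proof. by case/and3P=> k10 H _; apply: hole_ofE => //; lia. Qed.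

Lemma glue_circle k i j : on_circle k i j ->
  [/\ on_circle (mate k) (glue_x k i) (glue_y j), glue_x (mate k) (glue_x k i) = i, glue_y (glue_y j) = j &
      first_half_pt (mate k) (glue_x k i) (glue_y j) = ~~ first_half_pt k i j].
Proof.
move=> /and4P[k10 ik jk ijk]; have mk := mate_lt k10.
have := hole_x_bnd k10; have := hole_x_bnd mk; have [b1 b2] := mesh_bnd => -[H1 H2] [H3 H4].
rewrite /on_circle mk /glue_x /glue_y mateK /first_half_pt.
have om := @odd_mate k.
have mE : hd = false -> mate k = k by rewrite /mate => ->.
case Ehd: hd in om mE *.
  by split; [lia|lia|lia|rewrite om].
by rewrite mE //; split; lia.
Qed.

Lemma glue_circle_edge k h i j : on_circle_edge k h i j ->
  [/\ on_circle_edge (mate k) h (glue_ex k h i) (glue_ey h j), glue_ex (mate k) h (glue_ex k h i) = i,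
      glue_ey h (glue_ey h j) = j &
      first_half_edge (mate k) h (glue_ex k h i) (glue_ey h j) = ~~ first_half_edge k h i j].
Proof.
move=> /andP[k10 ik]; have mk := mate_lt k10.
have := hole_x_bnd k10; have := hole_x_bnd mk; have [b1 b2] := mesh_bnd => -[H1 H2] [H3 H4].
rewrite /on_circle_edge mk /glue_ex /glue_ey /glue_x /glue_y mateK /first_half_edge.
have om := @odd_mate k.
have mE : hd = false -> mate k = k by rewrite /mate => ->.
case Ehd: hd in om mE *.
  by case: h ik => ik; (split; [lia|lia|lia|rewrite om]).
by rewrite mE //; case: h ik => ik; split; lia.
Qed.

Definition side := 2 * b.
(** Coordinates are cyclic, so that every point has four edges and no case
    distinction is needed at the border; [inbox] excludes the edges that close
    up the torus. *)
Definition pt : finType := ('I_side.+1 * 'I_side.+1)%type.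
(** The boolean tells whether the edge is horizontal; the point is its left or
    lower end. *)
Definition ed : finType := (bool * pt)%type.
Definition succ_pt (h : bool) (p : pt) : pt :=
  if h then (ordS p.1, p.2) else (p.1, ordS p.2).
Definition pred_pt (h : bool) (p : pt) : pt :=
  if h then (ord_pred p.1, p.2) else (p.1, ord_pred p.2).

Lemma succ_ptK h : cancel (succ_pt h) (pred_pt h).
Proof. by case: h => -[i j]; rewrite /succ_pt /pred_pt /= ordSK. Qed.
Lemma pred_ptK h : cancel (pred_pt h) (succ_pt h).
Proof. by case: h => -[i j]; rewrite /succ_pt /pred_pt /= ord_predK. Qed.

Lemma pt_eq (p q : pt) : p.1 = q.1 :> nat -> p.2 = q.2 :> nat -> p = q.
Proof. by case: p q => [i j] [i' j'] /= /val_inj-> /val_inj->. Qed.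

Lemma ed_eq (e f : ed) : e.1 = f.1 -> e.2.1 = f.2.1 :> nat -> e.2.2 = f.2.2 :> nat ->
  e = f.
Proof. by case: e f => [h p] [h' p'] /= -> e1 e2; congr (_, _); apply: pt_eq. Qed.

Definition src (e : ed) : pt := e.2.
Definition tgt (e : ed) : pt := succ_pt e.1 e.2.

Definition circle_pt (p : pt) := on_circle (hole_of p.1) p.1 p.2.
Definition first_half (p : pt) := first_half_pt (hole_of p.1) p.1 p.2.
Definition tau (p : pt) : pt := (inord (glue_x (hole_of p.1) p.1), inord (glue_y p.2)).
(** The point that represents p and the point glued to it. *)
Definition rho p := if circle_pt p && ~~ first_half p then tau p else p.

Definition circ (e : ed) := on_circle_edge (hole_of e.2.1) e.1 e.2.1 e.2.2.
Definition in_hole_edge (e : ed) := hole_edge (hole_of e.2.1) e.1 e.2.1 e.2.2.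
Definition first_half_e (e : ed) := first_half_edge (hole_of e.2.1) e.1 e.2.1 e.2.2.
Definition tauE (e : ed) : ed :=
  (e.1, (inord (glue_ex (hole_of e.2.1) e.1 e.2.1), inord (glue_ey e.1 e.2.2))).
Definition inbox (e : ed) := (if e.1 then e.2.1 : nat else e.2.2 : nat) < side.
Definition valid e := inbox e && ~~ in_hole_edge e.
(** Edges inside the holes are omitted, and one of any two glued edges is
    kept. *)
Definition good e := valid e && (circ e ==> first_half_e e).
Definition ksrc e := rho (src e).
Definition ktgt e := rho (tgt e).

Lemma ord_predE (i : 'I_side.+1) : 0 < i -> ord_pred i = i.-1 :> nat.
Proof.
move=> i0 /=; have -> : (i + side.+1).-1 = i.-1 + side.+1 by lia.
by rewrite modnDr modn_small //; have := ltn_ord i; lia.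
Qed.

Lemma ord_pred0 (i : 'I_side.+1) : i = 0 :> nat -> ord_pred i = side :> nat.
Proof. by move=> /= ->; rewrite add0n modn_small. Qed.

Lemma circle_side k i j : on_circle k i j -> i < side /\ j < side /\ 0 < i /\ 0 < j.
Proof.
by case/and4P=> k10 *; have := hole_x_bnd k10; have := mesh_bnd; rewrite /side; lia.
Qed.

Lemma circle_edge_side k h i j : on_circle_edge k h i j -> i < side /\ j < side /\ 0 < i /\ 0 < j.
Proof.
move=> /andP[k10]; have := hole_x_bnd k10; have := mesh_bnd; rewrite /side.
by case: h; lia.
Qed.

Lemma tau_val p : circle_pt p -> (tau p).1 = glue_x (hole_of p.1) p.1 :> nat /\ (tau p).2 = glue_y p.2 :> nat.
Proof.
by move=> /glue_circle [/circle_side [? [? _]] _ _ _]; rewrite /= !inordK // ltnW.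
Qed.

Lemma tauP p : circle_pt p -> [/\ circle_pt (tau p), tau (tau p) = p, first_half (tau p) = ~~ first_half p &
  hole_of (tau p).1 = mate (hole_of p.1)].
Proof.
move=> pC; have [t1 t2] := tau_val pC; have [c1 e1 e2 e3] := glue_circle pC.
have kE := hole_of_circle c1.
have tC : circle_pt (tau p) by rewrite /circle_pt t1 t2 kE.
split=> //.
- have [t3 t4] := tau_val tC.
  apply: pt_eq.
  by rewrite t3 t1 kE.
  by rewrite t4 t2.
- by rewrite /first_half t1 t2 kE.
- by rewrite t1 kE.
Qed.

Lemma tauE_val e : circ e -> (tauE e).2.1 = glue_ex (hole_of e.2.1) e.1 e.2.1 :> nat /\
  (tauE e).2.2 = glue_ey e.1 e.2.2 :> nat.
Proof.
by move=> /glue_circle_edge [/circle_edge_side [? [? _]] _ _ _]; rewrite /= !inordK // ltnW.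
Qed.

Lemma tauEP e : circ e -> [/\ circ (tauE e), tauE (tauE e) = e, first_half_e (tauE e) = ~~ first_half_e e &
  hole_of (tauE e).2.1 = mate (hole_of e.2.1)].
Proof.
move=> eC; have [t1 t2] := tauE_val eC; have [c1 e1 e2 e3] := glue_circle_edge eC.
have kE := hole_of_circle_edge c1.
have tC : circ (tauE e) by rewrite /circ t1 t2 kE.
split=> //.
- have [t3 t4] := tauE_val tC.
  apply: ed_eq => //.
  by rewrite t3 t1 kE.
  by rewrite t4 t2.
- by rewrite /first_half_e t1 t2 kE.
- by rewrite t1 kE.
Qed.

Lemma circ_valid e : circ e -> valid e.
Proof.
move=> eC; have [w1 [w2 _]] := circle_edge_side eC; apply/andP; split.
  by rewrite /inbox; case: e.1.
move: eC; rewrite /circ /in_hole_edge /hole_edge /on_circle_edge; case: ltnP => //= k10.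
by have := mesh_bnd; case: e.1 => /=; lia.
Qed.

Lemma succ_val h (p : pt) : p.1 < side -> p.2 < side ->
  (succ_pt h p).1 = p.1 + h :> nat /\ (succ_pt h p).2 = p.2 + ~~ h :> nat.
Proof.
by move=> p1 p2; rewrite /succ_pt; case: h => /=; rewrite modn_small ?addn1 ?addn0.
Qed.

Lemma circ_ends e : circ e -> [/\ circle_pt (src e), circle_pt (tgt e),
  hole_of (src e).1 = hole_of e.2.1 & hole_of (tgt e).1 = hole_of e.2.1].
Proof.
move=> eC; have [w1 [w2 [w3 w4]]] := circle_edge_side eC.
have [n1 n2] := succ_val e.1 w1 w2.
have c2 : on_circle (hole_of e.2.1) (tgt e).1 (tgt e).2.
  move: eC; rewrite /tgt n1 n2 /circ /on_circle /on_circle_edge; case: ltnP => //= k10.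
  by case: e.1 => /=; have := hole_x_bnd k10; have := mesh_bnd; lia.
have hk2 := hole_of_circle c2; rewrite /circle_pt hk2; split=> //.
move: eC; rewrite /circ /on_circle /on_circle_edge /src; case: ltnP => //= k10.
by case: e.1 => /=; have := hole_x_bnd k10; have := mesh_bnd; lia.
Qed.

Lemma tauE_ends e : circ e ->
  (src (tauE e) = tau (src e) /\ tgt (tauE e) = tau (tgt e)) \/
  (src (tauE e) = tau (tgt e) /\ tgt (tauE e) = tau (src e)).
Proof.
move=> eC; have [c1 c2 h1 h2] := circ_ends eC.
have [t1 t2] := tau_val c1; have [t3 t4] := tau_val c2.
have [tC _ _ _] := tauEP eC.
have [w1 [w2 [w3 w4]]] := circle_edge_side eC.
have [u1 [u2 [u3 u4]]] := circle_edge_side tC.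
have [n1 n2] := succ_val e.1 w1 w2; have [n3 n4] := succ_val e.1 u1 u2.
have [v1 v2] := tauE_val eC.
have k10 : hole_of e.2.1 < 10 by case/andP: eC.
have H1 := hole_x_bnd k10; have H2 := hole_x_bnd (mate_lt k10); have H3 := mesh_bnd.
have [b1 b2] : hole_x (hole_of e.2.1) - N <= e.2.1 <= hole_x (hole_of e.2.1) + N /\ b - N <= e.2.2 <= b + N.
  by move: eC; rewrite /circ /on_circle_edge; case: e.1 => /=; lia.
rewrite /src in h1 t1 t2 *; rewrite h2 in t3.
rewrite n1 in t3; rewrite n2 in t4.
have te1 : (tauE e).1 = e.1 by [].
clear eC c1 c2 tC h1 h2 k10 n1 n2 w1 w2 w3 w4 u1 u2 u3 u4.
case eh : e.1 in n3 n4 v1 v2 t3 t4 te1 *.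
  right; split; apply: pt_eq; rewrite /src /tgt ?te1.
  - by rewrite v1 t3 /glue_ex /glue_x; lia.
  - by rewrite v2 t4 /glue_ey /glue_y; case: hd; lia.
  - by rewrite n3 v1 t1 /glue_ex /glue_x; lia.
  - by rewrite n4 v2 t2 /glue_ey /glue_y; case: hd; lia.
case Ehd : hd.
  left; split; apply: pt_eq; rewrite /src /tgt ?te1.
  - by rewrite v1 t1.
  - by rewrite v2 t2 /glue_ey /glue_y Ehd.
  - by rewrite n3 v1 t3 /glue_ex /glue_x; lia.
  - by rewrite n4 v2 t4 /glue_ey /glue_y Ehd; lia.
right; split; apply: pt_eq; rewrite /src /tgt ?te1.
- by rewrite v1 t3 /glue_ex /glue_x; lia.
- by rewrite v2 t4 /glue_ey /glue_y Ehd; lia.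
- by rewrite n3 v1 t1 /glue_ex /glue_x; lia.
- by rewrite n4 v2 t2 /glue_ey /glue_y Ehd; lia.
Qed.

Lemma rho_tau p : circle_pt p -> rho (tau p) = rho p.
Proof.
move=> pC; have [tC tK th _] := tauP pC.
by rewrite /rho tC pC th /=; case: (first_half p) => //=; rewrite tK.
Qed.

Lemma rhoE p q : rho p = rho q <-> p = q \/ (circle_pt p /\ q = tau p).
Proof.
split; last by move=> [->|[pC ->]] //; rewrite rho_tau.
have rhoX x : rho x = x \/ circle_pt x /\ rho x = tau x.
  by rewrite /rho; case: (boolP (circle_pt x)) => xC; case: (first_half x) => /=; auto.
case: (rhoX p) => [->|[pC ->]]; case: (rhoX q) => [->|[qC ->]]; auto.
- by have [tC tK _ _] := tauP qC => ->; rewrite tK; auto.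
- have [_ tpK _ _] := tauP pC; have [_ tqK _ _] := tauP qC => e.
  by left; rewrite -tpK e tqK.
Qed.

(** The image of a chain of the plane in the glued grid. *)
Definition fold (y : ed -> bool) (e : ed) := y e (+) (circ e && y (tauE e)).

Lemma bnd_fold y p :
  bnd ksrc ktgt good (fold y) p = \xor_(q | rho q == p) bnd src tgt valid y q.
Proof.
pose d e := (ksrc e == p) (+) (ktgt e == p).
have dtau e : circ e -> d (tauE e) = d e.
  move=> eC; have [c1 c2 _ _] := circ_ends eC; rewrite /d /ksrc /ktgt.
  by case: (tauE_ends eC) => -[-> ->]; rewrite !rho_tau // addbC.
transitivity (\xor_(e | valid e) (y e && d e)); last first.
  rewrite /bnd exchange_big /=; apply: eq_bigr => e _.
  rewrite -big_distrr /= big_split /= /d /ksrc /ktgt.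
  have E x : \xor_(i | rho i == p) (x == i) = (rho x == p).
    case: (eqVneq (rho x) p) => xp.
      by rewrite (bigD1 x) ?xp //= eqxx big1 // => i /andP[_]; rewrite eq_sym => /negPf.
    by rewrite big1 // => i ip; case: eqP => // xi; rewrite xi ip in xp.
  by rewrite !E.
rewrite /bnd /fold (eq_bigr (fun e => (y e && d e) (+) (circ e && (y (tauE e) && d (tauE e))))); last first.
  by move=> e _; rewrite andb_addl -/(d e) -andbA; case: (boolP (circ e)) => //= /dtau ->.
rewrite big_split /= [RHS](bigID good) /=; congr (_ (+) _).
  by apply: eq_bigl => e; rewrite /good; case: (valid e).
rewrite -big_mkcondr /= [RHS](reindex_onto tauE tauE) /=; last first.
  move=> e /andP[ve]; rewrite /good ve negb_imply => /andP[eC _].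
  by have [] := tauEP eC.
apply: eq_bigl => e; case: (boolP (circ e)) => eC /=; last first.
  rewrite andbF; apply/esym/negP => /andP[/andP[ve ne] /eqP te].
  have tC : circ (tauE e) by move: ne; rewrite /good ve negb_imply => /andP[].
  by have [] := tauEP tC; rewrite te (negPf eC).
have [tC tK th _] := tauEP eC.
by rewrite tK eqxx /good !circ_valid //= eC tC th negbK !andbT.
Qed.

Lemma bnd4 z q : bnd src tgt xpredT z q =
  (z (true, q) (+) z (true, pred_pt true q)) (+) (z (false, q) (+) z (false, pred_pt false q)).
Proof.
transitivity (\xor_h \xor_p (z (h, p) && ((src (h, p) == q) (+) (tgt (h, p) == q)))).
  by rewrite pair_bigA; apply: eq_bigr => -[].
have E h : \xor_p (z (h, p) && ((src (h, p) == q) (+) (tgt (h, p) == q))) =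
    z (h, q) (+) z (h, pred_pt h q).
  under eq_bigr do rewrite andb_addr; rewrite big_split /=; congr (_ (+) _).
    by rewrite (bigD1 q) //= eqxx andbT big1 ?addbF // => p /negPf pq; rewrite /src pq andbF.
  rewrite (bigD1 (pred_pt h q)) //= /tgt /= pred_ptK eqxx andbT big1 ?addbF // => p pq.
  by case: eqP => [e|]; rewrite ?andbF //; rewrite -e succ_ptK eqxx in pq.
by rewrite big_bool !E.
Qed.

Definition sqA (e : ed) : pt := e.2.
Definition sqB (e : ed) : pt := pred_pt (~~ e.1) e.2.
(** Squares are named by their lower left corner. *)
Definition cob (u : pt -> bool) (e : ed) := u (sqA e) (+) u (sqB e).

Lemma bnd_cob u q : bnd src tgt xpredT (cob u) q = false.
Proof.
rewrite bnd4 /cob /sqA /sqB /=.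
by do ![case: (u _) => //=].
Qed.

Definition in_hole (p : pt) := hole_square (hole_of p.1) p.1 p.2.
(** The squares together with the outer region, which contains the point at
    infinity. *)
Definition cell : finType := option pt.
Definition cell_of (p : pt) : cell := if (p.1 < side) && (p.2 < side) then Some p else None.
Definition lift_cells (w : cell -> bool) (p : pt) := if in_hole p then false else w (cell_of p).
Definition outer_cell (e : ed) := if in_hole (sqA e) then cell_of (sqB e) else cell_of (sqA e).
Definition side1 (e : ed) := outer_cell e.
Definition side2 (e : ed) := if circ e then outer_cell (tauE e) else cell_of (sqB e).

Lemma hole_of_in_hole k (p : pt) : hole_square k p.1 p.2 -> hole_of p.1 = k /\ in_hole p.
Proof. by move=> H; rewrite /in_hole (hole_of_square H). Qed.

Lemma sqB_val (e : ed) : 0 < e.2.1 -> 0 < e.2.2 ->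
  (sqB e).1 = e.2.1 - ~~ e.1 :> nat /\ (sqB e).2 = e.2.2 - e.1 :> nat.
Proof.
move=> p1 p2; rewrite /sqB /pred_pt; case: e.1 => /=; rewrite ?subn0 ?subn1.
  by rewrite -(ord_predE p2).
by rewrite -(ord_predE p1).
Qed.

Lemma in_holeP (p : pt) : reflect (exists k, hole_square k p.1 p.2) (in_hole p).
Proof.
apply: (iffP idP) => [H|[k /hole_of_in_hole[]]] //; by exists (hole_of p.1).
Qed.

Lemma circ_sq_arith (h : bool) x i j : 0 < i -> 0 < j -> b <= x ->
  (if h then (x - N <= i < x + N) && ((j == b - N) || (j == b + N))
   else ((i == x - N) || (i == x + N)) && (b - N <= j < b + N)) ->
  [&& x - N <= i < x + N, b - N <= j & j < b + N] =
  ~~ [&& x - N <= i - ~~ h < x + N, b - N <= j - h & j - h < b + N].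
Proof. by have := mesh_bnd; case: h => /=; lia. Qed.

Lemma circ_sq e : circ e ->
  (hole_square (hole_of e.2.1) (sqA e).1 (sqA e).2 /\ ~~ in_hole (sqB e)) \/
  (~~ in_hole (sqA e) /\ hole_square (hole_of e.2.1) (sqB e).1 (sqB e).2).
Proof.
move=> eC; have [w1 [w2 [w3 w4]]] := circle_edge_side eC.
have k10 : hole_of e.2.1 < 10 by case/andP: eC.
have [v1 v2] := sqB_val w3 w4.
have H1 := hole_x_bnd k10; have H2 := mesh_bnd.
have nH (p : pt) : hole_x (hole_of e.2.1) - N - 1 <= p.1 <= hole_x (hole_of e.2.1) + N ->
    hole_square (hole_of e.2.1) p.1 p.2 = false -> ~~ in_hole p.
  move=> pk; apply: contraFN => /in_holeP[k pH].
  suff -> : hole_of e.2.1 = k by [].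
  case/and3P: pH => kk pX _; move: pk pX; have := hole_x_bnd kk; rewrite /hole_x.
  move: (hole_of e.2.1) => l; case: (ltngtP l k) => // lk.
    by have := leq_mul lk (leqnn (4 * N)); lia.
  by have := leq_mul lk (leqnn (4 * N)); lia.
have [iA iB] : hole_x (hole_of e.2.1) - N - 1 <= (sqA e).1 <= hole_x (hole_of e.2.1) + N /\
    hole_x (hole_of e.2.1) - N - 1 <= (sqB e).1 <= hole_x (hole_of e.2.1) + N.
  rewrite v1 /sqA; move: eC; rewrite /circ /on_circle_edge; case: e.1 => /=; lia.
have: hole_square (hole_of e.2.1) (sqA e).1 (sqA e).2 = ~~ hole_square (hole_of e.2.1) (sqB e).1 (sqB e).2.
  rewrite v1 v2 /hole_square /sqA k10 /=; apply: circ_sq_arith => //; first by case: H1.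
  by case/andP: eC.
case: (boolP (hole_square _ (sqB e).1 _)) => B A; [right|left]; split=> //.
- exact: nH.
- by apply: nH => //; apply/negbTE.
Qed.

Lemma valid_sq_arith (h : bool) x i j d : d <= 1 -> b <= x ->
  0 < i + (1 - d) -> 0 < j + (1 - d) ->
  x - N <= i - d * ~~ h < x + N -> b - N <= j - d * h < b + N ->
  ~~ (if h then (x - N <= i < x + N) && ((j == b - N) || (j == b + N))
   else ((i == x - N) || (i == x + N)) && (b - N <= j < b + N)) ->
  ~~ (if h then (x - N <= i < x + N) && (b - N < j < b + N)
      else (x - N < i < x + N) && (b - N <= j < b + N)) -> False.
Proof.
have := mesh_bnd; case: h => /=; rewrite ?muln0 ?muln1 ?subn0; lia.
Qed.

Lemma valid_sq e : valid e -> ~~ circ e -> ~~ in_hole (sqA e) /\ ~~ in_hole (sqB e).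
Proof.
move=> /andP[vb vi] nC.
have X0 k : k < 10 -> N < hole_x k by move=> /hole_x_bnd; have := mesh_bnd; lia.
have key k i j : hole_square k i j -> [/\ k < 10, hole_x k - N <= i < hole_x k + N & b - N <= j < b + N].
  by case/and3P.
have hkK k i : k < 10 -> hole_x k - N <= i <= hole_x k + N -> hole_of i = k by apply: hole_ofE.
have fin k : k < 10 -> hole_of e.2.1 = k -> forall d : nat, d <= 1 ->
    hole_x k - N <= e.2.1 - d * ~~ e.1 < hole_x k + N -> b - N <= e.2.2 - d * e.1 < b + N ->
    0 < e.2.1 + (1 - d) -> 0 < e.2.2 + (1 - d) -> False.
  move=> k10 ek d d1 ik jk i0 j0; move: nC vi.
  rewrite /circ /in_hole_edge ek /on_circle_edge /hole_edge k10 /=.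
  have [bX _] := hole_x_bnd k10.
  exact: (valid_sq_arith d1 bX i0 j0 ik jk).
split; apply/negP => /in_holeP[k /key[k10 ik jk]].
  have ek : hole_of e.2.1 = k by apply: hkK => //; move: ik; rewrite /sqA; lia.
  by apply: (fin k k10 ek 0); rewrite ?mul0n ?subn0 ?addn1.
have H1 := X0 _ k10; have H2 := mesh_bnd; have H3 := hole_x_bnd k10.
move: ik jk; rewrite /sqB /pred_pt; case eh: e.1 => /= ik jk.
  have j0 : 0 < e.2.2.
    by rewrite lt0n; apply/eqP => z; move: jk; have := ord_pred0 z => /= ->; rewrite /side; lia.
  have := ord_predE j0 => /= jE; rewrite jE in jk.
  have ek : hole_of e.2.1 = k by apply: hkK => //=; lia.
  by apply: (fin k k10 ek 1) => //; rewrite ?eh ?muln0 ?muln1 ?subn0 ?subn1 //=; lia.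
have j0 : 0 < e.2.1.
  by rewrite lt0n; apply/eqP => z; move: ik; have := ord_pred0 z => /= ->; rewrite /side; lia.
have := ord_predE j0 => /= jE; rewrite jE in ik.
have ek : hole_of e.2.1 = k by apply: hkK => //=; lia.
by apply: (fin k k10 ek 1) => //; rewrite ?eh ?muln0 ?muln1 ?subn0 ?subn1 //=; lia.
Qed.

Lemma cob_valid w e : ~~ valid e -> cob (lift_cells w) e = false.
Proof.
have H2 := mesh_bnd.
rewrite negb_and negbK /cob => /orP[nb|].
  have out (p : pt) : (side <= p.1) || (side <= p.2) -> lift_cells w p = w None.
    move=> pW; rewrite /lift_cells /cell_of; case: ifP => [/and3P[k10 h1 h2]|_].
      by have := hole_x_bnd k10; move: h1 h2 pW; rewrite /side; lia.
    by case: ifP => //; lia.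
  rewrite !out ?addbb //; move: nb; rewrite /inbox /sqA /sqB /pred_pt -leqNgt.
    by case: e.1 => /= ->; rewrite ?orbT.
  by case: e.1 => ->; rewrite ?orbT.
rewrite /in_hole_edge => eI; have := eI; rewrite /hole_edge => /andP[k10 ek].
have H1 := hole_x_bnd k10.
have [p1 p2] : 0 < e.2.1 /\ 0 < e.2.2 by move: ek; case: e.1; lia.
have [v1 v2] := sqB_val p1 p2.
have A : in_hole (sqA e).
  by apply/in_holeP; exists (hole_of e.2.1); rewrite /hole_square k10 /sqA; move: ek; case: e.1; lia.
have B : in_hole (sqB e).
  apply/in_holeP; exists (hole_of e.2.1); rewrite /hole_square k10 v1 v2.
  by move: ek; case: e.1 => /=; lia.
by rewrite /lift_cells A B.
Qed.

Lemma cobE w e : good e -> cobnd side1 side2 w e = fold (cob (lift_cells w)) e.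
Proof.
have outE f : circ f -> w (outer_cell f) = cob (lift_cells w) f.
  move=> fC; rewrite /outer_cell /cob /lift_cells; case: (circ_sq fC) => -[].
    by move=> /hole_of_in_hole[_ ->] /negPf->.
  by move=> /negPf-> /hole_of_in_hole[_ ->]; rewrite addbF.
move=> /andP[ve _]; rewrite /cobnd /side1 /side2 /fold.
case: (boolP (circ e)) => eC /=.
  by rewrite !outE //; have [] := tauEP eC.
have [/negPf A /negPf B] := valid_sq ve eC.
by rewrite addbF /outer_cell /cob /lift_cells A B.
Qed.

Lemma bnd_valid z q : (forall e, ~~ valid e -> z e = false) ->
  bnd src tgt valid z q = bnd src tgt xpredT z q.
Proof.
move=> zv; rewrite /bnd [RHS](bigID valid) /= [X in _ = _ (+) X]big1 ?addbF //.
by move=> e /zv->.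
Qed.

(** In the plane the identity is [bnd_cob], and the boundary of a folded chain
    is the folded boundary ([bnd_fold]). *)
Lemma grid_dd w p : bnd ksrc ktgt good (cobnd side1 side2 w) p = false.
Proof.
transitivity (bnd ksrc ktgt good (fold (cob (lift_cells w))) p).
  by apply: eq_bigr => e /cobE->.
rewrite bnd_fold big1 // => q _; rewrite bnd_valid ?bnd_cob //.
exact: cob_valid.
Qed.

(** The value of u on a square counts the edges of Y below it, that is, the
    crossings of Y with a vertical ray. Across vertical edges the rule follows
    from the cycle condition, upwards along a column. *)
Lemma planar_cycle (Y : ed -> bool) : (forall e, ~~ valid e -> Y e = false) ->
  (forall q, bnd src tgt xpredT Y q = false) ->
  exists u : pt -> bool, (forall e, Y e = cob u e) /\
    forall p : pt, (side <= p.1) || (side <= p.2) -> u p = false.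
Proof.
move=> Yv Yc.
have YhW (p : pt) : side <= p.1 -> Y (true, p) = false.
  by move=> pW; apply: Yv; rewrite negb_and /inbox /= -leqNgt pW.
have YvW (i j : 'I_side.+1) : side <= j -> Y (false, (i, j)) = false.
  by move=> pW; apply: Yv; rewrite negb_and /inbox /= -leqNgt pW.
pose u (p : pt) := \big[addb/false]_(k < side.+1 | k <= p.2) Y (true, (p.1, k)).
have u0 i (j : 'I_side.+1) : j = 0 :> nat -> u (i, j) = Y (true, (i, j)).
  move=> j0; rewrite /u (bigD1 j) //= big1 ?addbF // => k /andP[].
  by rewrite j0 leqn0 => /eqP k0 /eqP[]; apply: val_inj; rewrite /= k0.
have uS i (j : 'I_side.+1) : 0 < j -> u (i, j) = u (i, ord_pred j) (+) Y (true, (i, j)).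
  move=> j0; rewrite /u (bigD1 j) //= addbC; congr (_ (+) _).
  apply: eq_bigl => k; have := ord_predE j0; move=> /= ->.
  by rewrite -val_eqE /=; move: (ltn_ord k); lia.
have cyc i j : Y (true, (i, j)) (+) Y (true, (ord_pred i, j)) =
    Y (false, (i, j)) (+) Y (false, (i, ord_pred j)).
  have := Yc (i, j); rewrite bnd4 /pred_pt /=.
  by case: (Y _); case: (Y _); case: (Y _); case: (Y _).
have vert i n (j : 'I_side.+1) : j = n :> nat ->
    u (i, j) (+) u (ord_pred i, j) = Y (false, (i, j)).
  elim: n j => [|n IH] j jn.
    by rewrite !u0 // cyc (YvW i (ord_pred j)) ?addbF // (ord_pred0 jn).
  have jp : ord_pred j = n :> nat by rewrite ord_predE jn.
  have j0 : 0 < j by rewrite jn.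
  by rewrite (uS i j j0) (uS _ j j0) addbACA (IH _ jp) cyc addbC -addbA addbb addbF.
have uW1 (i j : 'I_side.+1) : side <= i -> u (i, j) = false.
  by move=> iW; rewrite /u big1 // => k _; exact: YhW.
have uW2 n (i j : 'I_side.+1) : i = n :> nat -> side <= j -> u (i, j) = false.
  elim: n i => [|n IH] i iN jW; have := @vert i _ j erefl; rewrite YvW //.
    by rewrite (uW1 (ord_pred i)) ?addbF // (ord_pred0 iN).
  by rewrite IH ?addbF // ord_predE iN.
have uout (p : pt) : (side <= p.1) || (side <= p.2) -> u p = false.
  by case: p => i j /= /orP[/uW1 ->|] //; apply: uW2.
exists u; split=> // -[[] [i j]]; rewrite /cob /sqA /sqB /pred_pt /=.
  case: (posnP j) => j0; last by rewrite uS // addbC addbA addbb.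
  by rewrite u0 // (@uW2 _ i (ord_pred j) erefl) ?addbF // (ord_pred0 j0).
by rewrite (vert _ _ _ erefl).
Qed.

Definition circle_index (p : pt) : option 'I_10 := if circle_pt p then Some (inord (hole_of p.1)) else None.
Definition gpt (i j : nat) : pt := (inord i, inord j).

Lemma gpt_val i j : i <= side -> j <= side -> (gpt i j).1 = i :> nat /\ (gpt i j).2 = j :> nat.
Proof. by move=> iW jW; rewrite /= !inordK. Qed.

Lemma circle_pt_lt (p : pt) : circle_pt p -> hole_of p.1 < 10.
Proof. by case/and4P. Qed.

Local Notation circle_adj := (branch_adj src tgt circ circle_index).

Lemma circle_adj_sym : symmetric circle_adj.
Proof.
move=> p q; rewrite /branch_adj eq_sym; congr (_ && _); apply: eq_existsb => e.
by rewrite /joins orbC.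
Qed.

Lemma circ_adj e : circ e -> circle_adj (src e) (tgt e).
Proof.
move=> eC; have [c1 c2 h1 h2] := circ_ends eC; apply/andP; split.
  by rewrite /circle_index c1 c2 h1 h2.
by apply/existsP; exists e; rewrite /joins eC !eqxx.
Qed.

Lemma circ_step h k i j : on_circle_edge k h i j -> circle_adj (gpt i j) (gpt (i + h) (j + ~~ h)).
Proof.
move=> kij; have [w1 [w2 _]] := circle_edge_side kij.
have [v1 v2] := gpt_val (ltnW w1) (ltnW w2).
have eC : circ (h, gpt i j).
  by rewrite /circ [(_, _).2]/(gpt i j) v1 v2 (hole_of_circle_edge kij).
have := circ_adj eC; suff -> : tgt (h, gpt i j) = gpt (i + h) (j + ~~ h) by [].
have [| |n1 n2] := @succ_val h (gpt i j) _ _; rewrite ?v1 ?v2 //.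
have [u1 u2] : (gpt (i + h) (j + ~~ h)).1 = i + h :> nat /\
    (gpt (i + h) (j + ~~ h)).2 = j + ~~ h :> nat.
  by apply: gpt_val; case: (h); lia.
by apply: pt_eq; rewrite /tgt ?u1 ?u2 ?n1 ?n2 ?v1 ?v2.
Qed.

Lemma circle_vrun k i j n : k < 10 -> (i == hole_x k - N) || (i == hole_x k + N) -> b - N <= j ->
  j + n <= b + N -> connect circle_adj (gpt i (j + n)) (gpt i j).
Proof.
move=> k10 ik jb; elim: n => [|n IH] jn; first by rewrite addn0.
apply: connect_trans (IH _); last lia.
have := @circ_step false k i (j + n); rewrite addn0 addn1 addnS => st.
apply: connect1; rewrite circle_adj_sym; apply: st.
by rewrite /on_circle_edge k10 ik; lia.
Qed.

Lemma circle_hrun k i j n : k < 10 -> (j == b - N) || (j == b + N) -> hole_x k - N <= i ->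
  i + n <= hole_x k + N -> connect circle_adj (gpt (i + n) j) (gpt i j).
Proof.
move=> k10 jk ib; elim: n => [|n IH] jn; first by rewrite addn0.
apply: connect_trans (IH _); last lia.
have := @circ_step true k (i + n) j; rewrite addn0 addn1 addnS => st.
apply: connect1; rewrite circle_adj_sym; apply: st.
by rewrite /on_circle_edge k10 jk; lia.
Qed.

Lemma gptE (p : pt) : p = gpt p.1 p.2.
Proof. by rewrite /gpt !inord_val; case: p. Qed.

Lemma corner_conn (p : pt) : circle_pt p ->
  connect circle_adj p (gpt (hole_x (hole_of p.1) - N) (b - N)).
Proof.
rewrite [X in connect _ X]gptE /circle_pt; move: (nat_of_ord p.1) (nat_of_ord p.2) => i j.
move: (hole_of i) => k /and4P[k10 ik jk ijk]; have := hole_x_bnd k10; have B := mesh_bnd => Xb.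
have left_ j' : (j' == b - N) || (j' == b + N) ->
    connect circle_adj (gpt i j') (gpt (hole_x k - N) j').
  move=> jj; have -> : i = (hole_x k - N) + (i - (hole_x k - N)) by lia.
  by apply: (@circle_hrun k) => //; lia.
have down i' : (i' == hole_x k - N) || (i' == hole_x k + N) ->
    connect circle_adj (gpt i' j) (gpt i' (b - N)).
  move=> ii; have -> : j = (b - N) + (j - (b - N)) by lia.
  by apply: (@circle_vrun k) => //; lia.
have down2 i' : (i' == hole_x k - N) || (i' == hole_x k + N) ->
    connect circle_adj (gpt i' (b + N)) (gpt i' (b - N)).
  move=> ii; have -> : b + N = (b - N) + (N + N) by lia.
  by apply: (@circle_vrun k) => //; lia.
case/or4P: ijk => /eqP e.
- by rewrite -[in X in connect _ _ X]e; apply: down; rewrite e eqxx.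
- apply: (connect_trans (down i _)); first by rewrite e eqxx orbT.
  by apply: left_; rewrite eqxx.
- by rewrite e; apply: left_; rewrite eqxx.
- rewrite e; apply: (connect_trans (left_ _ _)); first by rewrite eqxx orbT.
  by apply: down2; rewrite eqxx.
Qed.

Lemma circ_conn p q : circle_index p != None -> circle_index p = circle_index q -> connect circle_adj p q.
Proof.
rewrite /circle_index; case: ifP => // pC _; case: ifP => // qC [] pq.
have kE : hole_of p.1 = hole_of q.1.
  by move/(congr1 val): pq; rewrite /= !inordK // circle_pt_lt.
have /sym_connect_sym cs := circle_adj_sym.
apply: connect_trans (corner_conn pC) _; rewrite cs kE; exact: corner_conn.
Qed.

Lemma fold_good z e : good e -> fold (fun e => good e && z e) e = z e.
Proof.
move=> ge; rewrite /fold ge /=; case: (boolP (circ e)) => eC /=; last by rewrite addbF.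
have [tC _ th _] := tauEP eC.
by move: ge; rewrite /good tC eC /= th => /andP[_ ->]; rewrite andbF addbF.
Qed.

Lemma tau_inj p q : circle_pt p -> circle_pt q -> (tau p == tau q) = (p == q).
Proof.
move=> /tauP [_ pK _ _] /tauP [_ qK _ _].
by apply/eqP/eqP => [e|->//]; rewrite -pK e.
Qed.

Lemma bnd_tau x q : circle_pt q ->
  bnd src tgt circ (fun e => x (tauE e)) (tau q) = bnd src tgt circ x q.
Proof.
move=> qC; rewrite /bnd [LHS](reindex_onto tauE tauE); last first.
  by move=> e /tauEP[].
apply: eq_big => e.
  apply/andP/idP => [[tC /eqP te]|eC]; first by have [] := tauEP tC; rewrite te.
  by have [tC tK _ _] := tauEP eC; rewrite tK.
move=> /andP[tC /eqP te]; have eC : circ e by have [] := tauEP tC; rewrite te.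
have [c1 c2 _ _] := circ_ends eC.
by rewrite te; case: (tauE_ends eC) => -[-> ->]; rewrite !tau_inj // addbC.
Qed.

Lemma bnd_circ0 x q : ~~ circle_pt q -> bnd src tgt circ x q = false.
Proof.
move=> qC; rewrite /bnd big1 // => e eC; have [c1 c2 _ _] := circ_ends eC.
have n1 : src e != q by apply: contraNneq qC => <-.
have n2 : tgt e != q by apply: contraNneq qC => <-.
by rewrite (negPf n1) (negPf n2) andbF.
Qed.

Lemma bnd_valid_circ (x : ed -> bool) q : (forall e, x e -> circ e) ->
  bnd src tgt valid x q = bnd src tgt circ x q.
Proof.
move=> xC; rewrite /bnd (bigID circ) /= [X in _ (+) X]big1 ?addbF.
  apply: eq_bigl => e; case: (boolP (circ e)) => eC; rewrite ?andbF //.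
  by rewrite circ_valid.
by move=> e /andP[_ eC]; case xe: (x e) => //; rewrite (xC _ xe) in eC.
Qed.

(** A cycle of the glued grid, read in the plane, has ends only on the
    circles; this is the set of its ends. *)
Definition trace (z : ed -> bool) := bnd src tgt valid (fun e => good e && z e).
(** Only one of any two glued ends is counted. The parity tells whether the
    cycle passes through the cross-cap, or the handle, an odd number of
    times. *)
Definition twist (z : ed -> bool) (k : 'I_10) :=
  \xor_(q | (circle_index q == Some k) && first_half q) trace z q.

Lemma traceD z1 z2 q :
  trace (fun e => z1 e (+) z2 e) q = trace z1 q (+) trace z2 q.
Proof.
rewrite /trace -bndD; apply: eq_bigr => e _.
by congr (_ && _); rewrite andb_addr.
Qed.

Lemma twistD z1 z2 k :
  twist (fun e => z1 e (+) z2 e) k = twist z1 k (+) twist z2 k.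
Proof. by rewrite /twist -big_split; apply: eq_bigr => q _; rewrite traceD. Qed.

Definition closed_chain z := forall p, bnd ksrc ktgt good z p = false.

Lemma closed_chainD z1 z2 : closed_chain z1 -> closed_chain z2 -> closed_chain (fun e => z1 e (+) z2 e).
Proof. by move=> c1 c2 p; rewrite bndD c1 c2. Qed.

Lemma trace_closed z : closed_chain z ->
  (forall q, ~~ circle_pt q -> trace z q = false) /\
  (forall q, circle_pt q -> trace z (tau q) = trace z q).
Proof.
move=> zc.
have st p : \xor_(q | rho q == p) trace z q = false.
  rewrite /trace -bnd_fold -[RHS](zc p); apply: eq_bigr => e ge.
  by rewrite fold_good.
split=> q qC; have := st (rho q); rewrite (bigD1 q) //=.
  rewrite big1 ?addbF // => p /andP[/eqP/esym/rhoE[->|[]]]; first by rewrite eqxx.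
  by rewrite (negPf qC).
have [tC tK th _] := tauP qC.
have tq : tau q != q by apply/eqP => e; move: th; rewrite e; case: (first_half q).
rewrite (bigD1 (tau q)) /= ?rho_tau ?eqxx ?tq // big1 ?addbF.
  by case: (trace z q); case: (trace z (tau q)).
move=> p /andP[/andP[/eqP/esym/rhoE[->|[_ ->]]]]; by rewrite eqxx.
Qed.

Lemma hole_const (u : pt -> bool) : (forall e, in_hole_edge e -> u (sqA e) = u (sqB e)) ->
  forall p, in_hole p -> u p = u (gpt (hole_x (hole_of p.1) - N) (b - N)).
Proof.
move=> uI p; rewrite [X in u X]gptE /in_hole.
move: (nat_of_ord p.1) (nat_of_ord p.2) => i j; move: (hole_of i) => k.
case/and3P=> k10 ik jk; have := hole_x_bnd k10; have B := mesh_bnd => Xb.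
have stepI h i' j' : hole_edge k h i' j' -> u (gpt i' j') = u (gpt (i' - ~~ h) (j' - h)).
  move=> kI; have [W1 W2] : i' <= side /\ j' <= side.
    by case/andP: kI => _; rewrite /side; case: (h); lia.
  have [v1 v2] := gpt_val W1 W2.
  have := uI (h, gpt i' j'); rewrite /in_hole_edge [(_, _).2]/(gpt _ _) v1 v2 (hole_of_edge kI) => -> //.
  have [p1 p2] : 0 < i' /\ 0 < j' by case/andP: kI => _; case: (h); lia.
  have [| |s1 s2] := @sqB_val (h, gpt i' j') _ _; rewrite ?[(_, _).2]/(gpt _ _) ?v1 ?v2 //.
  rewrite v1 in s1; rewrite v2 in s2.
  have [u1 u2] : (gpt (i' - ~~ h) (j' - h)).1 = i' - ~~ h :> nat /\
      (gpt (i' - ~~ h) (j' - h)).2 = j' - h :> nat.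
    by apply: gpt_val; lia.
  by congr (u _); apply: pt_eq; rewrite ?s1 ?s2 ?u1 ?u2.
have hor n j' : hole_x k - N + n < hole_x k + N -> b - N <= j' < b + N ->
    u (gpt (hole_x k - N + n) j') = u (gpt (hole_x k - N) j').
  elim: n => [|n IH] nX jj; first by rewrite addn0.
  rewrite addnS (stepI false); last by rewrite /hole_edge k10 /=; lia.
  by rewrite /= subn0 subn1 /= IH //; lia.
have ver n : b - N + n < b + N ->
    u (gpt (hole_x k - N) (b - N + n)) = u (gpt (hole_x k - N) (b - N)).
  elim: n => [|n IH] nX; first by rewrite addn0.
  rewrite addnS (stepI true); last by rewrite /hole_edge k10 /=; lia.
  by rewrite /= subn0 subn1 /= IH //; lia.
have -> : i = hole_x k - N + (i - (hole_x k - N)) by lia.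
rewrite hor; [|lia|lia].
have -> : j = b - N + (j - (b - N)) by lia.
by rewrite ver //; lia.
Qed.

(** The region u of the plane bounds z after folding; beta records its values
    on the holes, which are not part of the surface. *)
Definition filled (z : ed -> bool) (beta : nat -> bool) := exists u : pt -> bool,
  [/\ forall p : pt, (side <= p.1) || (side <= p.2) -> u p = false,
      forall p : pt, in_hole p -> u p = beta (hole_of p.1) &
      forall e, good e -> z e = fold (cob u) e].

(** If all twists vanish, the ends of the cycle on the first halves of the
    circles can be joined along the circles; adding the glued copy of this
    chain changes nothing in the glued grid and yields a cycle Y of the plane.
    It avoids the holes, so the region that it bounds is constant on each of
    them. *)
Lemma untwisted_filled z : closed_chain z -> (forall k, twist z k = false) ->
  exists beta, filled z beta.
Proof.
move=> zc zt; have [t0 t1] := trace_closed zc.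
pose t q := (circle_pt q && first_half q) && trace z q.
have [| |x0 [x0i x0b]] := @even_boundary _ _ src tgt circ _ circle_index circ_conn t.
- by move=> p /andP[/andP[pC _] _]; rewrite /circle_index pC.
- move=> v; rewrite -[RHS](zt v) /twist big_mkcondr; apply: eq_bigr => q.
  by rewrite /t /circle_index; case: (circle_pt q) => //= _; case: (first_half q).
have x0C e : x0 e -> circ e by move=> /x0i /andP[].
pose x e := x0 e (+) (circ e && x0 (tauE e)).
have xC e : x e -> circ e.
  by rewrite /x; case: (boolP (x0 e)) => [/x0C //|_ /andP[]].
have xb q : bnd src tgt valid x q = trace z q.
  rewrite bnd_valid_circ //; case: (boolP (circle_pt q)) => qC; last by rewrite bnd_circ0 // t0.
  rewrite /x bndD x0b.
  have -> : bnd src tgt circ (fun e => circ e && x0 (tauE e)) q =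
      bnd src tgt circ (fun e => x0 (tauE e)) q.
    by apply: eq_bigr => e ->.
  have [tC tK th _] := tauP qC.
  rewrite -{2}tK bnd_tau // x0b /t qC tC th t1 //=.
  by case: (first_half q); rewrite ?addbF.
pose y e := good e && z e.
pose Y e := valid e && (y e (+) x e).
have Yv e : ~~ valid e -> Y e = false by rewrite /Y => /negPf->.
have Yb q : bnd src tgt xpredT Y q = false.
  rewrite -bnd_valid //.
  have -> : bnd src tgt valid Y q = bnd src tgt valid (fun e => y e (+) x e) q.
    by apply: eq_bigr => e; rewrite /Y => ->.
  by rewrite bndD xb addbb.
have [u [uY u0]] := planar_cycle Yv Yb.
have uI e : in_hole_edge e -> u (sqA e) = u (sqB e).
  move=> eI; have := uY e; rewrite Yv; last by rewrite /valid eI andbF.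
  by rewrite /cob; case: (u _); case: (u _).
exists (fun k => u (gpt (hole_x k - N) (b - N))), u; split=> //.
  exact: hole_const.
move=> e ge; rewrite -[LHS](fold_good z ge).
have ve : valid e by case/andP: ge.
rewrite /fold -!uY /Y ve /=; case: (boolP (circ e)) => eC /=; last first.
  by rewrite /x (negPf eC) addbF; case x0e: (x0 e); rewrite ?addbF //; rewrite (x0C _ x0e) in eC.
have [tC tK _ _] := tauEP eC.
rewrite (circ_valid tC) /= /x eC tC tK /= [x0 (tauE e) (+) _]addbC.
by rewrite addbACA addbb addbF.
Qed.

(** On a glued pair of edges the values on the two holes cancel. *)
Lemma filled_boundary z beta : filled z beta ->
  (forall k, k < 10 -> beta (mate k) = beta k) ->
  exists w, forall e, good e -> z e = cobnd side1 side2 w e.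
Proof.
move=> [u [u0 ub uz]] bm.
exists (fun f => if f is Some p then u p else false) => e ge.
rewrite uz // cobE //; set w := (fun f : cell => _).
have wE p : ~~ in_hole p -> lift_cells w p = u p.
  move=> /negPf pH; rewrite /lift_cells pH /cell_of /w; case: ifP => // out.
  by rewrite u0 //; move: out; lia.
have cC f : circ f -> cob u f = cob (lift_cells w) f (+) beta (hole_of f.2.1).
  move=> fC; rewrite /cob; case: (circ_sq fC) => -[].
    by move=> /hole_of_in_hole[k1 k2] k3; rewrite (wE _ k3) (ub _ k2) k1 /lift_cells k2 /= addbC.
  by move=> k3 /hole_of_in_hole[k1 k2]; rewrite (wE _ k3) (ub _ k2) k1 /lift_cells k2 /= addbF.
have ve : valid e by case/andP: ge.
rewrite /fold; case: (boolP (circ e)) => eC /=; last first.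
  by have [n1 n2] := valid_sq ve eC; rewrite /cob !wE.
have [tC _ _ hm] := tauEP eC.
have k10 : hole_of e.2.1 < 10 by case/andP: eC.
by rewrite !cC // hm bm // addbACA addbb addbF.
Qed.

Lemma filledD z1 z2 b1 b2 : filled z1 b1 -> filled z2 b2 ->
  filled (fun e => z1 e (+) z2 e) (fun k => b1 k (+) b2 k).
Proof.
move=> [u1 [o1 h1 f1]] [u2 [o2 h2 f2]]; exists (fun p => u1 p (+) u2 p); split.
- by move=> p pW; rewrite o1 ?o2.
- by move=> p pH; rewrite h1 ?h2.
- move=> e ge; rewrite f1 // f2 // /fold /cob [LHS]addbACA -andb_addr.
  by congr (_ (+) (_ && _)); rewrite addbACA.
Qed.

(** The twists, one for each cross-cap or handle, and for each handle one more
    bit: after the addition of a fixed cycle R with the same twists, z bounds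
    a region of the plane, and the bit tells whether its values on the two
    holes of the handle differ. *)
Lemma grid_hom : exists s : (ed -> bool) -> {ffun 'I_10 -> bool}, forall z1 z2,
  closed_chain z1 -> closed_chain z2 -> s z1 = s z2 ->
  exists w, forall e, good e -> z1 e (+) z2 e = cobnd side1 side2 w e.
Proof.
pose a z := [ffun k => twist z k].
have /choice [R RP] : forall al, exists z0,
    (exists2 z, closed_chain z & a z = al) -> closed_chain z0 /\ a z0 = al.
  move=> al.
  have [[z zc za]|no] := pselect (exists2 z, closed_chain z & a z = al); first by exists z.
  by exists (fun=> false) => yes; case: no.
have /choice [B BP] : forall z, exists be, closed_chain z ->
    filled (fun e => z e (+) R (a z) e) be.
  move=> z.
  have [zc|nc] := pselect (closed_chain z); last by exists (fun=> false).
  have [rc ra] := RP (a z) (ex_intro2 _ _ z zc erefl).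
  have [k|be bf] := untwisted_filled (closed_chainD zc rc); last by exists be.
  by rewrite twistD; move/ffunP: ra => /(_ k); rewrite !ffunE => ->; rewrite addbb.
exists (fun z => [ffun k : 'I_10 =>
  if hd && odd k then B z k (+) B z (mate k) else twist z k]) => z1 z2 c1 c2 /ffunP ss.
have aa : a z1 = a z2.
  apply/ffunP => k; rewrite !ffunE; have := ss k; rewrite !ffunE.
  case: ifP => // /andP[hh ok] _.
  have tw z : twist z k = false.
    apply: big1 => q /andP[/eqP]; rewrite /circle_index /first_half /first_half_pt hh.
    case: ifP => // qC [kE].
    by rewrite -(inordK (circle_pt_lt qC)) kE ok.
  by rewrite !tw.
have f12 : filled (fun e => z1 e (+) z2 e) (fun k => B z1 k (+) B z2 k).
  have [u [u0 u1 u2]] := filledD (BP z1 c1) (BP z2 c2).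
  exists u; split=> // e /u2 <-; rewrite aa addbACA addbb addbF //.
apply: (filled_boundary f12) => k k10.
have key j (j10 : j < 10) : hd -> odd j -> B z1 j (+) B z1 (mate j) = B z2 j (+) B z2 (mate j).
  by move=> hh oj; have := ss (Ordinal j10); rewrite !ffunE hh oj.
case: (boolP hd) => hh; last by rewrite /mate (negPf hh).
case: (boolP (odd k)) => ok.
  have := key k k10 hh ok.
  by case: (B z1 k); case: (B z2 k); case: (B z1 _); case: (B z2 _).
have := key (mate k) (mate_lt k10) hh; rewrite odd_mate // mateK => /(_ ok).
by case: (B z1 k); case: (B z2 k); case: (B z1 _); case: (B z2 _).
Qed.

End Grid.

(** * The two surfaces in coordinates *)

From Stdlib Require Import Relations.
From mathcomp Require Import all_boot all_order all_algebra.
From mathcomp Require Import all_classical all_reals all_analysis.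
From mathcomp Require Import ring lra.

Import Order.TTheory GRing.Theory Num.Theory.
Import numFieldNormedType.Exports.

Local Open Scope classical_set_scope.
Local Open Scope ring_scope.

Section Surface.
Variables (R : realType) (hd : bool).

Definition gluing : holed_sphere R 10 -> holed_sphere R 10 -> Prop :=
  if hd then @handle_glue R 5 else @crosscap_glue R 10.
(** Five handles and ten cross-caps both use ten holes, so that the two
    surfaces can be treated together. *)
Definition surf : topologicalType := glued gluing.
Local Notation holed := (holed_sphere R 10).
Definition proj (x : holed) : surf := \pi_{eq_quot (glue_equiv gluing)}%qT x.

Definition on_circleR (k : nat) (y : R * R) :=
  [/\ -1 <= y.1 - (4 * k)%:R <= 1, -1 <= y.2 <= 1 &
   [\/ y.1 = (4 * k)%:R - 1, y.1 = (4 * k)%:R + 1, y.2 = -1 | y.2 = 1]].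
Definition in_disc (k : nat) (y : R * R) := (-1 < y.1 - (4 * k)%:R < 1) && (-1 < y.2 < 1).
Definition glue_map (k : nat) (y : R * R) : R * R :=
  ((4 * k)%:R + (4 * mate hd k)%:R - y.1, if hd then y.2 else - y.2).

Lemma norm_lt (v : R * R) r : (`|v| < r) = (- r < v.1 < r) && (- r < v.2 < r).
Proof. by rewrite prod_normE gt_max !ltr_norml. Qed.

Lemma norm_le (v : R * R) r : (`|v| <= r) = (- r <= v.1 <= r) && (- r <= v.2 <= r).
Proof. by rewrite prod_normE ge_max !ler_norml. Qed.

Lemma on_circleRP k y : `|y - centre R k| = 1 <-> on_circleR k y.
Proof.
split.
  move=> e; have : `|y - centre R k| <= 1 by rewrite e.
  have : ~~ (`|y - centre R k| < 1) by rewrite e ltxx.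
  rewrite norm_lt norm_le /centre /= => H1 /andP[h1 h2].
  rewrite subr0 in h2 H1; split=> //.
  move: H1; rewrite !negb_and -!leNgt => /orP[/orP[]|/orP[]] H.
  - by constructor 1; lra.
  - by constructor 2; lra.
  - by constructor 3; lra.
  - by constructor 4; lra.
case=> h1 h2 h3; apply/eqP; rewrite eq_le norm_le [X in _ && X]leNgt norm_lt /centre /= subr0.
rewrite h1 h2 /=; apply/negP => /andP[] /andP[a1 a2] /andP[b1 b2].
by case: h3 => e; rewrite e in a1 a2 b1 b2; lra.
Qed.

Lemma in_discP k y : ball (centre R k) 1 y = in_disc k y :> Prop.
Proof.
rewrite -ball_normE /ball_ /= norm_lt /centre /in_disc /= sub0r; congr is_true.
by apply/idP/idP => /andP[/andP[h1 h2] /andP[h3 h4]]; apply/andP; split; apply/andP; split; lra.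
Qed.

Lemma pair_ext (p q : R * R) : p.1 = q.1 -> p.2 = q.2 -> p = q.
Proof. by case: p q => [a b] [a' b'] /= -> ->. Qed.

Lemma natr4_lt j k : (j < k)%N -> (4 * j)%:R + 4 <= (4 * k)%:R :> R.
Proof. by move=> jk; rewrite -[4 in X in X <= _]/(4%:R) -natrD ler_nat; lia. Qed.

Lemma close_hole k k' (y y' : R * R) : -1 <= y.1 - (4 * k)%:R <= 1 ->
  -1 <= y'.1 - (4 * k')%:R <= 1 -> `|y - y'| < 2 -> k = k'.
Proof.
rewrite norm_lt /= => h1 h2 /andP[h3 _].
by case: (ltngtP k k') => // /natr4_lt H; exfalso; lra.
Qed.

Lemma on_circleR_uniq k k' y : on_circleR k y -> on_circleR k' y -> k = k'.
Proof. by case=> h1 _ _ [h2 _ _]; apply: (close_hole h1 h2); rewrite subrr normr0. Qed.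

Lemma mate_lt10 k : (k < 10)%N -> (mate hd k < 10)%N.
Proof. exact: (@mate_lt hd 1 41). Qed.

Lemma glue_map_circle k y : on_circleR k y -> on_circleR (mate hd k) (glue_map k y).
Proof.
rewrite /on_circleR /glue_map /=; case=> h1 h2 h3; split; first lra.
  by case: hd; lra.
case: hd; case: h3 => e; rewrite e.
- by constructor 2; lra.
- by constructor 1; lra.
- by constructor 3; lra.
- by constructor 4; lra.
- by constructor 2; lra.
- by constructor 1; lra.
- by constructor 4; lra.
- by constructor 3; lra.
Qed.

Lemma glue_mapK k y : glue_map (mate hd k) (glue_map k y) = y.
Proof.
rewrite /glue_map mateK /= (surjective_pairing y) /=; congr (_, _); first lra.
by case: hd; rewrite ?opprK.
Qed.

Lemma glue_map_isom k y y' : `|glue_map k y - glue_map k y'| = `|y - y'|.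
Proof.
rewrite !prod_normE /glue_map /=; congr (Num.max _ _).
  by rewrite -normrN; congr (`|_|); lra.
by case: hd => //; rewrite -normrN; congr (`|_|); lra.
Qed.

(** The gluing relation as a symmetric one, with the k-th gluing given by the
    same map [glue_map] for handles and for cross-caps. *)
Definition twin (p q : holed) := exists k y,
  [/\ (k < 10)%N, on_circleR k y, set_val p = Some y & set_val q = Some (glue_map k y)].

Lemma twin_sym p q : twin p q -> twin q p.
Proof.
move=> [k [y [k10 ky py qy]]]; exists (mate hd k), (glue_map k y).
by rewrite glue_mapK; split=> //; [exact: mate_lt10|exact: glue_map_circle].
Qed.

Lemma twin_trans p q r : twin p q -> twin q r -> p = r.
Proof.
move=> [k [y [k10 ky py qy]]] [k' [y' [k10' ky' qy' ry']]].
apply: val_inj; rewrite -!set_valE py ry'.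
move: qy'; rewrite qy => -[e]; rewrite -e in ky' *.
by rewrite (on_circleR_uniq ky' (glue_map_circle ky)) glue_mapK.
Qed.

Lemma gluing_twin p q : gluing p q -> twin p q.
Proof.
rewrite /gluing /twin /glue_map /mate; case: hd => -[i [v [i5 v1 pv qv]]].
  exists i.*2, (centre R i.*2 + v); split=> //; first by lia.
    by apply/on_circleRP; rewrite addrC addKr.
  rewrite {}qv odd_double /centre /=; congr Some; apply: pair_ext => /=; lra.
exists i, (centre R i + v); split=> //.
  by apply/on_circleRP; rewrite addrC addKr.
by rewrite {}qv /centre /=; congr Some; apply: pair_ext => /=; lra.
Qed.

Lemma twin_gluing p q : twin p q -> gluing p q \/ gluing q p.
Proof.
move=> [k [y [k10 /on_circleRP ky py qy]]]; rewrite /gluing; move: py qy.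
rewrite /glue_map /mate; case: hd => py qy; last first.
  left; exists k, (y - centre R k); split=> //; first by rewrite addrC subrK.
  by rewrite qy /centre /=; congr Some; apply: pair_ext => /=; lra.
have kE := odd_double_half k.
case: (boolP (odd k)) => ok in py qy kE.
  right; exists k./2, (- (y - centre R k).1, (y - centre R k).2).
  have nE : `|(- (y - centre R k).1, (y - centre R k).2)| = 1.
    by rewrite -[RHS]ky !prod_normE /= normrN.
  split=> //; first by lia.
    have k1 : k./2.*2 = k.-1 by lia.
    have k2 : (4 * k)%:R = (4 * k.-1)%:R + 4 :> R.
      by rewrite -[4 in RHS]/(4%:R) -natrD; congr (_%:R); lia.
    rewrite qy k1 /centre /=; congr Some; apply: pair_ext => /=; lra.
  have k1 : k./2.*2.+1 = k by lia.
  by rewrite py k1 /centre /=; congr Some; apply: pair_ext => /=; lra.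
left; exists k./2, (y - centre R k); split=> //; first by lia.
  have -> : k./2.*2 = k by lia.
  by rewrite py addrC subrK.
have -> : k./2.*2 = k by lia.
have k2 : (4 * k.+1)%:R = (4 * k)%:R + 4 :> R.
  by rewrite -[4 in RHS]/(4%:R) -natrD; congr (_%:R); lia.
by rewrite qy /centre /=; congr Some; apply: pair_ext => /=; lra.
Qed.

(** A point of a circle has only one twin, so the generated equivalence has
    classes of at most two points. *)
Lemma projE p q : proj p = proj q <-> p = q \/ twin p q.
Proof.
split.
  move=> /(@eqquotP _ _ {eq_quot (glue_equiv gluing)}%qT) /asboolP.
  elim=> [x y /gluing_twin|x|x y _ [->|/twin_sym]|x y z _ H1 _ H2]; auto.
  case: H1 => [->|xy] //; case: H2 => [<-|yz]; auto.
  by left; apply: twin_trans xy yz.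
move=> H; apply/(@eqquotP _ _ {eq_quot (glue_equiv gluing)}%qT)/asboolP.
case: H => [->|/twin_gluing[]]; first exact: rst_refl.
  by move=> ?; apply: rst_step.
by move=> ?; apply: rst_sym; apply: rst_step.
Qed.

Lemma proj_surj (s : surf) : exists x, proj x = s.
Proof. by exists (repr s); exact: reprK. Qed.

Lemma holed_notin_disc (x : holed) k y : (k < 10)%N -> set_val x = Some y -> ~~ in_disc k y.
Proof.
move=> k10 xy; apply/negP => yD; have := set_valP x; rewrite /= -set_valE xy.
by apply; exists k => //; exists y; rewrite ?in_discP.
Qed.

Lemma holed_point (z : sphere R) : (forall k y, (k < 10)%N -> z = Some y -> ~~ in_disc k y) ->
  exists x : holed, set_val x = z.
Proof.
move=> zP; have zH : (~` \bigcup_(i in `I_10) open_disc (R := R) i) z.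
  move=> [k /= k10 [y]]; rewrite in_discP => yD zy.
  by have := zP k y k10 (esym zy); rewrite yD.
by exists (SigSub (mem_set zH)).
Qed.

End Surface.

(** * Stars of grid points *)

Section Stars.
Variables (R : realType) (hd : bool) (N b : nat).
Hypotheses (N0 : (0 < N)%N) (bN : (41 * N <= b)%N).
Local Notation holed := (holed_sphere R 10).
Local Notation surf := (surf R hd).
Local Notation proj := (@proj R hd).
Local Notation rho := (@rho hd N b).
Local Notation holex := (hole_x N b).
Local Notation adjK := (edge_adj (@ksrc hd N b) (@ktgt hd N b) (@good hd N b)).

(** In the coordinates sx, sy the grid points have integer coordinates. *)
Definition sx (y : R * R) : R := N%:R * y.1 + b%:R.
Definition sy (y : R * R) : R := N%:R * y.2 + b%:R.
Definition box (y : R * R) :=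
  (0 <= sx y <= (side b)%:R) && (0 <= sy y <= (side b)%:R).
Definition instar (q : pt b) (y : R * R) :=
  (`|sx y - q.1%:R| < 1) && (`|sy y - q.2%:R| < 1).
Definition bdry (q : pt b) :=
  [|| (q.1 == 0 :> nat)%N, (q.1 == side b :> nat)%N, (q.2 == 0 :> nat)%N |
      (q.2 == side b :> nat)%N].
(** An open square of half side one step. The stars of the points on the
    border of the box also contain everything outside the box, so that the
    stars cover the sphere. *)
Definition star (q : pt b) (z : sphere R) : bool :=
  if z is Some y then instar q y || (bdry q && ~~ box y) else bdry q.
Definition star_at (p : pt b) (s : surf) : Prop :=
  exists x q, [/\ proj x = s, rho q = p & star q (set_val x)].
Definition star_pts (s : surf) : {set pt b} := [set p | `[< star_at p s >]]%SET.

Lemma near_ge (A i : nat) (r : R) : A%:R <= r -> `|r - i%:R| < 1 -> (A <= i)%N.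
Proof.
rewrite ltr_norml => h1 /andP[h2 h3]; rewrite -ltnS -(ltr_nat R) -natr1; lra.
Qed.

Lemma near_le (A i : nat) (r : R) : r <= A%:R -> `|r - i%:R| < 1 -> (i <= A)%N.
Proof.
rewrite ltr_norml => h1 /andP[h2 h3]; rewrite -ltnS -(ltr_nat R) -natr1; lra.
Qed.

Lemma NR0 : 0 < N%:R :> R. Proof. by rewrite ltr0n. Qed.

Lemma hole_xR k : (holex k)%:R = b%:R + N%:R * (4 * k)%:R :> R.
Proof. by rewrite /hole_x natrD; congr (_ + _); rewrite -natrM mulnC. Qed.

Lemma hole_x_in_box k : (k < 10)%N -> (N <= holex k)%N /\ (holex k + N < side b)%N.
Proof. by move=> k10; have := hole_x_bnd N0 bN k10; have := mesh_bnd N0 bN; rewrite /side; lia. Qed.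

Lemma sideR : (side b)%:R = 2 * b%:R :> R.
Proof. by rewrite /side natrM. Qed.

Lemma on_circleR_scaled k y : on_circleR k y -> [/\ (holex k)%:R - N%:R <= sx y <= (holex k)%:R + N%:R,
  b%:R - N%:R <= sy y <= b%:R + N%:R &
  [\/ sx y = (holex k)%:R - N%:R, sx y = (holex k)%:R + N%:R, sy y = b%:R - N%:R |
      sy y = b%:R + N%:R]].
Proof.
rewrite hole_xR /sx /sy => -[h1 h2 h3]; have := NR0 => n0; split; [nra|nra|].
by case: h3 => ->; [constructor 1|constructor 2|constructor 3|constructor 4]; lra.
Qed.

(** The circles run along grid lines, at distance at least one step from the
    grid points that are not on them. *)
Lemma star_circle k y q : (k < 10)%N -> on_circleR k y -> instar q y -> on_circle N b k q.1 q.2.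
Proof.
move=> k10 /on_circleR_scaled [h1 h2 h3] /andP[q1 q2]; have [X1 X2] := hole_x_in_box k10.
have b1 : (N <= b)%N by have := mesh_bnd N0 bN; lia.
have e1 : (holex k - N)%:R = (holex k)%:R - N%:R :> R by rewrite natrB.
have e2 : (b - N)%:R = b%:R - N%:R :> R by rewrite natrB.
have e3 : (holex k + N)%:R = (holex k)%:R + N%:R :> R by rewrite natrD.
have e4 : (b + N)%:R = b%:R + N%:R :> R by rewrite natrD.
have a1 : (holex k - N <= q.1)%N by apply: near_ge q1; rewrite e1; case/andP: h1.
have a2 : (q.1 <= holex k + N)%N by apply: near_le q1; rewrite e3; case/andP: h1.
have a3 : (b - N <= q.2)%N by apply: near_ge q2; rewrite e2; case/andP: h2.
have a4 : (q.2 <= b + N)%N by apply: near_le q2; rewrite e4; case/andP: h2.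
rewrite /on_circle k10 a1 a2 a3 a4 /=; apply/or4P; case: h3 => e.
- by constructor 1; rewrite eqn_leq a1 andbT; apply: near_le q1; rewrite e e1.
- by constructor 2; rewrite eqn_leq a2 /=; apply: near_ge q1; rewrite e e3.
- by constructor 3; rewrite eqn_leq a3 andbT; apply: near_le q2; rewrite e e2.
- by constructor 4; rewrite eqn_leq a4 /=; apply: near_ge q2; rewrite e e4.
Qed.

Lemma circle_in_box k y : (k < 10)%N -> on_circleR k y -> box y.
Proof.
move=> k10 /on_circleR_scaled [h1 h2 _]; have [X1 X2] := hole_x_in_box k10.
have b1 : (N <= b)%N by have := mesh_bnd N0 bN; lia.
have : (N%:R : R) <= (holex k)%:R by rewrite ler_nat.
have : (N%:R : R) <= b%:R by rewrite ler_nat.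
have : (holex k)%:R + N%:R < (side b)%:R :> R by rewrite -natrD ltr_nat.
have : b%:R + N%:R <= (side b)%:R :> R by rewrite -natrD ler_nat /side; lia.
move: h1 h2 => /andP[? ?] /andP[? ?] ? ? ? ?.
by rewrite /box; apply/andP; split; apply/andP; split; lra.
Qed.

Lemma circle_ptE k (q : pt b) : on_circle N b k q.1 q.2 -> circle_pt N q /\ hole_of N b q.1 = k.
Proof. by move=> qC; rewrite /circle_pt (hole_of_circle N0 bN qC). Qed.

(** The gluing maps are isometries that preserve the grid. *)
Lemma star_twin x x' q : twin hd x x' -> star q (set_val x) ->
  circle_pt N q /\ star (tau hd N q) (set_val x').
Proof.
move=> [k [y [k10 yk -> ->]]]; rewrite /star (circle_in_box k10 yk) andbF orbF => sq.
have qC := star_circle k10 yk sq; have [qc qk] := circle_ptE qC; split=> //.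
apply/orP; left; have [t1 t2] := tau_val hd N0 bN qc.
case/and4P: qC => _ q1 q2 _; have [X1 X2] := hole_x_in_box k10.
have [X3 X4] := hole_x_in_box (mate_lt10 hd k10).
have qb : (q.2 <= 2 * b)%N by lia.
move: sq; rewrite /instar t1 t2 qk /glue_x.
rewrite natrB; last by lia.
rewrite (natrD _ (holex k)).
have -> : sx (glue_map hd k y) = (holex k)%:R + (holex (mate hd k))%:R - sx y.
  by rewrite !hole_xR /sx /glue_map /=; lra.
have sE (c r s : R) : `|c - r - (c - s)| = `|r - s|.
  by rewrite -normrN; congr `|_|; lra.
rewrite sE => /andP[-> /= ]; rewrite /sy /glue_map /= /glue_y; case: hd => //.
rewrite (natrB _ qb).
rewrite natrM -normrN => H.
by rewrite (_ : _ - _ = - (N%:R * y.2 + b%:R - q.2%:R)) //; lra.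
Qed.

Lemma star_ptsP x p : (p \in star_pts (proj x)) <-> exists2 q, rho q = p & star q (set_val x).
Proof.
rewrite inE; split; last first.
  by move=> [q qp sq]; apply/asboolP; exists x, q.
move=> /asboolP[x' [q [/projE xx qp sq]]].
case: xx => [e|xx]; first by subst x'; exists q.
have [qC st] := star_twin xx sq; exists (tau hd N q) => //.
by rewrite (rho_tau hd N0 bN qC).
Qed.

Lemma valid_adj (e : ed b) : valid N e -> adjK (rho (src e)) (rho (tgt e)).
Proof.
move=> ve; apply/existsP; have [ge|] := boolP (good hd N e).
  by exists e; rewrite /joins ge !eqxx.
rewrite /good ve negb_imply => /= /andP[eC nh].
have [c1 c2 _ _] := circ_ends N0 bN eC.
have [tC tK th _] := tauEP hd N0 bN eC.
exists (tauE hd N e); rewrite /joins /good (circ_valid N0 bN tC) tC th nh /=.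
rewrite /ksrc /ktgt; case: (tauE_ends hd N0 bN eC) => -[-> ->];
by rewrite !(rho_tau hd N0 bN) // !eqxx ?orbT.
Qed.

Lemma adjK_sym p q : adjK p q = adjK q p. Proof. exact: edge_adj_sym. Qed.

Lemma succ_val_le (h : bool) (p : pt b) : (p.1 + h <= side b)%N -> (p.2 + ~~ h <= side b)%N ->
  ((succ_pt h p).1 = p.1 + h :> nat)%N /\ ((succ_pt h p).2 = p.2 + ~~ h :> nat)%N.
Proof.
rewrite /succ_pt; case: h => /=; rewrite ?addn1 ?addn0 => h1 h2; split=> //;
by rewrite modn_small.
Qed.

(** Both stars contain a point outside the holes, so the edge between their
    centres does not lie in the interior of a hole. *)
Lemma step_adj (x : holed) y (h : bool) (q q' : pt b) : set_val x = Some y ->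
  instar q y -> instar q' y -> (q'.1 = q.1 + h :> nat)%N -> (q'.2 = q.2 + ~~ h :> nat)%N ->
  adjK (rho q) (rho q').
Proof.
move=> xy /andP[qx qy] /andP[qx' qy'] e1 e2.
have -> : q' = tgt (h, q).
  have w1 := ltn_ord q'.1; have w2 := ltn_ord q'.2.
  by have [||n1 n2] := @succ_val_le h q; [lia..|apply: pt_eq; rewrite /tgt ?n1 ?n2].
rewrite -[q in rho q]/(src (h, q)); apply: valid_adj; apply/andP; split.
  have w1 := ltn_ord q'.1; have w2 := ltn_ord q'.2.
  suff : ((if h then (q.1 : nat) else q.2) < side b)%N by [].
  by case: h e1 e2; lia.
apply/negP => /andP[/= k10 hI]; have := holed_notin_disc k10 xy; apply/negP/negPn.
have [X1 X2] := hole_x_in_box k10; move: hI; set k := hole_of _ _ _ => hI.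
have b1 : (N <= b)%N by have := mesh_bnd N0 bN; lia.
have n0 := NR0.
have fin : (holex k)%:R - N%:R < sx y < (holex k)%:R + N%:R ->
   b%:R - N%:R < sy y < b%:R + N%:R -> in_disc k y.
  rewrite hole_xR /sx /sy /in_disc => h1 h2; apply/andP; split.
    by apply/andP; split; rewrite -(ltr_pM2l n0); lra.
  by apply/andP; split; rewrite -(ltr_pM2l n0); lra.
have cl (i A : nat) : (A <= i)%N -> A%:R <= i%:R :> R by rewrite ler_nat.
have cl' (i A : nat) : (A < i)%N -> A%:R + 1 <= i%:R :> R by rewrite natr1 ler_nat.
have e3 : (holex k - N)%:R = (holex k)%:R - N%:R :> R by rewrite natrB.
have e4 : (b - N)%:R = b%:R - N%:R :> R by rewrite natrB.
have e5 : (holex k + N)%:R = (holex k)%:R + N%:R :> R by rewrite natrD.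
have e6 : (b + N)%:R = b%:R + N%:R :> R by rewrite natrD.
move: qx qy qx' qy'; rewrite e1 e2 !natrD !ltr_norml {e1 e2}.
case: h hI => /= /andP[/andP[] + + /andP[]].
  move=> /cl + /cl' + /cl' + /cl'; rewrite e3 e4 e5 e6 => i1 i2 i3 i4.
  move=> /andP[? ?] /andP[? ?] /andP[? ?] /andP[? ?].
  by apply: fin; apply/andP; split; lra.
move=> /cl' + /cl' + /cl + /cl'; rewrite e3 e4 e5 e6 => i1 i2 i3 i4.
move=> /andP[? ?] /andP[? ?] /andP[? ?] /andP[? ?].
by apply: fin; apply/andP; split; lra.
Qed.

Lemma in_star_pts (x : holed) q : star q (set_val x) -> rho q \in star_pts (proj x).
Proof. by move=> sq; apply/star_ptsP; exists q. Qed.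

Local Notation radjK x := (radj (@ksrc hd N b) (@ktgt hd N b) (@good hd N b) (star_pts (proj x))).

Lemma star_conn_inside (x : holed) y : set_val x = Some y -> forall q q' : pt b,
  instar q y -> instar q' y -> connect (radjK x) (rho q) (rho q').
Proof.
move=> xy.
have inS q : instar q y -> rho q \in star_pts (proj x).
  by move=> qy; apply: in_star_pts; rewrite /star xy qy.
have st (h : bool) (q q' : pt b) : instar q y -> instar q' y ->
    (q'.1 = q.1 + h :> nat)%N -> (q'.2 = q.2 + ~~ h :> nat)%N ->
    connect (radjK x) (rho q) (rho q') /\ connect (radjK x) (rho q') (rho q).
  move=> qy qy' e1 e2; have qq := step_adj xy qy qy' e1 e2.
  by split; apply: connect1; rewrite /radj !inS // adjK_sym.
have close (i j : nat) (r : R) : `|r - i%:R| < 1 -> `|r - j%:R| < 1 -> (i <= j.+1)%N.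
  rewrite !ltr_norml => /andP[? ?] /andP[? ?]; rewrite -ltnS -(ltr_nat R) -!natr1; lra.
have hor (q q' : pt b) : instar q y -> instar q' y -> q.2 = q'.2 :> nat ->
    connect (radjK x) (rho q) (rho q').
  move=> qy qy' e2; have /andP[q1 _] := qy; have /andP[q1' _] := qy'.
  have c1 := close _ _ _ q1 q1'; have c2 := close _ _ _ q1' q1.
  case: (ltngtP q.1 q'.1) => e1.
  - by apply: (proj1 (@st true q q' _ _ _ _)) => //; lia.
  - by apply: (proj2 (@st true q' q _ _ _ _)) => //; lia.
  - by rewrite (pt_eq e1 e2) connect0.
have ver (q q' : pt b) : instar q y -> instar q' y -> q.1 = q'.1 :> nat ->
    connect (radjK x) (rho q) (rho q').
  move=> qy qy' e2; have /andP[_ q1] := qy; have /andP[_ q1'] := qy'.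
  have c1 := close _ _ _ q1 q1'; have c2 := close _ _ _ q1' q1.
  case: (ltngtP q.2 q'.2) => e1.
  - by apply: (proj1 (@st false q q' _ _ _ _)) => //; lia.
  - by apply: (proj2 (@st false q' q _ _ _ _)) => //; lia.
  - by rewrite (pt_eq e2 e1) connect0.
move=> q q' qy qy'; have /andP[q1 q2] := qy; have /andP[q1' q2'] := qy'.
have my : instar (q'.1, q.2) y by rewrite /instar q1' q2.
by apply: connect_trans (hor q _ qy my _) (ver _ q' my qy' _).
Qed.

Lemma bdry_notC q : bdry q -> circle_pt N q = false.
Proof.
move=> qb; apply/negP => /(circle_side N0 bN) [? [? [? ?]]].
by move: qb; rewrite /bdry; lia.
Qed.

Lemma bdry_rho q : bdry q -> rho q = q.
Proof. by move=> /bdry_notC qC; rewrite /rho qC. Qed.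

Lemma bdry_gpt i j : (i <= side b)%N -> (j <= side b)%N ->
  [|| i == 0, i == side b, j == 0 | j == side b]%N -> bdry (gpt b i j).
Proof. by move=> iW jW; have [v1 v2] := gpt_val iW jW; rewrite /bdry v1 v2. Qed.

Lemma bdry_step (h : bool) i j : (i + h <= side b)%N -> (j + ~~ h <= side b)%N ->
  (if h then (j == 0) || (j == side b) else (i == 0) || (i == side b))%N ->
  adjK (gpt b i j) (gpt b (i + h) (j + ~~ h)).
Proof.
move=> iW jW ij.
have [||v1 v2] := @gpt_val b i j; [lia..|].
have [||u1 u2] := @gpt_val b (i + h) (j + ~~ h); [lia..|].
have b1 : bdry (gpt b i j) by apply: bdry_gpt; [lia|lia|case: h ij {iW jW u1 u2} => /=; lia].
have b2 : bdry (gpt b (i + h) (j + ~~ h)).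
  by apply: bdry_gpt => //; case: h ij {iW jW u1 u2} => /=; rewrite ?addn0; lia.
rewrite -(bdry_rho b1) -(bdry_rho b2).
have -> : gpt b (i + h) (j + ~~ h) = tgt (h, gpt b i j).
  have [||n1 n2] := @succ_val_le h (gpt b i j); rewrite ?v1 ?v2 //.
  by apply: pt_eq; rewrite /tgt ?n1 ?n2 ?u1 ?u2 ?v1 ?v2.
rewrite -[X in rho X]/(src (h, gpt b i j)); apply: valid_adj; apply/andP; split.
  by rewrite /inbox [(_, _).2]/(gpt b i j) v1 v2; case: h iW jW {ij u1 u2 b2} => /=; lia.
rewrite /in_hole_edge [(_, _).2]/(gpt b i j) v1 v2; apply/negP => /andP[k10].
have [X1 X2] := hole_x_in_box k10; have := mesh_bnd N0 bN.
by move: ij X2; rewrite /side; case: h {iW jW u1 u2 b2} => /=; lia.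
Qed.

Lemma bdry_vrun i n : (i == 0)%N || (i == side b) -> (n <= side b)%N ->
  connect (radj (@ksrc hd N b) (@ktgt hd N b) (@good hd N b) [set q | bdry q]%SET)
    (gpt b i n) (gpt b i 0).
Proof.
move=> ik; elim: n => [|n IH] nW; first exact: connect0.
apply: connect_trans (IH (ltnW nW)); apply: connect1.
have st := @bdry_step false i n; rewrite addn0 addn1 in st.
rewrite /radj adjK_sym st //; last by case/orP: ik => /eqP->.
have iW : (i <= side b)%N by case/orP: ik => /eqP->.
by rewrite !inE !bdry_gpt // ?(ltnW nW) //; case/orP: ik => /eqP->; rewrite eqxx ?orbT.
Qed.

Lemma bdry_hrun j n : (j == 0)%N || (j == side b) -> (n <= side b)%N ->
  connect (radj (@ksrc hd N b) (@ktgt hd N b) (@good hd N b) [set q | bdry q]%SET)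
    (gpt b n j) (gpt b 0 j).
Proof.
move=> ik; elim: n => [|n IH] nW; first exact: connect0.
apply: connect_trans (IH (ltnW nW)); apply: connect1.
have st := @bdry_step true n j; rewrite addn0 addn1 in st.
rewrite /radj adjK_sym st //; last by case/orP: ik => /eqP->.
have iW : (j <= side b)%N by case/orP: ik => /eqP->.
by rewrite !inE !bdry_gpt // ?(ltnW nW) //; case/orP: ik => /eqP->; rewrite eqxx ?orbT.
Qed.

Lemma bdry_conn :
  connected_in (@ksrc hd N b) (@ktgt hd N b) (@good hd N b) [set q | bdry q]%SET.
Proof.
have rsym := sym_connect_sym (@radj_sym _ _ (@ksrc hd N b) (@ktgt hd N b) (@good hd N b)
  [set q | bdry q]%SET).
suff key q : q \in [set q | bdry q]%SET -> connect
    (radj (@ksrc hd N b) (@ktgt hd N b) (@good hd N b) [set q | bdry q]%SET) q (gpt b 0 0).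
  move=> p q pS qS; apply: connect_trans (key p pS) _.
  by rewrite rsym; exact: key.
rewrite inE [X in connect _ X](gptE q) /bdry => qb.
have q1 : (q.1 <= side b)%N by rewrite -ltnS.
have q2 : (q.2 <= side b)%N by rewrite -ltnS.
case/or4P: qb => e.
- by rewrite (eqP e); apply: bdry_vrun.
- apply: connect_trans (bdry_vrun _ q2) (bdry_hrun _ q1); by rewrite ?e ?orbT.
- by rewrite (eqP e); apply: bdry_hrun.
- apply: connect_trans (bdry_hrun _ q1) _; first by rewrite e orbT.
  exact: bdry_vrun.
Qed.

Lemma instar_out q y : instar q y -> ~~ box y -> bdry q.
Proof.
have qW1 : (q.1 <= side b)%N by rewrite -ltnS.
have qW2 : (q.2 <= side b)%N by rewrite -ltnS.
move=> /andP[q1 q2]; rewrite /box !negb_and -!ltNge /bdry => H.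
have low (i : nat) (r : R) : `|r - i%:R| < 1 -> r < 0 -> i = 0%N.
  by move=> h1 /ltW h2; apply/eqP; rewrite -leqn0; apply: near_le h1.
have high (i : nat) (r : R) : `|r - i%:R| < 1 -> (side b)%:R < r -> (side b <= i)%N.
  by move=> h1 /ltW h2; apply: near_ge h1.
case/orP: H => /orP[] H.
- by rewrite (low _ _ q1 H).
- by apply/or4P; constructor 2; rewrite eqn_leq qW1 /=; apply: high q1 H.
- by rewrite (low _ _ q2 H) orbA orbT.
- by apply/or4P; constructor 4; rewrite eqn_leq qW2 /=; apply: high q2 H.
Qed.

(** A point inside the box is seen by the corners of a square, an edge or a
    point of the grid; a point outside by the border of the box. *)
Lemma star_pts_conn s :
  connected_in (@ksrc hd N b) (@ktgt hd N b) (@good hd N b) (star_pts s).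
Proof.
have [x <-] := proj_surj s; clear s.
have out : (forall q, star q (set_val x) = bdry q) -> star_pts (proj x) = [set q | bdry q]%SET.
  move=> sb; apply/setP => p; rewrite [RHS]inE; apply/idP/idP.
    by move=> /star_ptsP[q <-]; rewrite sb => qb; rewrite bdry_rho.
  by move=> pb; apply/star_ptsP; exists p; rewrite ?bdry_rho ?sb.
case xE: (set_val x) => [y|]; last first.
  by rewrite out; [exact: bdry_conn|move=> q; rewrite xE].
have [yb|yb] := boolP (box y); last first.
  rewrite out; first exact: bdry_conn.
  move=> q; rewrite xE /star yb andbT; case: (boolP (instar q y)) => //= qy.
  by rewrite (instar_out qy yb).
move=> p p' /star_ptsP[q <- sq] /star_ptsP[q' <- sq'].
move: sq sq'; rewrite xE /star yb !andbF !orbF => sq sq'.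
exact: star_conn_inside xE _ _ sq sq'.
Qed.

Lemma star_pts_neq0 s : exists p, p \in star_pts s.
Proof.
have [x <-] := proj_surj s.
have b0 : bdry (gpt b 0 0) by apply: bdry_gpt.
case xE: (set_val x) => [y|]; last by exists (rho (gpt b 0 0)); apply: in_star_pts; rewrite xE.
have [yb|yb] := boolP (box y); last first.
  by exists (rho (gpt b 0 0)); apply: in_star_pts; rewrite xE /star b0 yb orbT.
have /andP[/andP[a1 a2] /andP[a3 a4]] := yb.
have ex (r : R) : 0 <= r -> r <= (side b)%:R -> exists2 i, (i <= side b)%N & `|r - i%:R| < 1.
  move=> r0 rW; have := truncn_itv r0; set i := Num.truncn r => /andP[i1 i2].
  exists i; first by rewrite -(ler_nat R); exact: le_trans rW.
  by move: i2; rewrite ltr_norml -natr1 => i2; apply/andP; split; lra.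
have [i iW ir] := ex _ a1 a2; have [j jW jr] := ex _ a3 a4.
have [v1 v2] := gpt_val iW jW.
exists (rho (gpt b i j)); apply: in_star_pts.
by rewrite xE /star /instar v1 v2 ir jr.
Qed.

Definition gpos (q : pt b) : R * R :=
  ((q.1%:R - b%:R) / N%:R, (q.2%:R - b%:R) / N%:R).

Lemma instarE q y : instar q y = (`|gpos q - y| < N%:R^-1).
Proof.
have n0 := NR0.
have H (i : nat) (r : R) : (`|N%:R * r + b%:R - i%:R| < 1) = (`|(i%:R - b%:R) / N%:R - r| < N%:R^-1).
  have -> : (i%:R - b%:R) / N%:R - r = - ((N%:R * r + b%:R - i%:R) / N%:R).
    by field; rewrite gt_eqF.
  have i0 : 0 < (N%:R^-1 : R) by rewrite invr_gt0.
  by rewrite normrN normrM (gtr0_norm i0) -[X in _ = (_ < X)]mul1r ltr_pM2r.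
by rewrite prod_normE gt_max /= /instar /sx /sy !H.
Qed.

Lemma instar_open q : open [set y | instar q y].
Proof.
have -> : [set y | instar q y] = ball (gpos q) (N%:R^-1 : R).
  by apply/seteqP; split => y; rewrite -ball_normE /ball_ /= instarE.
exact: ball_open.
Qed.

Lemma box_segments :
  [set y : R * R | box y] = `[- (b%:R / N%:R), b%:R / N%:R : R] `*` `[- (b%:R / N%:R), b%:R / N%:R : R].
Proof.
have n0 := NR0.
have H (r : R) : (0 <= N%:R * r + b%:R <= (side b)%:R) = (- (b%:R / N%:R) <= r <= b%:R / N%:R).
  rewrite sideR -mulNr ler_pdivrMr // ler_pdivlMr //.
  by apply/idP/idP => /andP[h1 h2]; apply/andP; split; lra.
by apply/seteqP; split => y; rewrite /box /sx /sy /= !in_itv /= !H => /andP.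
Qed.

Lemma box_compact : compact [set y : R * R | box y].
Proof. by rewrite box_segments; apply: compact_setX; apply: segment_compact. Qed.

Lemma box_closed : closed [set y : R * R | box y].
Proof. by apply: compact_closed box_compact; exact: norm_hausdorff. Qed.

Definition outside : set (sphere R) := [set z | if z is Some y then ~~ box y else true].

(** At infinity the complement of the box is a neighbourhood since the box is
    compact. *)
Lemma outside_open : open outside.
Proof.
rewrite openE => -[y|] /= yb.
  rewrite /interior /nbhs /= .
  have : nbhs y (~` [set y : R * R | box y]).
    by apply: open_nbhs_nbhs; split; [exact/closed_openC/box_closed|exact/negP].
  by apply: filterS => y' /= /negP.
exists [set y | box y]; first by split; [exact: box_compact|exact: box_closed].
by move=> z [[y' /= /negP yb' <-]|->].
Qed.

Lemma star_open q : open [set z | star q z].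
Proof.
have -> : [set z | star q z] =
    (Some @` [set y | instar q y]) `|` (if bdry q then outside else set0).
  apply/seteqP; split => [[y|]|z] /=.
  - case/orP => [qy|/andP[-> yb]]; [by left; exists y|by right].
  - by move=> ->; right.
  - case=> [[y qy <-]|]; first by rewrite /star qy.
    by case: (boolP (bdry q)) => // qb; case: z => [y|] //= yb; rewrite qb yb orbT.
apply: openU; first exact/one_point_compactification_open_some/instar_open.
by case: ifP => _; [exact: outside_open|exact: open0].
Qed.

Lemma star_at_open p : open (star_at p).
Proof.
have -> : open (star_at p) = open (proj @^-1` star_at p) by [].
have -> : proj @^-1` star_at p = set_val @^-1` (\bigcup_(q in [set q | rho q = p]) [set z | star q z]).
  apply/seteqP; split => x /=.
    move=> /asboolP xp; have /star_ptsP[q qp sq] : p \in star_pts (proj x) by rewrite inE.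
    by exists q.
  by move=> [q qp sq]; exists x, q.
apply: open_comp; first by move=> x _; exact: initial_continuous.
by apply: bigcup_open => q _; exact: star_open.
Qed.

Lemma sx_gpos q : sx (gpos q) = q.1%:R.
Proof. by rewrite /sx /gpos /=; have := NR0; move=> n0; field; rewrite gt_eqF. Qed.

Lemma sy_gpos q : sy (gpos q) = q.2%:R.
Proof. by rewrite /sy /gpos /=; have := NR0; move=> n0; field; rewrite gt_eqF. Qed.

Lemma in_disc_scaled k y : in_disc k y =
  ((holex k)%:R - N%:R < sx y < (holex k)%:R + N%:R) && (b%:R - N%:R < sy y < b%:R + N%:R).
Proof.
have n0 := NR0; rewrite hole_xR /sx /sy /in_disc.
rewrite -(ltr_pM2l n0 (-1)) -(ltr_pM2l n0 _ 1) -(ltr_pM2l n0 (-1) y.2) -(ltr_pM2l n0 y.2 1).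
by apply/idP/idP => /andP[/andP[h1 h2] /andP[h3 h4]]; apply/andP; split;
  apply/andP; split; lra.
Qed.

Lemma gpos_holed (x : holed) q : star q (set_val x) -> exists z : holed, set_val z = Some (gpos q).
Proof.
move=> sq; apply: holed_point => k y k10 [<-]; apply/negP; rewrite in_disc_scaled sx_gpos sy_gpos.
have [X1 X2] := hole_x_in_box k10; have b1 : (N <= b)%N by have := mesh_bnd N0 bN; lia.
rewrite -!natrB // -!natrD !ltr_nat => /andP[/andP[i1 i2] /andP[i3 i4]].
have qb : bdry q = false.
  by apply/negP; move: i1 i2 i3 i4; rewrite /bdry; move: X1 X2; rewrite /side; lia.
move: sq; rewrite /star qb; case xy: (set_val x) => [y'|//]; rewrite orbF.
move=> /andP[q1 q2]; have := holed_notin_disc k10 xy; apply/negP; rewrite negbK in_disc_scaled.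
have cl' (i A : nat) : (A < i)%N -> A%:R + 1 <= i%:R :> R by rewrite natr1 ler_nat.
move: q1 q2; rewrite !ltr_norml => /andP[? ?] /andP[? ?].
have := cl' _ _ i1; have := cl' _ _ i2; have := cl' _ _ i3; have := cl' _ _ i4.
rewrite !natrB // ![(_ + N)%:R]natrD => ? ? ? ?.
by apply/andP; split; apply/andP; split; lra.
Qed.

Lemma circle_gpos k (q : pt b) : on_circle N b k q.1 q.2 -> on_circleR k (gpos q).
Proof.
have n0 := NR0.
case/and4P=> k10 i1 i2 i3; have [X1 X2] := hole_x_in_box k10.
have b1 : (N <= b)%N by have := mesh_bnd N0 bN; lia.
have e (i : nat) (c : R) : (i%:R - b%:R) / N%:R - c = (i%:R - (b%:R + N%:R * c)) / N%:R.
  by field; rewrite gt_eqF.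
have H (i : nat) (A : nat) (c : R) : (N <= A)%N -> A%:R = b%:R + N%:R * c ->
    (A - N <= i <= A + N)%N -> -1 <= (i%:R - b%:R) / N%:R - c <= 1.
  move=> NA Ac /andP[a1 a2]; rewrite e -Ac ler_pdivlMr // ler_pdivrMr //.
  move: a1 a2; rewrite -!(ler_nat R) natrB // natrD => a1 a2.
  by apply/andP; split; lra.
split.
- exact: H (hole_xR k) i1.
- by have := H q.2 b 0; rewrite mulr0 addr0 subr0; apply.
- have n1 : (N%:R != 0 :> R) by rewrite gt_eqF.
  have eb : (b - N)%:R = b%:R - N%:R :> R by rewrite natrB.
  have ex : (holex k - N)%:R = b%:R + N%:R * (4 * k)%:R - N%:R :> R by rewrite natrB // hole_xR.
  have ey : (holex k + N)%:R = b%:R + N%:R * (4 * k)%:R + N%:R :> R by rewrite natrD hole_xR.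
  case/or4P: i3 => /eqP; rewrite /gpos /= => ->.
  + by constructor 1; rewrite ex; field.
  + by constructor 2; rewrite ey; field.
  + by constructor 3; rewrite eb; field.
  + by constructor 4; rewrite natrD; field.
Qed.

Lemma gpos_tau q : circle_pt N q -> gpos (tau hd N q) = glue_map hd (hole_of N b q.1) (gpos q).
Proof.
move=> qC; have [t1 t2] := tau_val hd N0 bN qC; have n0 := NR0.
have n1 : (N%:R != 0 :> R) by rewrite gt_eqF.
case/and4P: (qC) => k10 i1 i2 _; have [X1 X2] := hole_x_in_box k10.
have [X3 X4] := hole_x_in_box (mate_lt10 hd k10).
apply: pair_ext; rewrite /gpos /glue_map /= ?t1 ?t2.
  rewrite /glue_x natrB; last by lia.
  by rewrite (natrD _ (holex _)) !hole_xR; field.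
rewrite /glue_y; case: hd; first by [].
have qb : (q.2 <= 2 * b)%N by rewrite -ltnS.
by rewrite (natrB _ qb) natrM; field.
Qed.

Lemma rho_gpos q q' (x x' : holed) : rho q = rho q' -> set_val x = Some (gpos q) ->
  set_val x' = Some (gpos q') -> proj x = proj x'.
Proof.
move=> /(rhoE hd N0 bN) qq xq xq'; apply/projE; case: qq => [e|[qC e]].
  by left; apply: val_inj; rewrite -!set_valE xq xq' e.
right; exists (hole_of N b q.1), (gpos q); split=> //; first by case/and4P: qC.
  exact: circle_gpos.
by rewrite xq' e gpos_tau.
Qed.

End Stars.

(** * Fine grids separate points *)

Section Separation.
Variables (R : realType) (hd : bool).
Local Notation holed := (holed_sphere R 10).
Local Notation surf := (surf R hd).
Local Notation proj := (@proj R hd).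

Definition far (d : R) (z : sphere R) : bool := if z is Some y then d^-1 < `|y| else true.
(** A substitute for a distance on the sphere, as a one-point
    compactification: at distance less than d in the plane, or both at
    distance more than 1 / d from the origin. *)
Definition close (d : R) (z z' : sphere R) : Prop :=
  (exists y y', [/\ z = Some y, z' = Some y' & `|y - y'| < d]) \/ (far d z && far d z').

Lemma close_sym d z z' : close d z z' -> close d z' z.
Proof.
case=> [[y [y' [-> -> yy]]]|]; last by rewrite andbC; right.
by left; exists y', y; rewrite distrC.
Qed.

Lemma far_mono d d' z : 0 < d -> d <= d' -> far d z -> far d' z.
Proof.
move=> d0 dd; case: z => //= y; apply: le_lt_trans.
by rewrite lef_pV2 // posrE (lt_le_trans d0 dd).
Qed.

Lemma close_mono d d' z z' : 0 < d -> d <= d' -> close d z z' -> close d' z z'.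
Proof.
move=> d0 dd [[y [y' [-> -> yy]]]|/andP[f1 f2]]; last first.
  by right; rewrite !(far_mono d0 dd).
by left; exists y, y'; rewrite (lt_le_trans yy dd).
Qed.

Lemma far_near d y z : 0 < d -> d <= 1 / 2 -> far d z ->
  (exists2 y', z = Some y' & `|y - y'| < d) -> far (2 * d) (Some y).
Proof.
move=> d0 d2 fz [y' zy yy]; move: fz; rewrite zy /= => fy.
have h1 : `|y'| <= `|y| + `|y - y'| by rewrite -[X in `|X| <= _](subKr y) ler_normB.
rewrite invfM; have di : 0 < d^-1 by rewrite invr_gt0.
have dd : d * d^-1 = 1 by rewrite divff // gt_eqF.
have h2 : 2 <= d^-1.
  by rewrite -[2]invrK lef_pV2 ?posrE ?invr_gt0 // (le_trans d2) // ; lra.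
nra.
Qed.

(** If d is small, points far from the origin stay far, at twice the
    parameter. *)
Lemma close_trans d z z' z'' : 0 < d -> d <= 1 / 2 ->
  close d z z' -> close d z' z'' -> close (2 * d) z z''.
Proof.
move=> d0 d2; have dd : d <= 2 * d by lra.
case=> [[y [y' [-> -> yy]]]|/andP[f1 f2]].
  case=> [[y1 [y2 [[<-] -> yy2]]]|/andP[f3 f4]].
    left; exists y, y2; split=> //.
    by rewrite -[y - y2](subrKA y') (le_lt_trans (ler_normD _ _)) //; lra.
  right; rewrite (far_mono d0 dd f4) andbT; apply: far_near d0 d2 f3 _.
  by exists y'.
case=> [[y1 [y2 [e -> yy2]]]|/andP[f3 f4]]; last first.
  by right; rewrite !(far_mono d0 dd).
right; rewrite (far_mono d0 dd f1) /=; apply: (far_near d0 d2 f2).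
by exists y1; rewrite // distrC.
Qed.

Lemma far_open d : open [set z | far d z].
Proof.
have bc : [set y : R * R | `|y| <= d^-1] = `[- d^-1, d^-1 : R] `*` `[- d^-1, d^-1 : R].
  by apply/seteqP; split => y; rewrite /= norm_le !in_itv /= => /andP.
have cc : compact [set y : R * R | `|y| <= d^-1].
  by rewrite bc; apply: compact_setX; apply: segment_compact.
have cl : closed [set y : R * R | `|y| <= d^-1].
  by apply: compact_closed cc; exact: norm_hausdorff.
rewrite openE => -[y|] /= yb.
  have : nbhs y (~` [set y : R * R | `|y| <= d^-1]).
    apply: open_nbhs_nbhs; split; first exact/closed_openC.
    by move=> /=; rewrite leNgt yb.
  by apply: filterS => y' /= /negP; rewrite -ltNge.
exists [set y : R * R | `|y| <= d^-1]; first by split.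
by move=> z [[y' /= /negP yb' <-]|->] //=; rewrite ltNge.
Qed.

Lemma close_open d z0 : open [set z | close d z0 z].
Proof.
have -> : [set z | close d z0 z] =
    (if z0 is Some y then Some @` (ball y d) else set0) `|`
    (if far d z0 then [set z | far d z] else set0).
  apply/seteqP; split => z /=.
    case=> [[y [y' [-> -> yy]]]|/andP[-> fz]]; last by right.
    by left; exists y' => //; rewrite -ball_normE.
  case.
    by case: z0 => [y [y' + <-]|//]; rewrite -ball_normE => yy; left; exists y, y'.
  by case: (boolP (far d z0)) => // f0 fz; right; rewrite f0.
apply: openU.
  case: z0 => [y|]; last exact: open0.
  exact/one_point_compactification_open_some/ball_open.
by case: ifP => _; [exact: far_open|exact: open0].
Qed.

Lemma close_sep (z z' : sphere R) : z <> z' ->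
  exists2 e, 0 < e & forall d, 0 < d -> d <= e -> ~ close d z z'.
Proof.
have farF d (y : R * R) : 0 < d -> d <= (`|y| + 1)^-1 -> far d (Some y) = false.
  move=> d0 dy /=; apply/negbTE; rewrite -leNgt.
  have y1 : 0 < `|y| + 1 by rewrite ltr_pwDr.
  by move: dy; rewrite -[X in X <= _]invrK lef_pV2 ?posrE ?invr_gt0 //; lra.
have pos (y : R * R) : 0 < (`|y| + 1)^-1 by rewrite invr_gt0 ltr_pwDr.
case: z z' => [y|] [y'|] zz //.
- have yy : 0 < `|y - y'| by rewrite normr_gt0 subr_eq0; apply/eqP => e; apply: zz; rewrite e.
  exists (Num.min `|y - y'| (`|y| + 1)^-1); first by rewrite lt_min yy pos.
  move=> d d0; rewrite le_min => /andP[d1 d2].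
  case=> [[x [x' [[<-] [<-]]]]|]; first by rewrite ltNge d1.
  by rewrite farF.
- exists (`|y| + 1)^-1 => // d d0 dy [[x [x' [_ ?]]]|]; by rewrite ?farF.
- exists (`|y'| + 1)^-1 => // d d0 dy [[x [x' [?]]]|]; by rewrite ?farF ?andbF.
Qed.

Definition nearby (s : surf) (e : R) (x : holed) : Prop :=
  exists x1, proj x1 = s /\ close e (set_val x1) (set_val x).

Lemma circle_notin_disc k k' (y : R * R) : on_circleR k y -> ~~ in_disc k' y.
Proof.
move=> yk; apply/negP => /andP[h1 h2]; case: (yk) => a1 a2 a3.
have kk : k = k'.
  by apply: (close_hole (y := y) (y' := y) a1 _ _); rewrite ?subrr ?normr0 //; apply/andP; lra.
by subst k'; case: a3 => e; lra.
Qed.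

Lemma circle_bound k (y : R * R) : (k < 10)%N -> on_circleR k y -> `|y| <= 40.
Proof.
move=> k10 [h1 h2 _]; rewrite norm_le.
have : (4 * k)%:R <= 36%:R :> R by rewrite ler_nat; lia.
have : 0 <= (4 * k)%:R :> R by [].
by move=> h3 h4; apply/andP; split; apply/andP; split; lra.
Qed.

(** A circle that does not contain y0 has positive distance from it. *)
Lemma circle_gap (y0 : R * R) : exists2 r, 0 < r &
  forall k y, (k < 10)%N -> on_circleR k y -> `|y0 - y| < r -> on_circleR k y0.
Proof.
have one k : exists2 r, 0 < r & forall y, on_circleR k y -> `|y0 - y| < r -> on_circleR k y0.
  have [k0|k0] := pselect (on_circleR k y0); first by exists 1.
  exists `| `|y0 - centre R k| - 1|.
    by rewrite normr_gt0 subr_eq0; apply/eqP => /on_circleRP.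
  move=> y /on_circleRP ky; rewrite ltNge => /negP[].
  rewrite -ky; apply: le_trans (ler_dist_dist _ _) _.
  by rewrite opprB addrA subrK.
suff all n : exists2 r, 0 < r &
  forall k y, (k < n)%N -> on_circleR k y -> `|y0 - y| < r -> on_circleR k y0 by [].
elim: n => [|n [r r0 rP]]; first by exists 1.
have [r' r0' rP'] := one n; exists (Num.min r r'); first by rewrite lt_min r0.
move=> k y; rewrite ltnS leq_eqVlt lt_min => /orP[/eqP->|kn] yk /andP[a1 a2].
  exact: rP' yk a2.
exact: rP kn yk a1.
Qed.

(** For small e, a circle comes within e of a point over s only if it contains
    this point ([circle_gap]). The gluing map of the circle is an isometry, so
    it carries the estimate from a point of the circle to its twin. *)
Lemma saturated s : exists2 e0, 0 < e0 <= 1 / 100 & forall e, 0 < e -> e <= e0 ->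
  forall x x', proj x = proj x' -> nearby s e x -> nearby s e x'.
Proof.
have [x0 x0s] := proj_surj s.
(* The circles lie within distance 40 of the origin, so for e at most 1 / 100
   their points are not close to a point through infinity, nor to another
   circle. *)
have [e0 e00 e0P] : exists2 e0, 0 < e0 <= 1 / 100 &
    forall x1 y1 k y, proj x1 = s -> set_val x1 = Some y1 -> (k < 10)%N -> on_circleR k y ->
      `|y1 - y| < e0 -> exists2 k1, (k1 < 10)%N & on_circleR k1 y1.
  have [[k [y0 [k10 ky0 xy0]]]|no] := pselect (exists k y0,
      [/\ (k < 10)%N, on_circleR k y0 & set_val x0 = Some y0]).
    exists (1 / 100); first by lra.
    move=> x1 y1 k' y x1s x1y1 _ _ _; move: x1s; rewrite -x0s => /projE[x10|].
      by exists k => //; move: x1y1; rewrite x10 xy0 => -[<-].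
    move=> [k1 [z [k1lt zk1 x1z _]]]; exists k1 => //.
    by move: x1y1; rewrite x1z => -[<-].
  have fib x1 : proj x1 = s -> x1 = x0.
    rewrite -x0s => /projE[//|/twin_sym[k [y [k10 yk xy _]]]].
    by case: no; exists k, y.
  case xy0 : (set_val x0) no => [y0|] no; last first.
    by exists (1 / 100); [lra|move=> x1 y1 k y /fib->; rewrite xy0].
  have [r r0 rP] := circle_gap y0; exists (Num.min r (1 / 100)).
    by rewrite lt_min r0 /= ge_min lexx orbT andbT; lra.
  move=> x1 y1 k y /fib->; rewrite xy0 => -[<-] k10 yk; rewrite lt_min => /andP[yr _].
  by exists k => //; apply: rP yr.
exists e0 => // e ep ee x x' /projE[<-//|[k [y [k10 yk xy xy']]]] [x1 [x1s]].
have eb : e <= 1 / 100 by case/andP: e00; lra.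
case=> [[y1 [y2 [x1y1]]]|/andP[_]]; last first.
  rewrite xy /= ltNge (le_trans (circle_bound k10 yk)) //.
  by rewrite -[40]invrK lef_pV2 ?posrE ?invr_gt0 //; lra.
rewrite xy => -[<-] yy.
have [k1 k1lt y1k] := e0P _ _ _ _ x1s x1y1 k10 yk (lt_le_trans yy ee).
have kk : k1 = k.
  by case: y1k yk => a1 _ _ [a2 _ _]; apply: (close_hole a1 a2); lra.
subst k1; have [x1' x1'y] : exists z : holed, set_val z = Some (glue_map hd k y1).
  by apply: holed_point => k' z _ [<-]; apply: circle_notin_disc (glue_map_circle hd y1k).
exists x1'; split.
  rewrite -x1s; apply/projE; right; apply: twin_sym.
  by exists k, y1; split.
left; exists (glue_map hd k y1), (glue_map hd k y); split=> //.
by rewrite glue_map_isom.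
Qed.

(** By [saturated] these sets are inverse images of subsets of the surface,
    and they are open in the sphere with holes. *)
Lemma nearby_nbhs s : exists2 e0, 0 < e0 <= 1 / 100 &
  (forall e, 0 < e -> e <= e0 -> nbhs s [set t | exists2 x, proj x = t & nearby s e x]) /\
  (forall e, 0 < e -> e <= e0 ->
     forall x x', proj x = proj x' -> nearby s e x -> nearby s e x').
Proof.
have [e0 e00 sat] := saturated s; exists e0 => //; split=> // e ep ee.
apply: open_nbhs_nbhs; split; last first.
  have [x0 x0s] := proj_surj s; exists x0 => //; exists x0; split=> //.
  case: (set_val x0) => [y|]; last by right.
  by left; exists y, y; rewrite subrr normr0.
set U := (X in open X).
have -> : open U = open (proj @^-1` U) by [].
have -> : proj @^-1` U = \bigcup_(x1 in [set x1 | proj x1 = s])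
    set_val @^-1` [set z | close e (set_val x1) z].
  apply/seteqP; split => x /=.
    by move=> [x' /sat st /(st e ep ee)[x1 [x1s x1x]]]; exists x1.
  by move=> [x1 /= x1s x1x]; exists x => //; exists x1.
apply: bigcup_open => x1 _; apply: open_comp; last exact: close_open.
by move=> x _; exact: initial_continuous.
Qed.

Lemma fibre2 s : exists x0 x1 : holed, forall x, proj x = s -> x = x0 \/ x = x1.
Proof.
have [x0 x0s] := proj_surj s.
have [[x1 x01]|no] := pselect (exists x1, twin hd x0 x1).
  exists x0, x1 => x; rewrite -x0s => /esym/projE[->|tw]; first by left.
  by right; apply: (twin_trans (twin_sym tw) x01).
exists x0, x0 => x; rewrite -x0s => /esym/projE[->|tw]; first by left.
by case: no; exists x.
Qed.

Lemma fibres_sep s s' : s <> s' -> exists2 e, 0 < e & forall d, 0 < d -> d <= e ->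
  forall x x', proj x = s -> proj x' = s' -> ~ close d (set_val x) (set_val x').
Proof.
move=> ss.
have one (x x' : holed) : exists2 e, 0 < e & forall d, 0 < d -> d <= e ->
    proj x = s -> proj x' = s' -> ~ close d (set_val x) (set_val x').
  have [e|xx] := pselect (set_val x = set_val x').
    exists 1 => // d _ _ xs xs'; case: ss; rewrite -xs -xs'; congr proj.
    by apply: val_inj; rewrite -!set_valE.
  by have [e e0 eP] := close_sep xx; exists e => // d d0 de _ _; apply: eP.
have [x0 [x1 x01]] := fibre2 s; have [x0' [x1' x01']] := fibre2 s'.
have [e1 p1 P1] := one x0 x0'; have [e2 p2 P2] := one x0 x1'.
have [e3 p3 P3] := one x1 x0'; have [e4 p4 P4] := one x1 x1'.
exists (Num.min (Num.min e1 e2) (Num.min e3 e4)); first by rewrite !lt_min p1 p2 p3 p4.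
move=> d d0; rewrite !le_min => /andP[/andP[d1 d2] /andP[d3 d4]] x x' xs xs'.
have [xE|xE] := x01 x xs; have [xE'|xE'] := x01' x' xs'; subst x x'.
- exact: P1.
- exact: P2.
- exact: P3.
- exact: P4.
Qed.

Definition mesh (n : nat) := n.+1.
(** While the steps shrink to 0, the box, of half side n + 50, exhausts the
    plane. *)
Definition hbox (n : nat) := (n.+1 * (n + 50))%N.

Lemma mesh_gt0 n : (0 < mesh n)%N. Proof. by []. Qed.
Lemma hbox_ge n : (41 * mesh n <= hbox n)%N.
Proof. by rewrite /hbox mulnC leq_mul2l; apply/orP; right; lia. Qed.

Lemma hboxR n : (hbox n)%:R / (mesh n)%:R = n%:R + 50 :> R.
Proof. by rewrite /hbox natrM mulrAC divff ?mul1r ?natrD // pnatr_eq0. Qed.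

Lemma star_near n (x : holed) q : @star R (mesh n) (hbox n) q (set_val x) ->
  close (n.+1%:R^-1) (set_val x) (Some (gpos R (mesh n) q)).
Proof.
have n0 : 0 < (mesh n)%:R :> R by rewrite ltr0n.
have nE : n.+1%:R = n%:R + 1 :> R by rewrite natr1.
have bdry_far q' : bdry q' -> far (n.+1%:R^-1) (Some (gpos R (mesh n) (q' : pt (hbox n)))).
  move=> qb /=; rewrite invrK ltNge norm_le; apply/negP => /andP[/andP[h1 h2] /andP[h3 h4]].
  move: h1 h2 h3 h4; rewrite /gpos /= !mulrBl hboxR nE => h1 h2 h3 h4.
  have WE : (side (hbox n))%:R / (n%:R + 1) = 2 * (n%:R + 50) :> R.
    by rewrite -nE sideR -mulrA hboxR.
  by case/or4P: qb => /eqP qe; move: h1 h2 h3 h4; rewrite qe ?WE ?mulr0n ?mul0r; lra.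
rewrite /star; case xy : (set_val x) => [y|]; last by move=> qb; right; rewrite bdry_far.
case/orP => [|/andP[qb yb]].
  by rewrite (instarE (mesh_gt0 n)) distrC => qy; left; exists y, (gpos R (mesh n) q).
right; rewrite bdry_far // andbT /= invrK ltNge; apply/negP => yn.
move/negP: yb; apply; have := @box_segments R (mesh n) (hbox n) (mesh_gt0 n).
move=> /seteqP[_ /(_ y)] /=; rewrite !in_itv /= hboxR; apply.
move: yn; rewrite norm_le nE => /andP[/andP[h1 h2] /andP[h3 h4]].
by split; apply/andP; split; lra.
Qed.

(** If a grid point saw points near s and near s', it would be close to both
    fibres; passing between the points over one point of the surface
    ([saturated]) and between points and centres of stars at most doubles the
    parameter each time. *)
Lemma star_sep (s s' : surf) : s <> s' -> exists U U' : set surf, [/\ nbhs s U, nbhs s' U' &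
  \forall n \near \oo, forall t t' p, U t -> U' t' ->
    ~ (@star_at R hd (mesh n) (hbox n) p t /\ @star_at R hd (mesh n) (hbox n) p t')].
Proof.
move=> ss; have [e0 e00 [nb0 sat0]] := nearby_nbhs s.
have [e1 e10 [nb1 sat1]] := nearby_nbhs s'.
have [e2 e20 fs] := fibres_sep ss.
have [/andP[p0 h0] /andP[p1 h1]] := (e00, e10).
(* Three doublings lead from e to 8 e. *)
pose e := Num.min (Num.min e0 e1) e2 / 16.
have [ep [ea [eb ec]]] : 0 < e /\ e * 16 <= e0 /\ e * 16 <= e1 /\ e * 16 <= e2.
  have m0 : 0 < Num.min (Num.min e0 e1) e2 by rewrite !lt_min p0 p1 e20.
  rewrite /e mulfVK // divr_gt0 // !ge_min !lexx ?orbT; split=> //.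
have [e1' e2' e3' e4'] : [/\ e <= 1 / 2, 2 * e <= 1 / 2, 2 * (2 * e) <= 1 / 2 & 2 * (2 * (2 * e)) <= e2].
  by split; lra.
have [l0 l0' l1] : [/\ e <= e0, 2 * e <= e0 & e <= e1] by split; lra.
have [q1 q2 q3] : [/\ 0 < 2 * e, 0 < 2 * (2 * e) & 0 < 2 * (2 * (2 * e))] by split; lra.
have [m1 m2] : e <= 2 * e /\ e <= 2 * (2 * e) by split; lra.
exists [set t | exists2 x, proj x = t & nearby s e x],
  [set t | exists2 x, proj x = t & nearby s' e x]; split.
- exact: nb0.
- exact: nb1.
near=> n => t t' p [x xt xN] [x' xt' xN'] [[y [q [yt qp sq]]] [y' [q' [yt' qp' sq']]]].
have de : n.+1%:R^-1 <= e.
  by apply: ltW; near: n; exact: near_infty_natSinv_lt (PosNum ep).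
have d0 : 0 < n.+1%:R^-1 :> R by rewrite invr_gt0 ltr0n.
have [g gE] := gpos_holed (mesh_gt0 n) (hbox_ge n) sq.
have [g' gE'] := gpos_holed (mesh_gt0 n) (hbox_ge n) sq'.
have gg : proj g = proj g'.
  by apply: (rho_gpos (mesh_gt0 n) (hbox_ge n) _ gE gE'); rewrite qp qp'.
have Nstep d u v : 0 < d -> e <= d -> d <= 1 / 2 -> nearby s d u ->
    close (n.+1%:R^-1) (set_val u) (set_val v) -> nearby s (2 * d) v.
  move=> dp ed d2 [w [ws wu]] uv; exists w; split=> //.
  apply: close_trans dp d2 wu _; apply: close_mono uv => //; exact: le_trans de ed.
have yN : nearby s e y by apply: (sat0 e ep l0 x y) => //; rewrite xt yt.
have gN : nearby s (2 * e) g.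
  by apply: Nstep yN _ => //; rewrite gE; exact: star_near.
have gN' : nearby s (2 * e) g'.
  exact: (sat0 (2 * e) q1 l0' g g').
have [w [ws wy]] : nearby s (2 * (2 * e)) y'.
  by apply: Nstep gN' _ => //; rewrite gE'; apply: close_sym; exact: star_near.
have [w' [ws' wy']] : nearby s' e y' by apply: (sat1 e ep l1 x' y') => //; rewrite xt' yt'.
apply: (fs (2 * (2 * (2 * e))) q3 e4' w w' ws ws').
apply: (close_trans q2 e3' wy).
exact: close_mono ep m2 (close_sym wy').
Unshelve. all: by end_near. Qed.

End Separation.

(** * The edge bound for embedded graphs *)

Section Thick.
Variables (R : realType) (hd : bool).
Local Notation surf := (surf R hd).
Local Notation stars n := (@star_at R hd (mesh n) (hbox n)).

Definition thick n (P : set surf) : {set pt (hbox n)} :=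
  [set p | `[< exists2 s, P s & stars n p s >]]%SET.

Lemma thickP n P p : reflect (exists2 s, P s & stars n p s) (p \in thick n P).
Proof. by rewrite inE; apply: asboolP. Qed.

Local Notation radjn n := (radj (@ksrc hd (mesh n) (hbox n)) (@ktgt hd (mesh n) (hbox n))
  (@good hd (mesh n) (hbox n))).

Lemma radj_mono n (S S' : {set pt (hbox n)}) p q : S \subset S' ->
  connect (radjn n S) p q -> connect (radjn n S') p q.
Proof.
move=> /fintype.subsetP SS; apply: connect_sub => x y /and3P[xS yS xy].
by apply: connect1; rewrite /radj !SS.
Qed.

(** If the grid points that see P fell into two parts without a connection,
    the unions of their stars would be open sets that cover P and are disjoint
    in P, because the grid points that see one point are connected. *)
Lemma thick_conn n P : connected P ->
  connected_in (@ksrc hd (mesh n) (hbox n)) (@ktgt hd (mesh n) (hbox n))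
    (@good hd (mesh n) (hbox n)) (thick n P).
Proof.
move=> cP p0 q0 p0S q0S; set S := thick n P in p0S q0S *.
have ptsS s : P s -> star_pts (mesh n) (hbox n) s \subset S.
  by move=> Ps; apply/fintype.subsetP => p; rewrite inE => /asboolP ps; apply/thickP; exists s.
have pconn s p q : P s -> stars n p s -> stars n q s -> connect (radjn n S) p q.
  move=> Ps ps qs; apply: radj_mono (ptsS s Ps) _.
  by apply: (star_pts_conn (mesh_gt0 n) (hbox_ge n)); rewrite inE; apply/asboolP.
have csym := sym_connect_sym (@radj_sym _ _ (@ksrc hd (mesh n) (hbox n))
  (@ktgt hd (mesh n) (hbox n)) (@good hd (mesh n) (hbox n)) S).
pose U1 := \bigcup_(p in [set p | connect (radjn n S) p0 p]) [set s | stars n p s].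
pose U2 := \bigcup_(p in [set p | ~~ connect (radjn n S) p0 p]) [set s | stars n p s].
have oU Q : open (\bigcup_(p in Q) [set s | stars n p s]).
  by apply: bigcup_open => p _; apply: star_at_open; [exact: mesh_gt0|exact: hbox_ge].
have dis s : P s -> U1 s -> ~ U2 s.
  move=> Ps [p /= p0p ps] [q /= /negP p0q qs]; apply: p0q.
  exact: connect_trans p0p (pconn s p q Ps ps qs).
have cov s : P s -> U1 s \/ U2 s.
  move=> Ps; have [p ps] := @star_pts_neq0 R hd _ _ (mesh_gt0 n) (hbox_ge n) s.
  have {}ps : stars n p s by move: ps; rewrite inE => /asboolP.
  case: (boolP (connect (radjn n S) p0 p)) => cp; [by left; exists p|by right; exists p].
have /thickP[s0 Ps0 ps0] := p0S; have /thickP[s1 Ps1 qs1] := q0S.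
have PU1 : P `&` U1 = P.
  apply: cP; first by exists s0; split=> //; exists p0; rewrite /=.
  - by exists U1; [exact: oU|].
  - exists (~` U2); first exact/open_closedC/oU.
    apply/seteqP; split => s [Ps]; first by move=> /(dis _ Ps).
    by case: (cov _ Ps).
have [_ [p /= p0p ps]] : (P `&` U1) s1 by rewrite PU1.
exact: connect_trans p0p (pconn s1 _ _ Ps1 ps qs1).
Qed.

(** By [star_sep] two distinct points have neighbourhoods that are separated
    for almost all n; compactness makes n uniform, first in Q and then in
    P. *)
Lemma compact_sep (P Q : set surf) : compact P -> compact Q ->
  (forall s, P s -> Q s -> False) ->
  \forall n \near \oo, forall p, p \in thick n P -> p \in thick n Q -> False.
Proof.
move=> /compact_near_coveringP cP /compact_near_coveringP cQ PQ.
pose bad n (s s' : surf) := forall p, ~ (stars n p s /\ stars n p s').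
have one s : P s -> \forall x \near s & n \near \oo, Q `<=` bad n x.
  move=> Ps.
  have H : \forall i \near filter_prod (nbhs s) \oo, Q `<=` (fun s' => bad i.2 i.1 s').
    apply: cQ => s' Qs'.
    have ss : s <> s' by move=> e; apply: (PQ s) => //; rewrite e.
    have [U [U' [nU nU' nn]]] := star_sep ss.
    exists (U', (U `*` [set n | forall t t' p, U t -> U' t' -> ~ (stars n p t /\ stars n p t')])) => /=.
      by split=> //; exists (U, [set n | forall t t' p, U t -> U' t' -> ~ (stars n p t /\ stars n p t')]).
    by move=> [z [x n]] /= [U'z [Ux nP]] p; apply: nP.
  exact: H.
have H : \forall n \near \oo, P `<=` (fun s => Q `<=` bad n s) by apply: cP.
near=> n => p /thickP[s Ps ps] /thickP[s' Qs' ps'].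
have Hn : P `<=` (fun s => Q `<=` bad n s) by near: n.
by apply: (Hn s Ps s' Qs' p).
Unshelve. all: by end_near. Qed.

End Thick.

Section Embedded.
Variables (R : realType) (hd : bool) (V I : finType) (a b : I -> V).
Local Notation surf := (surf R hd).
Variables (f : V -> surf) (g : I -> R -> surf).
Hypothesis ab : forall i, a i != b i.
Hypothesis simple : forall i j, [set a i; b i]%SET = [set a j; b j]%SET -> i = j.
Hypothesis f_inj : injective f.
Hypothesis g_cont : forall i, {within `[0, 1], continuous (g i)}.
Hypothesis g_inj : forall i, {in `[0, 1] &, injective (g i)}.
Hypothesis g0 : forall i, g i 0 = f (a i).
Hypothesis g1 : forall i, g i 1 = f (b i).
Hypothesis g_vertex : forall i t w, t \in `[0, 1] -> g i t = f w -> w = a i \/ w = b i.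
Hypothesis g_cross : forall i j t t', i != j -> t \in `[0, 1] -> t' \in `[0, 1] ->
  g i t = g j t' -> exists w, g i t = f w.

Definition middle i : set surf := g i @` `[1 / 3, 2 / 3].
(** A limb of v is v itself or the third of an edge next to its end v; [false]
    and [true] stand for the initial and the final third. *)
Definition limb (j : option (I * bool)) (v : V) : set surf :=
  match j with
  | None => [set f v]
  | Some (i, false) => g i @` `[0, 1 / 3]
  | Some (i, true) => g i @` `[2 / 3, 1]
  end.
Definition at_vertex (v : V) : {set option (I * bool)} :=
  [set j | match j with
           | None => true
           | Some (i, false) => a i == v
           | Some (i, true) => b i == v
           end]%SET.
(** A vertex with the adjacent thirds of its edges. The spiders are pairwise
    disjoint, so they can serve as branch sets, and the middle thirds connect
    them. *)
Definition spider (v : V) : set surf := \bigcup_(j in [set` at_vertex v]) limb j v.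

Lemma not_high0 (t : R) : 2 / 3 <= t -> t = 0 -> False.
Proof. by move=> ? ?; lra. Qed.

Lemma not_low1 (t : R) : t <= 1 / 3 -> t = 1 -> False.
Proof. by move=> ? ?; lra. Qed.

Lemma not_mid (t : R) : 1 / 3 <= t -> t <= 2 / 3 -> t = 0 \/ t = 1 -> False.
Proof. by move=> ? ? []; lra. Qed.

Lemma not_low_high (t : R) : 2 / 3 <= t -> t <= 1 / 3 -> False.
Proof. by move=> ? ?; lra. Qed.

Lemma sub01 (x y : R) : 0 <= x -> y <= 1 -> `[x, y] `<=` `[0, 1 : R].
Proof. by move=> x0 y1 t; rewrite /= !in_itv /= => /andP[? ?]; apply/andP; lra. Qed.

Lemma arc_compact i (x y : R) : 0 <= x -> y <= 1 -> compact (g i @` `[x, y]).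
Proof.
move=> x0 y1; apply: continuous_compact; last exact: segment_compact.
by apply: (continuous_subspaceW _ (@g_cont i)); exact: sub01.
Qed.

Lemma arc_connected i (x y : R) : 0 <= x -> y <= 1 -> connected (g i @` `[x, y]).
Proof.
move=> x0 y1; apply: connected_continuous_connected; first exact: segment_connected.
by apply: (continuous_subspaceW _ (@g_cont i)); exact: sub01.
Qed.

Lemma limb_compact j v : compact (limb j v).
Proof.
case: j => [[i []]|] /=; [|by apply: arc_compact; lra|exact: compact_set1].
by apply: arc_compact; lra.
Qed.

Lemma limb_connected j v : connected (limb j v).
Proof.
case: j => [[i []]|] /=; [|by apply: arc_connected; lra|exact: connected1].
by apply: arc_connected; lra.
Qed.

Lemma limb_vertex j v : j \in at_vertex v -> limb j v (f v).
Proof.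
rewrite inE; case: j => [[i []]|] //= /eqP <-.
  by exists 1; rewrite ?g1 //= in_itv /=; apply/andP; lra.
by exists 0; rewrite ?g0 //= in_itv /=; apply/andP; lra.
Qed.

Lemma spider_compact v : compact (spider v).
Proof.
by rewrite /spider bigcup_pred; apply: bigsetU_compact => j _; exact: limb_compact.
Qed.

Lemma spider_connected v : connected (spider v).
Proof.
apply: bigcup_connected => [|j _]; last exact: limb_connected.
by exists (f v) => j /limb_vertex.
Qed.

Lemma at_end i t w : t \in `[0, 1] -> g i t = f w ->
  (t = 0 /\ w = a i) \/ (t = 1 /\ w = b i).
Proof.
move=> t01 gw; have z0 : (0 : R) \in `[0, 1] by rewrite in_itv /=; apply/andP; lra.
have z1 : (1 : R) \in `[0, 1] by rewrite in_itv /=; apply/andP; lra.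
case: (g_vertex t01 gw) => wE; rewrite wE in gw *.
  by left; split=> //; apply: (g_inj (i := i)) => //; rewrite g0.
by right; split=> //; apply: (g_inj (i := i)) => //; rewrite g1.
Qed.

Lemma limb_middle j v i s : j \in at_vertex v -> limb j v s -> middle i s ->
  v = a i \/ v = b i.
Proof.
move=> jv js [t]; rewrite /= in_itv /= => /andP[t1 t2] ts.
have t01 : t \in `[0, 1] by rewrite in_itv /=; apply/andP; lra.
have no w : g i t = f w -> False by case/(at_end t01) => -[e _]; apply: not_mid t1 t2 _; auto.
case: j jv js => [[k []]|] /=; rewrite inE; last first.
- by move=> _ sv; case: (no v); rewrite ts.
- move=> /eqP <- [u]; rewrite /= in_itv /= => /andP[u1 u2] us.
  have [->|ki] := eqVneq k i; first by left.
  have u01 : u \in `[0, 1] by rewrite in_itv /=; apply/andP; lra.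
  have ik : i != k by rewrite eq_sym.
  have [|w gw] := @g_cross i k t u ik t01 u01; first by rewrite ts us.
  by case: (no w gw).
- move=> /eqP <- [u]; rewrite /= in_itv /= => /andP[u1 u2] us.
  have [->|ki] := eqVneq k i; first by right.
  have u01 : u \in `[0, 1] by rewrite in_itv /=; apply/andP; lra.
  have ik : i != k by rewrite eq_sym.
  have [|w gw] := @g_cross i k t u ik t01 u01; first by rewrite ts us.
  by case: (no w gw).
Qed.

Lemma middle_disj i j s : i != j -> middle i s -> middle j s -> False.
Proof.
move=> ij [t]; rewrite /= in_itv /= => /andP[t1 t2] ts [u].
rewrite /= in_itv /= => /andP[u1 u2] us.
have t01 : t \in `[0, 1] by rewrite in_itv /=; apply/andP; lra.
have u01 : u \in `[0, 1] by rewrite in_itv /=; apply/andP; lra.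
have [|w gw] := @g_cross i j t u ij t01 u01; first by rewrite ts us.
by case: (at_end t01 gw) => -[e _]; apply: not_mid t1 t2 _; auto.
Qed.

Lemma limb_end j v w : j \in at_vertex v -> limb j v (f w) -> w = v.
Proof.
rewrite inE; case: j => [[k []]|] /=; last by move=> _ /f_inj.
- move=> /eqP <- [u]; rewrite /= in_itv /= => /andP[u1 u2].
  have u01 : u \in `[0, 1] by rewrite in_itv /=; apply/andP; lra.
  by case/(at_end u01) => -[e -> //]; case: (not_high0 u1 e).
- move=> /eqP <- [u]; rewrite /= in_itv /= => /andP[u1 u2].
  have u01 : u \in `[0, 1] by rewrite in_itv /=; apply/andP; lra.
  by case/(at_end u01) => -[e -> //]; case: (not_low1 u2 e).
Qed.

Lemma limb_disj j j' v v' s : j \in at_vertex v -> j' \in at_vertex v' ->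
  limb j v s -> limb j' v' s -> v = v'.
Proof.
move=> jv jv' js js'.
have [[w sw]|no] := pselect (exists w, s = f w).
  by rewrite sw in js js'; rewrite -(limb_end jv js) -(limb_end jv' js').
have par j0 v0 : j0 \in at_vertex v0 -> limb j0 v0 s -> exists i h t,
    [/\ j0 = Some (i, h), t \in `[0, 1], g i t = s, v0 = (if h then b i else a i) &
        if h then 2 / 3 <= t else t <= 1 / 3].
  rewrite inE; case: j0 => [[k []]|] /=.
  - move=> /eqP <- [u]; rewrite /= in_itv /= => /andP[u1 u2] us.
    by exists k, true, u; split=> //; rewrite in_itv /=; apply/andP; lra.
  - move=> /eqP <- [u]; rewrite /= in_itv /= => /andP[u1 u2] us.
    by exists k, false, u; split=> //; rewrite in_itv /=; apply/andP; lra.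
  - by move=> _ sv; case: no; exists v0.
have [i [h [t [_ t01 ts vE th]]]] := par _ _ jv js.
have [i' [h' [t' [_ t01' ts' vE' th']]]] := par _ _ jv' js'.
have [ii|ii] := eqVneq i i'; last first.
  have [|w gw] := @g_cross i i' t t' ii t01 t01'; first by rewrite ts ts'.
  by case: no; exists w; rewrite -ts.
subst i'; have tt : t = t' by apply: (g_inj (i := i)) => //; rewrite ts ts'.
subst t'; rewrite vE vE'; case: h h' th th' {vE vE'} => -[] // th th'.
  by case: (not_low_high th th').
by case: (not_low_high th' th).
Qed.

(** Spiders and middle thirds are connected and compact, and they meet only as
    the incidences of the graph prescribe. On a fine grid this remains true of
    the grid points that see them. *)
Lemma embedded_edge_bound : V -> (#|I| + 6 <= 3 * (#|V| + 10))%N.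
Proof.
move=> v0.
have H1 : \forall n \near \oo, forall u v : V, u != v ->
    forall p, p \in thick n (spider u) -> p \in thick n (spider v) -> False.
  apply: filter_forall => u; apply: filter_forall => v.
  have [->|uv] := eqVneq u v; first by near=> n.
  have dis s : spider u s -> spider v s -> False.
    move=> [j /= ju us] [j' /= jv vs]; move/eqP: uv; apply.
    exact: limb_disj ju jv us vs.
  have := compact_sep (@spider_compact u) (@spider_compact v) dis.
  by apply: filterS => n H _.
have mc i : compact (middle i) by apply: arc_compact; lra.
have H2 : \forall n \near \oo, forall i j : I, i != j ->
    forall p, p \in thick n (middle i) -> p \in thick n (middle j) -> False.
  apply: filter_forall => i; apply: filter_forall => j.
  have [->|ij] := eqVneq i j; first by near=> n.
  have := compact_sep (mc i) (mc j) (fun s => @middle_disj i j s ij).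
  by apply: filterS => n H _.
have H3 : \forall n \near \oo, forall (i : I) (v : V), (v != a i) && (v != b i) ->
    forall p, p \in thick n (middle i) -> p \in thick n (spider v) -> False.
  apply: filter_forall => i; apply: filter_forall => v.
  have [vi|vi] := boolP ((v != a i) && (v != b i)); last by near=> n.
  have dis s : middle i s -> spider v s -> False.
    move=> ms [j /= jv js]; case/andP: vi => /eqP va /eqP vb.
    by case: (limb_middle jv js ms).
  have := compact_sep (mc i) (@spider_compact v) dis.
  by apply: filterS => n H _.
have [n [h1 h2 h3]] : exists n, [/\ forall u v : V, u != v ->
      forall p, p \in thick n (spider u) -> p \in thick n (spider v) -> False,
    forall i j : I, i != j ->
      forall p, p \in thick n (middle i) -> p \in thick n (middle j) -> False &
    forall (i : I) (v : V), (v != a i) && (v != b i) ->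
      forall p, p \in thick n (middle i) -> p \in thick n (spider v) -> False].
  by near \oo => n; exists n; split; near: n.
have [s sP] := grid_hom hd (mesh_gt0 n) (hbox_ge n).
have touch i (t : R) v j : j \in at_vertex v -> limb j v (g i t) -> t \in `[1 / 3, 2 / 3] ->
    exists p, p \in (thick n (middle i) :&: thick n (spider v))%SET.
  move=> jv jt t12; have [p pt] := @star_pts_neq0 R hd _ _ (mesh_gt0 n) (hbox_ge n) (g i t).
  exists p; rewrite finset.in_setI; move: pt; rewrite inE => /asboolP pt.
  apply/andP; split; apply/thickP; exists (g i t) => //; first by exists t.
  by exists j.
apply: (@thick_edge_bound _ _ _ (@ksrc hd (mesh n) (hbox n)) (@ktgt hd (mesh n) (hbox n))
  (@side1 (mesh n) (hbox n)) (@side2 hd (mesh n) (hbox n)) (@good hd (mesh n) (hbox n))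
  V I a b (fun v => thick n (spider v)) (fun i => thick n (middle i)) ab simple
  _ _ _ _ _ _ _ _ 10%N {ffun 'I_10 -> bool} s) => //.
- by move=> v; apply: thick_conn; exact: spider_connected.
- by move=> i; apply: thick_conn; apply: arc_connected; lra.
- move=> u v p pu pv; apply/eqP; apply: contraT => uv; case: (h1 u v uv p pu pv).
- move=> i j p pi pj; apply/eqP; apply: contraT => ij; case: (h2 i j ij p pi pj).
- move=> i v p pi pv; have [->|va] := eqVneq v (a i); first by left.
  have [->|vb] := eqVneq v (b i); first by right.
  by case: (h3 i v _ p pi pv); rewrite va.
- move=> i; apply: (touch i (1 / 3) _ (Some (i, false))).
  + by rewrite inE.
  + by exists (1 / 3) => //=; rewrite in_itv /=; apply/andP; lra.
  + by rewrite in_itv /=; apply/andP; lra.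
- move=> i; apply: (touch i (2 / 3) _ (Some (i, true))).
  + by rewrite inE.
  + by exists (2 / 3) => //=; rewrite in_itv /=; apply/andP; lra.
  + by rewrite in_itv /=; apply/andP; lra.
- by move=> w p; apply: grid_dd; [exact: mesh_gt0|exact: hbox_ge].
- by rewrite card_ffun card_bool card_ord.
Unshelve. all: by end_near. Qed.

End Embedded.

(** * The theorem *)

(** The graph induced by W is embedded too; it has one edge for each arc
    because the digraph is oriented. *)
Lemma embeddable_arcs (R : realType) (hd : bool) (V : finType) (d : rel V) (W : {set V}) :
  oriented d -> embeddable R (surf R hd) (underlying d) -> W != finset.set0 ->
  (size_arcs d W <= 3 * #|W| + 24)%N.
Proof.
move=> orient [f [A [f_inj curve vert cross]]] /finset.set0Pn[v0 v0W].
pose I := {p : V * V | p \in arcs d W}; pose VW := {v : V | v \in W}.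
have arc (i : I) : [/\ (val i).1 \in W, (val i).2 \in W & d (val i).1 (val i).2].
  by case: i => -[u v] /= h; move: h; rewrite finset.inE => /and3P.
have aW (i : I) : (val i).1 \in W by case: (arc i).
have bW (i : I) : (val i).2 \in W by case: (arc i).
have arcd (i : I) : d (val i).1 (val i).2 by case: (arc i).
have arcu (i : I) : underlying d (val i).1 (val i).2 by rewrite /underlying arcd.
pose a (i : I) : VW := exist _ (val i).1 (aW i); pose b (i : I) : VW := exist _ (val i).2 (bW i).
pose B (i : I) : {set V} := [set (val i).1; (val i).2]%SET.
have /boolp.choice[g gP] (i : I) : exists g : R -> surf R hd,
    [/\ {within `[0, 1], continuous g}, {in `[0, 1] &, injective g},
      g 0 = f (val i).1, g 1 = f (val i).2 & A (B i) = g @` `[0, 1]] by exact: curve.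
have Ag (i : I) t : t \in `[0, 1] -> A (B i) (g i t).
  by case: (gP i) => _ _ _ _ ->; exists t.
have B_inj (i j : I) : B i = B j -> i = j.
  move=> E; apply/val_inj; have := arcd i; have := arcd j; move: E; rewrite /B.
  case: (val i) (val j) => [u v] [u' v'] /= E uv' uv.
  have nl (x y : V) : d x y -> x != y.
    by apply: contraTneq => ->; apply/negP => yy; have := orient _ _ yy; rewrite yy.
  have := congr1 (fun X : {set V} => u \in X) E; have := congr1 (fun X : {set V} => v \in X) E.
  rewrite /= !finset.inE !eqxx orbT /= => /esym/orP[] /eqP vE /esym/orP[] /eqP uE.
  - by have := nl _ _ uv; rewrite uE vE eqxx.
  - by have := orient _ _ uv; rewrite uE vE uv'.
  - by rewrite uE vE.
  - by have := nl _ _ uv; rewrite uE vE eqxx.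
have -> : size_arcs d W = #|{: I}| by rewrite card_sig.
have -> : #|W| = #|{: VW}| by rewrite card_sig.
have bound : V -> (#|{: I}| + 6 <= 3 * (#|{: VW}| + 10))%N.
  move=> _; apply: (@embedded_edge_bound R hd _ _ a b (f \o val) g _ _ _ _ _ _ _ _ _ (exist _ v0 v0W)).
  - move=> i; apply/eqP => /(congr1 val) /= E; have := arcd i; rewrite E => dd.
    by have := orient _ _ dd; rewrite dd.
  - move=> i j E; apply: B_inj; have := congr1 (fun X : {set VW} => val @: X)%SET E.
    by rewrite !imsetU1 !imset_set1.
  - by move=> x y /f_inj/val_inj.
  - by move=> i; case: (gP i).
  - by move=> i; case: (gP i).
  - by move=> i; case: (gP i).
  - by move=> i; case: (gP i).
  - move=> i t w tI gt; have := Ag i t tI; rewrite gt /= => /(vert _ _ _ (arcu i)).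
    by rewrite !finset.inE => /orP[] /eqP E; [left|right]; apply: val_inj.
  - move=> i j t t' ij tI t'I gg.
    have BB : B i != B j by apply: contraNneq ij => /B_inj->.
    have [|w + wE] := cross _ _ _ _ (arcu i) (arcu j) BB (g i t).
      by split; [exact: Ag | rewrite gg; exact: Ag].
    rewrite /= finset.in_setI => /andP[wB _].
    have wW : w \in W by move: wB; rewrite !finset.inE => /orP[] /eqP->; [exact: aW | exact: bW].
    by exists (exist _ w wW); rewrite /= wE.
have := bound v0; lia.
Qed.

Theorem theorem3p7 (R : realType) (V : finType) (d : rel V) :
  oriented d ->
  embeddable R (sphere_handles R 5) (underlying d) \/
  embeddable R (sphere_crosscaps R 10) (underlying d) ->
  dicolourable 4 d.
Proof.
move=> orient emb.
have sparse W : W != finset.set0 -> (size_arcs d W <= 3 * #|W| + 24)%N.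
  by case: emb => emb; [exact: (@embeddable_arcs R true) | exact: (@embeddable_arcs R false)].
have /dicolP[c cP] := sparse_dicol4 orient sparse [set: V]%SET.
exists c => i p p0 pA /andP[cyc_p _]; apply: acyclic_no_cycle (cP i) p0 _ cyc_p.
by move=> v /pA; rewrite !finset.inE.
Qed.
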